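(* Clique-Identification is NP-complete, and it does not admit a polynomial kernel when parameterized by $k$ unless $\mathsf{coNP}\subseteq\mathsf{NP/poly}$. Both results hold even when the input graph is connected.
   Context: All graphs are finite, simple and undirected. An identification of two distinct vertices $u,v$ replaces them with a new vertex adjacent to every vertex of $(N(u)\cup N(v))\setminus\{u,v\}$. Clique-Identification takes as input a graph $G$ and an integer $k\ge 0$ and asks whether $G$ can be transformed into a complete graph by at most $k$ identifications. A polynomial kernel is a polynomial-time algorithm mapping each instance $(G,k)$ to an equivalent instance whose size is bounded by a polynomial in $k$. *)

(* Defs.v *)
From HB Require Import structures.
From mathcomp Require Import all_boot all_algebra.
From Stdlib Require BinNat.

Set Implicit Arguments.
Unset Strict Implicit.
Unset Printing Implicit Defensive.

Inductive move := MoveL | Stay | MoveR.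

(* A two-way infinite tape: [lft] lists the cells to the left of the head,
   nearest first; [rgt] those to its right, nearest first.  All cells outside
   the two lists are blank. *)
Record tape (S : Type) := Tape { lft : seq S; cur : S; rgt : seq S }.

(* The tape symbols include the bits, embedded as [letter (Some b)], and a
   blank, [letter None]. *)
Record turing_machine := TuringMachine {
  state : finType;
  sym : finType;
  letter : option bool -> sym;
  letter_inj : injective letter;
  ntapes : nat; (* there are [ntapes.+1] tapes *)
  start : state;
  halted : pred state;
  delta : state -> {ffun 'I_ntapes.+1 -> sym} ->
          state * {ffun 'I_ntapes.+1 -> sym * move}
}.

Section Run.
Variable M : turing_machine.

Definition blank : sym M := letter M None.

Definition write_move (t : tape (sym M)) (a : sym M * move) : tape (sym M) :=
  match a.2 with
  | MoveL => Tape (behead (lft t)) (head blank (lft t)) (a.1 :: rgt t)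
  | Stay => Tape (lft t) a.1 (rgt t)
  | MoveR => Tape (a.1 :: lft t) (head blank (rgt t)) (behead (rgt t))
  end.

Definition config : Type := state M * {ffun 'I_(ntapes M).+1 -> tape (sym M)}.

Definition step (c : config) : config :=
  if halted c.1 then c else
  let d := delta c.1 [ffun i => cur (c.2 i)] in
  (d.1, [ffun i => write_move (c.2 i) (d.2 i)]).

Definition load (s : seq (sym M)) : tape (sym M) :=
  Tape [::] (head blank s) (behead s).

Definition init (x : seq bool) : config :=
  (start M,
   [ffun i => load (if i == ord0 then [seq letter M (Some b) | b <- x]
                    else [::])]).

(* The output is read on the last tape, from the head rightwards, and must be
   followed by blanks only. *)
Definition outputs (c : config) (y : seq bool) : Prop :=
  let t := c.2 ord_max in
  forall i, nth blank (cur t :: rgt t) i = letter M (onth y i).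

(* [step] is the identity on halted configurations, so this says that [M]
   halts on [x] after at most [n] steps, with output [y]. *)
Definition computes_within (x y : seq bool) (n : nat) : Prop :=
  let c := iter n step (init x) in halted c.1 /\ outputs c y.

End Run.

Definition polytime_on (A B : Type) (encA : A -> seq bool)
    (encB : B -> seq bool) (dom : A -> Prop) (f : A -> B) : Prop :=
  exists (M : turing_machine) (p : {poly nat}),
    forall a, dom a ->
      computes_within M (encA a) (encB (f a)) (horner p (size (encA a))).

Definition polytime (f : seq bool -> seq bool) : Prop :=
  polytime_on id id (fun=> True) f.

Definition language := seq bool -> Prop.

Definition class_P (L : language) : Prop :=
  exists f : seq bool -> bool,
    polytime (fun x => [:: f x]) /\ forall x, L x <-> f x.

(* The bits of [x] doubled, the separator 01, then [y]. *)
Definition pairs (x y : seq bool) : seq bool :=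
  flatten [seq [:: b; b] | b <- x] ++ [:: false; true] ++ y.

Definition class_NP (L : language) : Prop :=
  exists (V : language) (p : {poly nat}), class_P V /\
    forall x, L x <-> exists y, size y <= horner p (size x) /\ V (pairs x y).

Definition class_coNP (L : language) : Prop := class_NP (fun x => ~ L x).

Definition class_NPpoly (L : language) : Prop :=
  exists (L' : language) (advice : nat -> seq bool) (p : {poly nat}),
    [/\ class_NP L',
        forall n, size (advice n) <= horner p n
      & forall x, L x <-> L' (pairs x (advice (size x)))].

Definition coNP_sub_NPpoly : Prop := forall L, class_coNP L -> class_NPpoly L.

Definition karp_reducible (L L' : language) : Prop :=
  exists f, polytime f /\ forall x, L x <-> L' (f x).

Definition NP_hard (L : language) : Prop :=
  forall L', class_NP L' -> karp_reducible L' L.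

Definition NP_complete (L : language) : Prop := class_NP L /\ NP_hard L.

(* The kernelization need only handle the inputs in [dom], and its outputs may
   lie outside [dom]: this is a weaker requirement than a kernel for the problem
   restricted to [dom], so excluding it is stronger. *)
Definition poly_kernel (I : Type) (enc : I -> seq bool) (param : I -> nat)
    (yes dom : I -> Prop) : Prop :=
  exists f : I -> I,
    [/\ polytime_on enc enc dom f,
        forall i, dom i -> (yes (f i) <-> yes i)
      & exists p : {poly nat},
          forall i, dom i -> size (enc (f i)) <= horner p (param i)].

Record graph := Graph {
  vertex :> finType;
  adj : rel vertex;
  adj_sym : symmetric adj;
  adj_irr : irreflexive adj
}.

Definition complete (G : graph) : Prop := forall u v : G, u != v -> adj u v.

Definition connected (G : graph) : Prop :=
  0 < #|G| /\ forall u v : G, connect (@adj G) u v.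

Section Identify.
Variables (G : graph) (u v : G).

(* [None] is the new vertex. *)
Definition ident_vertex : finType :=
  option {x : G | (x != u) && (x != v)}.

Definition ident_adj : rel ident_vertex := fun a b =>
  match a, b with
  | Some x, Some y => adj (val x) (val y)
  | Some x, None | None, Some x => adj u (val x) || adj v (val x)
  | None, None => false
  end.

Lemma ident_adj_sym : symmetric ident_adj.
Proof. by case=> [x|] [y|] //=; rewrite adj_sym. Qed.

Lemma ident_adj_irr : irreflexive ident_adj.
Proof. by case=> [x|] //=; rewrite adj_irr. Qed.

Definition identify : graph := Graph ident_adj_sym ident_adj_irr.

End Identify.

Inductive identifications : nat -> graph -> graph -> Prop :=
| Ident0 G : identifications 0 G G
| IdentS n (G H : graph) (u v : G) :
    u != v -> identifications n (identify u v) H ->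
    identifications n.+1 G H.

Definition clique_identifiable (G : graph) (k : nat) : Prop :=
  exists j H, [/\ j <= k, identifications j G H & complete H].

(* The adjacency matrix, row by row, for the enumeration order of the vertices;
   its length is [#|G| ^ 2]. *)
Definition enc_graph (G : graph) : seq bool :=
  [seq adj u v | u <- enum G, v <- enum G].

(* Binary, least significant bit first; 0 is the empty string. *)
Fixpoint enc_pos (p : BinNums.positive) : seq bool :=
  match p with
  | BinNums.xH => [:: true]
  | BinNums.xO q => false :: enc_pos q
  | BinNums.xI q => true :: enc_pos q
  end.

Definition enc_nat (n : nat) : seq bool :=
  match BinNat.N.of_nat n with
  | BinNums.N0 => [::]
  | BinNums.Npos p => enc_pos p
  end.

Definition enc_instance (i : graph * nat) : seq bool :=
  pairs (enc_graph i.1) (enc_nat i.2).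

(* Strings that do not encode an instance with a graph in [C] are negative. *)
Definition clique_identification (C : graph -> Prop) : language := fun s =>
  exists G k, [/\ s = enc_instance (G, k), C G & clique_identifiable G k].

(* The usual convention for a parameterized problem: the parameter is written
   in unary, so that it counts with its value in the size of an instance. *)
Definition enc_param_instance (i : graph * nat) : seq bool :=
  pairs (enc_graph i.1) (nseq i.2 true).

Definition clique_identification_poly_kernel (C : graph -> Prop) : Prop :=
  poly_kernel enc_param_instance snd
    (fun i => clique_identifiable i.1 i.2) (fun i => C i.1).

Definition any_graph (G : graph) : Prop := True.

(* Main.v *)
(* A graph can be turned into a complete graph by k identifications iff its
   vertices can be partitioned into #|G| - k pairwise adjacent classes.  Hence a
   clique on a ground set U together with many copies of the members of a set
   family, a copy being adjacent to the elements of its set, can be made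
   complete with |U| - 2 identifications iff U splits into two parts that both
   meet every set.  Satisfiability reduces to set splitting with |U| = 2v + 1,
   where v counts only the variables.

   The run of a verifier on an unknown certificate is described by clauses saying
   that facts about the tape cells, taken relative to the head, propagate.  That
   the input word belongs to a list X is expressed without new variables, by
   forbidding the minimal words that are not prefixes of members of X.  The same
   formula thus proves NP-hardness (X a singleton) and is an OR-composition whose
   parameter depends only on the length of the words, so that a polynomial kernel
   gives a distillation: a few of its outputs, given as advice, witness membership
   in the complement.

   Polynomial time is established for functions on encodable types by closure
   properties, proved by compiling programs over four stacks to Turing machines. *)
Require Import Defs.
From mathcomp Require Import all_boot all_algebra.
From mathcomp Require Import zify.
From Stdlib Require BinNat.
From Stdlib Require Import ClassicalEpsilon.

Set Implicit Arguments.
Unset Strict Implicit.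
Unset Printing Implicit Defensive.


(** The notions of the theorem refer to concrete Turing machines, so every function of the argument,
    from the verifier to the check of the distillation, needs a proof of polynomial time.
    Conversely, verifiers and kernelizations are given only as machines: they enter through the
    table of the transition function or through a simulation with a clock, and can then be combined
    with everything else. The four claims share their proofs. All graphs produced are connected, so
    hardness and the exclusion of kernels hold for every class containing the connected graphs;
    membership in NP uses one verifier with a switch for the connectivity test. For the kernel, the
    complement of [L] is in NP, and a composed instance is negative exactly when all its words lie
    in [L]. If kernel outputs have length at most s for words of length n, then s + 1 words are
    composed at a time. This number is chosen after s, so the parameter must not grow with it. Some
    output is then reached from tuples that together contain half of the words of [L] of length n;
    after n + 1 rounds every word is covered. *)

Notation tok := (option bool).
(** Delimiter: it does not occur in the code of a tree, so popping up to the first [hash] removes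
    exactly one stored tree. *)
Definition hash : tok := None.

(** * Programs over four stacks and their compilation to Turing machines *)

Inductive stk := S0 | S1 | S2 | S3.

(** [reg] holds the last token popped, [None] if the stack was empty. In the compiled machine it is
    part of the finite control, which is why pushes and tests may depend on it. *)
Record store := Store {
  reg : option tok;
  st0 : seq tok; st1 : seq tok; st2 : seq tok; st3 : seq tok }.

Definition get (i : stk) (m : store) : seq tok :=
  match i with S0 => st0 m | S1 => st1 m | S2 => st2 m | S3 => st3 m end.

Definition set_stk (i : stk) (s : seq tok) (m : store) : store :=
  match i with
  | S0 => Store (reg m) s (st1 m) (st2 m) (st3 m)
  | S1 => Store (reg m) (st0 m) s (st2 m) (st3 m)
  | S2 => Store (reg m) (st0 m) (st1 m) s (st3 m)
  | S3 => Store (reg m) (st0 m) (st1 m) (st2 m) s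
  end.

Definition set_reg (r : option tok) (m : store) : store :=
  Store r (st0 m) (st1 m) (st2 m) (st3 m).

Inductive cmd :=
| Push of stk & (option tok -> tok)
| Pop of stk
| Skip
| Seq of cmd & cmd
| If of pred (option tok) & cmd & cmd
| While of pred (option tok) & cmd.

(** The costs are the exact numbers of machine steps of the compiled code: a push moves left and
    then writes, a test is one step, and the jump that ends a then-branch or a loop body is one
    more. *)
Inductive exec : cmd -> store -> store -> nat -> Prop :=
| EPush i g m : exec (Push i g) m (set_stk i (g (reg m) :: get i m) m) 2
| EPop i m :
    exec (Pop i) m (set_stk i (behead (get i m)) (set_reg (ohead (get i m)) m)) 1
| ESkip m : exec Skip m m 0
| ESeq c1 c2 m1 m2 m3 n1 n2 :
    exec c1 m1 m2 n1 -> exec c2 m2 m3 n2 -> exec (Seq c1 c2) m1 m3 (n1 + n2)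
| EIfT (p : pred (option tok)) c1 c2 m m' n :
    p (reg m) -> exec c1 m m' n -> exec (If p c1 c2) m m' n.+2
| EIfF (p : pred (option tok)) c1 c2 m m' n :
    ~~ p (reg m) -> exec c2 m m' n -> exec (If p c1 c2) m m' n.+1
| EWhileF (p : pred (option tok)) c m : ~~ p (reg m) -> exec (While p c) m m 1
| EWhileT (p : pred (option tok)) c m1 m2 m3 n1 n2 :
    p (reg m1) -> exec c m1 m2 n1 -> exec (While p c) m2 m3 n2 ->
    exec (While p c) m1 m3 (n1 + n2).+2.

Inductive instr :=
| IPush of stk & (option tok -> tok)
| IPop of stk
| IBranch of pred (option tok) & nat
| IJump of nat.

(* Jump targets are absolute: [compile a c] is the code of [c] to be loaded at
   address [a]. *)
Fixpoint compile (a : nat) (c : cmd) : seq instr :=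
  match c with
  | Push i g => [:: IPush i g]
  | Pop i => [:: IPop i]
  | Skip => [::]
  | Seq c1 c2 => let l1 := compile a c1 in l1 ++ compile (a + size l1) c2
  | If p c1 c2 =>
      let l1 := compile a.+1 c1 in
      let b := a + (size l1).+2 in
      let l2 := compile b c2 in
      IBranch p b :: l1 ++ IJump (b + size l2) :: l2
  | While p c1 =>
      let l1 := compile a.+1 c1 in
      IBranch p (a + (size l1).+2) :: l1 ++ [:: IJump a]
  end.

Definition tape_of (i : stk) : 'I_4 :=
  match i with
  | S0 => @Ordinal 4 0 isT | S1 => @Ordinal 4 1 isT
  | S2 => @Ordinal 4 2 isT | S3 => @Ordinal 4 3 isT
  end.

Definition tm_letter (s : option bool) : option tok := omap some s.

Lemma tm_letter_inj : injective tm_letter.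
Proof. by case=> [b|] [b'|] // [->]. Qed.

Section Machine.
Variable C : seq instr.

(** Program counter, phase of a push, and register. The counter reaches one address beyond the code,
    where the machine halts. *)
Definition tm_state : finType := ('I_(size C).+1 * bool * option tok)%type.

Definition tm_delta (q : tm_state) (v : {ffun 'I_4 -> option tok}) :
    tm_state * {ffun 'I_4 -> option tok * move} :=
  let: (pc, ph, r) := q in
  let stay := [ffun j => (v j, Stay)] in
  match nth (IJump 0) C pc with
  | IPush i g =>
      if ph then
        ((inord pc.+1, false, r),
         [ffun j => (if j == tape_of i then Some (g r) else v j, Stay)])
      else ((pc, true, r),
            [ffun j => (v j, if j == tape_of i then MoveL else Stay)])
  | IPop i =>
      ((inord pc.+1, false, v (tape_of i)),
       [ffun j => if j == tape_of i then (None, MoveR) else (v j, Stay)])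
  | IBranch p a => ((inord (if p r then pc.+1 else a), false, r), stay)
  | IJump a => ((inord a, false, r), stay)
  end.

Definition machine : turing_machine :=
  @TuringMachine tm_state (option tok) tm_letter tm_letter_inj 3
    (inord 0, false, None) (fun q => q.1.1 == size C :> nat) tm_delta.

(** The head stands on the top of the stack, which extends to the right. Moves may store blanks
    explicitly, so contents are compared through [nth] with a blank default and not as lists. *)
Definition stack_tape (t : tape (option tok)) (s : seq tok) : Prop :=
  (forall i, nth None (lft t) i = None) /\
  (forall i, nth None (cur t :: rgt t) i = onth s i).

Definition represents (a : nat) (m : store) (c : config machine) : Prop :=
  c.1 = (inord a, false, reg m) /\
  forall i, stack_tape (c.2 (tape_of i)) (get i m).

Lemma tape_of_eq i j : (tape_of i == tape_of j) = match i, j with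
  | S0, S0 | S1, S1 | S2, S2 | S3, S3 => true | _, _ => false end.
Proof. by case: i; case: j. Qed.

Lemma write_stay (t : tape (sym machine)) : write_move t (cur t, Stay) = t.
Proof. by case: t. Qed.

Lemma running (a : nat) (m : store) (c : config machine) :
  represents a m c -> a < size C -> @halted machine c.1 = false.
Proof.
by case=> -> _ ha /=; rewrite inordK ?ltnS 1?ltnW //; apply/eqP; lia.
Qed.

Lemma push_left t s a : stack_tape t s ->
  stack_tape (@write_move machine
    (@write_move machine t (cur t, MoveL)) (Some a, Stay)) (a :: s).
Proof.
case=> hl hr; split=> [i|[|i]] //=.
by have := hl i.+1; case: (lft t) => [|b l] //=; rewrite nth_nil.
Qed.

Lemma pop_right t s : stack_tape t s ->
  stack_tape (@write_move machine t (None, MoveR)) (behead s).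
Proof.
case=> hl hr; split=> [[|i]|i] //=.
have -> : nth None (head None (rgt t) :: behead (rgt t)) i = nth None (rgt t) i.
  by case: (rgt t) i => [|x l] [|i] //=; rewrite nth_nil.
by have := hr i.+1; case: s {hr} => [|b s] //= ->; rewrite onth0n.
Qed.

Lemma cur_stack t s : stack_tape t s -> cur t = ohead s.
Proof. by case=> _ /(_ 0); case: s. Qed.

Lemma push_step i g a m c : represents a m c -> a < size C ->
  nth (IJump 0) C a = IPush i g ->
  represents a.+1 (set_stk i (g (reg m) :: get i m) m) (iter 2 (@step machine) c).
Proof.
move=> hc ha hn.
have hh := running hc ha; case: hc => h1 h2.
have ha' : a < (size C).+1 by rewrite ltnS ltnW.
rewrite /= {2}/step hh h1 /= inordK // hn /= /step /= inordK //.
have -> : (a == size C) = false by apply/eqP; lia.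
rewrite hn /=; split; first by case: i {hn}.
move=> j; rewrite !ffunE !tape_of_eq.
have hj := h2 j.
by case: i hn; case: j hj => hj hn; rewrite /= ?write_stay //;
   apply: (push_left (g (reg m)) hj).
Qed.

Lemma pop_step i a m c : represents a m c -> a < size C ->
  nth (IJump 0) C a = IPop i ->
  represents a.+1 (set_stk i (behead (get i m)) (set_reg (ohead (get i m)) m))
    (@step machine c).
Proof.
move=> hc ha hn.
have hh := running hc ha; case: hc => h1 h2.
have ha' : a < (size C).+1 by rewrite ltnS ltnW.
rewrite /= /step hh h1 /= inordK // hn /=; split.
  by rewrite /= ffunE (cur_stack (h2 i)); case: i {hn}.
move=> j; rewrite !ffunE !tape_of_eq.
have hj := h2 j.
by case: i hn; case: j hj => hj hn; rewrite /= ?write_stay //;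
   apply: (pop_right hj).
Qed.

Lemma goto_step b a m c : represents a m c -> a < size C ->
  (nth (IJump 0) C a = IJump b \/
   exists p d, nth (IJump 0) C a = IBranch p d /\
               b = if p (reg m) then a.+1 else d) ->
  represents b m (@step machine c).
Proof.
move=> hc ha hn.
have hh := running hc ha; case: hc => h1 h2.
have ha' : a < (size C).+1 by rewrite ltnS ltnW.
rewrite /= /step hh h1 /= inordK //.
case: hn => [->|[p [d [-> ->]]]] /=; split=> [|j] //;
  by rewrite !ffunE write_stay; apply: h2.
Qed.

Lemma nth_code (l1 l2 : seq instr) x : nth (IJump 0) (l1 ++ x :: l2) (size l1) = x.
Proof. by rewrite nth_cat ltnn subnn. Qed.

(** Induction on [exec], for code placed at address [a] between arbitrary [C1] and [C2], since each
    subcommand runs in place inside the code of its parent. After one pass of a loop the jump leads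
    back to [a], so the second hypothesis applies to the same placement. *)
Lemma compile_correct c m m' n : exec c m m' n ->
  forall a C1 C2 cfg, C = C1 ++ compile a c ++ C2 -> size C1 = a ->
  represents a m cfg ->
  represents (a + size (compile a c)) m' (iter n (@step machine) cfg).
Proof.
elim=> {c m m' n}
  [i g m|i m|m|c1 c2 m1 m2 m3 n1 n2 _ IH1 _ IH2|p c1 c2 m m' n hp _ IH
  |p c1 c2 m m' n hp _ IH|p c m hp|p c m1 m2 m3 n1 n2 hp _ IH1 _ IH2] a C1 C2 cfg hC sC hr.
- rewrite addn1; apply: push_step hr _ _; rewrite hC -sC; last exact: nth_code.
  by rewrite size_cat /=; lia.
- rewrite addn1; apply: pop_step hr _ _; rewrite hC -sC; last exact: nth_code.
  by rewrite size_cat /=; lia.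
- by rewrite addn0.
- rewrite [n1 + n2]addnC iterD /= size_cat addnA.
  move: hC; rewrite /= -catA => hC.
  have h1 := IH1 _ _ _ _ hC sC hr.
  by rewrite catA in hC; apply: IH2 hC _ h1; rewrite size_cat sC.
- move: hC => /=; set l1 := compile _ _; set l2 := compile _ _ => hC.
  have la : a < size C by rewrite hC !size_cat /= sC; lia.
  have h1 : represents a.+1 m (@step machine cfg).
    apply: goto_step hr la _; right; exists p, (a + (size l1).+2).
    by rewrite hp {1}hC -sC nth_code.
  have hC' : C = rcons C1 (IBranch p (a + (size l1).+2)) ++ l1 ++
     (IJump (a + (size l1).+2 + size l2) :: l2 ++ C2).
    by rewrite hC cat_rcons /= -catA.
  have := IH _ _ _ _ hC' _ h1; rewrite size_rcons sC => /(_ erefl).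
  rewrite -iterSr -/l1 => {}h1.
  apply: goto_step h1 _ _; first by rewrite hC !size_cat /= !size_cat /= ?size_cat /= ?size_cat /= sC; lia.
  left; have -> : a.+1 + size l1 = size (C1 ++ IBranch p (a + (size l1).+2) :: l1).
    by rewrite size_cat /= sC; lia.
  rewrite {1}hC /= -[(l1 ++ _) ++ C2]catA -cat_cons catA nth_code.
  by congr IJump; rewrite /= size_cat /=; lia.
- move: hC => /=; set l1 := compile _ _; set l2 := compile _ _ => hC.
  have la : a < size C by rewrite hC !size_cat /= sC; lia.
  have h1 : represents (a + (size l1).+2) m (@step machine cfg).
    apply: goto_step hr la _; right; exists p, (a + (size l1).+2).
    by rewrite (negbTE hp) {1}hC -sC nth_code.
  have hC' : C = (C1 ++ IBranch p (a + (size l1).+2) :: l1 ++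
     [:: IJump (a + (size l1).+2 + size l2)]) ++ l2 ++ C2.
    by rewrite hC /= -!catA /= -!catA.
  have := IH _ _ _ _ hC' _ h1; rewrite !size_cat /= size_cat /= sC addn1.
  move=> /(_ erefl); rewrite -iterSr /= -/l2.
  by congr represents; rewrite ?size_cat /=; lia.
- move: hC => /=; set l1 := compile _ _ => hC.
  apply: goto_step hr _ _; first by rewrite hC !size_cat /= sC; lia.
  right; exists p, (a + (size l1).+2).
  by rewrite (negbTE hp) {1}hC -sC nth_code size_cat addn1.
- move: (hC) => /=; set l1 := compile _ _ => hC'.
  have la : a < size C by rewrite hC' !size_cat /= sC; lia.
  have h1 : represents a.+1 m1 (@step machine cfg).
    apply: goto_step hr la _; right; exists p, (a + (size l1).+2).
    by rewrite hp {1}hC' -sC nth_code.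
  have hC2 : C = rcons C1 (IBranch p (a + (size l1).+2)) ++ l1 ++ (IJump a :: C2).
    by rewrite hC' cat_rcons /= -catA.
  have := IH1 _ _ _ _ hC2 _ h1; rewrite size_rcons sC => /(_ erefl).
  rewrite -iterSr -/l1 => {}h1.
  have h2 : represents a m2 (iter n1.+2 (@step machine) cfg).
    rewrite iterS; apply: goto_step h1 _ _.
      by rewrite hC' !size_cat /= !size_cat /= ?size_cat /= ?size_cat /= sC; lia.
    left; have -> : a.+1 + size l1 = size (C1 ++ IBranch p (a + (size l1).+2) :: l1).
      by rewrite size_cat /= sC; lia.
    by rewrite {1}hC' /= -[(l1 ++ _) ++ C2]catA -cat_cons catA nth_code.
  have := IH2 _ _ _ _ hC sC h2; rewrite -[step _]/(iter (n1 + n2).+2 (@step machine) cfg).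
  have -> : (n1 + n2).+2 = n2 + n1.+2 by lia.
  by rewrite iterD.
Qed.

End Machine.

Lemma iter_halted (M : turing_machine) n (c : config M) :
  halted c.1 -> iter n (@step M) c = c.
Proof. by move=> h; elim: n => //= n ->; rewrite /step h. Qed.

Lemma computes_within_leq (M : turing_machine) x y n n' : n <= n' ->
  computes_within M x y n -> computes_within M x y n'.
Proof.
move=> le_n [h1 h2]; rewrite /computes_within -(subnK le_n) iterD.
by rewrite (iter_halted _ h1).
Qed.

(* Input on stack 0, output on stack 3; everything else is blank at the start
   and arbitrary at the end. *)
Lemma exec_computes c x y r s0 s1 s2 n :
  exec c (Store None [seq Some b | b <- x] [::] [::] [::])
         (Store r s0 s1 s2 [seq Some b | b <- y]) n ->
  computes_within (machine (compile 0 c)) x y n.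
Proof.
move=> h.
have hC : compile 0 c = [::] ++ compile 0 c ++ [::] by rewrite cats0.
have := compile_correct h (cfg := init (machine (compile 0 c)) x) hC erefl.
case.
  split=> // i; rewrite /= ffunE /load.
  have onthm (s : seq bool) j : onth [seq Some b | b <- s] j = omap some (onth s j).
    by elim: s j => [|b s IH] [|j] //=.
  case: i => /=; split=> j //=; rewrite ?nth_nil //; last first.
  - by case: j => [|[|j]].
  - by case: j => [|[|j]].
  - by case: j => [|[|j]].
  by case: x {h} j => [|b s] [|j] //=;
   rewrite ?nth_nil // onthm; elim: s j => [|b' s IH] [|j] //=.
rewrite add0n => hs /(_ S3) [_ h3]; split.
  by rewrite hs /= inordK ?eqxx.
have e : @ord_max 3 = tape_of S3 by apply: val_inj.
move=> i; rewrite [ord_max]e [LHS]h3 /=.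
by elim: y i {h h3 hs} => [|b s IH] [|j] //=.
Qed.


(** * Programs on encoded trees *)

Inductive tree := Leaf | Node of tree & tree.

(** Preorder, one token per node. This is a prefix code: a tree can be read off a stack above
    arbitrary data, and two trees lying on the stack are joined by one push. *)
Fixpoint code (t : tree) : seq tok :=
  match t with
  | Leaf => [:: Some false]
  | Node a b => Some true :: code a ++ code b
  end.

Definition run (c : cmd) (m m' : store) (b : nat) : Prop :=
  exists2 n, exec c m m' n & n <= b.

Lemma run_leq c m m' b b' : run c m m' b -> b <= b' -> run c m m' b'.
Proof. by case=> n h1 h2 h3; exists n => //; apply: leq_trans h3. Qed.

Lemma run_seq c1 c2 m1 m2 m3 b1 b2 :
  run c1 m1 m2 b1 -> run c2 m2 m3 b2 -> run (Seq c1 c2) m1 m3 (b1 + b2).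
Proof.
by case=> n1 h1 l1 [n2 h2 l2]; exists (n1 + n2); [apply: ESeq h1 h2|lia].
Qed.

Lemma run_push i g m : run (Push i g) m (set_stk i (g (reg m) :: get i m) m) 2.
Proof. by exists 2 => //; constructor. Qed.

Lemma run_pop i m :
  run (Pop i) m (set_stk i (behead (get i m)) (set_reg (ohead (get i m)) m)) 1.
Proof. by exists 1 => //; constructor. Qed.

Lemma run_skip m : run Skip m m 0.
Proof. by exists 0 => //; constructor. Qed.

Lemma run_ifT (p : pred (option tok)) c1 c2 m m' b :
  p (reg m) -> run c1 m m' b -> run (If p c1 c2) m m' b.+2.
Proof. by move=> hp [n h l]; exists n.+2; [apply: EIfT|]. Qed.

Lemma run_ifF (p : pred (option tok)) c1 c2 m m' b :
  ~~ p (reg m) -> run c2 m m' b -> run (If p c1 c2) m m' b.+2.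
Proof. by move=> hp [n h l]; exists n.+1; [apply: EIfF|lia]. Qed.

Lemma run_whileF (p : pred (option tok)) c m : ~~ p (reg m) -> run (While p c) m m 1.
Proof. by move=> hp; exists 1 => //; constructor. Qed.

Lemma run_whileT (p : pred (option tok)) c m1 m2 m3 b1 b2 :
  p (reg m1) -> run c m1 m2 b1 -> run (While p c) m2 m3 b2 ->
  run (While p c) m1 m3 (b1 + b2).+2.
Proof.
move=> hp [n1 h1 l1] [n2 h2 l2]; exists (n1 + n2).+2; first exact: EWhileT h2.
by lia.
Qed.

Lemma exec_size c m m' n : exec c m m' n -> size (st0 m') <= size (st0 m) + n.
Proof.
elim=> {c m m' n} [i g m|i m|m|c1 c2 m1 m2 m3 n1 n2 _ h1 _ h2|p c1 c2 m m' n _ _ h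
  |p c1 c2 m m' n _ _ h|p c m _|p c m1 m2 m3 n1 n2 _ _ h1 _ h2] /=; try lia.
- by case: i => /=; lia.
- by case: i => /=; rewrite ?size_behead; lia.
Qed.

Lemma run_size c m m' b : run c m m' b -> size (st0 m') <= size (st0 m) + b.
Proof. by case=> n /exec_size h l; lia. Qed.

Definition pushr (i : stk) : cmd := Push i (odflt hash).
Definition pushc (i : stk) (a : tok) : cmd := Push i (fun=> a).
Definition not_hash : pred (option tok) := fun r => r != Some hash.
Notation "c1 ;; c2" := (Seq c1 c2) (at level 90, right associativity).

Ltac run1 := first
  [ exact: run_push | exact: run_pop | exact: run_skip
  | apply: run_ifT; [by [] | run1] | apply: run_ifF; [by [] | run1]
  | eapply run_seq; [run1 | cbn; run1] ].

(* Stack 2 counts the subtrees still to be read; the popped tree ends up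
   reversed on stack 1, above a delimiter. *)
Definition mv_body : cmd :=
  Pop S0 ;; pushr S1 ;;
  If (pred1 (Some (Some true))) (pushc S2 (Some true) ;; pushc S2 (Some true)) Skip ;;
  Pop S2.

Definition mv : cmd :=
  pushc S1 hash ;; pushc S2 hash ;; pushc S2 (Some true) ;; Pop S2 ;;
  While not_hash mv_body.

(** The remaining run is a premise, so that in the node case the hypothesis for the second subtree
    provides the continuation of the first. A node pushes two markers and every iteration pops one,
    so a complete subtree uses up one marker. *)
Lemma mv_loop t : forall rest s1 s2 s3 r m' b, not_hash r ->
  run (While not_hash mv_body)
    (Store (ohead s2) rest (rev (code t) ++ s1) (behead s2) s3) m' b ->
  run (While not_hash mv_body) (Store r (code t ++ rest) s1 s2 s3) m'
    (b + 20 * size (code t)).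
Proof.
elim: t => [|t1 IH1 t2 IH2] rest s1 s2 s3 r m' b hr h.
  apply: run_leq; first by eapply run_whileT; [exact: hr|run1|exact: h].
  by rewrite /=; lia.
apply: run_leq.
  eapply run_whileT; [exact: hr|run1|].
  rewrite /= -catA; apply: IH1 => //=; apply: IH2 => //=.
  move: h; rewrite /= rev_cons rev_cat -cats1 -!catA; exact.
by rewrite /= size_cat; lia.
Qed.

Lemma run_mv t rest s1 s2 s3 r : run mv (Store r (code t ++ rest) s1 s2 s3)
  (Store (Some hash) rest (rev (code t) ++ hash :: s1) s2 s3) (20 * size (code t) + 10).
Proof.
apply: run_leq.
  do 4!(eapply run_seq; [run1|cbn]).
  by apply: mv_loop => //; apply: run_whileF.
by lia.
Qed.

Definition drain (i : stk) (c : cmd) : cmd := Pop i ;; While not_hash (c ;; Pop i).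

Lemma code_nohash t : all (predC1 hash) (code t).
Proof. by elim: t => //= t1 h1 t2 h2; rewrite all_cat h1 h2. Qed.

Definition back : cmd := drain S1 (pushr S0).
Definition clear : cmd := drain S1 Skip.
Definition copy : cmd := drain S1 (pushr S0 ;; pushr S2).
Definition back21 : cmd := drain S2 (pushr S1).
Definition fuel13 : cmd := drain S1 (pushr S3).


Lemma not_hash_some a : predC1 hash a -> not_hash (Some a).
Proof. by apply: contraNneq => -[->]. Qed.

Ltac drain_tac :=
  elim=> [|? ? ?] /= => [_|/andP[? ?]] *;
  [ exact: run_whileF
  | rewrite ?rev_cons ?cat_rcons; eapply run_leq;
    [ eapply run_whileT;
      [ by apply: not_hash_some | run1
      | cbn; match goal with IH : is_true (all _ _) -> _ |- _ => exact: IH end ]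
    | rewrite /=; lia ] ].

Lemma run_back (l : seq tok) : all (predC1 hash) l -> forall rest s1 s2 s3 r,
  run back (Store r rest (l ++ hash :: s1) s2 s3)
    (Store (Some hash) (rev l ++ rest) s1 s2 s3) (5 * size l + 2).
Proof.
move=> hl rest s1 s2 s3 r.
have W : forall l : seq tok, all (predC1 hash) l -> forall rest,
  run (While not_hash (pushr S0 ;; Pop S1))
    (Store (ohead (l ++ hash :: s1)) rest (behead (l ++ hash :: s1)) s2 s3)
    (Store (Some hash) (rev l ++ rest) s1 s2 s3) (5 * size l + 1) by drain_tac.
by apply: run_leq; [eapply run_seq; [exact: run_pop|exact: W]|lia].
Qed.

Lemma run_clear (l : seq tok) : all (predC1 hash) l -> forall rest s1 s2 s3 r,
  run clear (Store r rest (l ++ hash :: s1) s2 s3)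
    (Store (Some hash) rest s1 s2 s3) (5 * size l + 2).
Proof.
move=> hl rest s1 s2 s3 r.
have W : forall l : seq tok, all (predC1 hash) l ->
  run (While not_hash (Skip ;; Pop S1))
    (Store (ohead (l ++ hash :: s1)) rest (behead (l ++ hash :: s1)) s2 s3)
    (Store (Some hash) rest s1 s2 s3) (5 * size l + 1) by drain_tac.
by apply: run_leq; [eapply run_seq; [exact: run_pop|exact: W]|lia].
Qed.

Lemma run_copy (l : seq tok) : all (predC1 hash) l -> forall rest s1 s2 s3 r,
  run copy (Store r rest (l ++ hash :: s1) s2 s3)
    (Store (Some hash) (rev l ++ rest) s1 (rev l ++ s2) s3) (7 * size l + 2).
Proof.
move=> hl rest s1 s2 s3 r.
have W : forall l : seq tok, all (predC1 hash) l -> forall rest s2,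
  run (While not_hash ((pushr S0 ;; pushr S2) ;; Pop S1))
    (Store (ohead (l ++ hash :: s1)) rest (behead (l ++ hash :: s1)) s2 s3)
    (Store (Some hash) (rev l ++ rest) s1 (rev l ++ s2) s3) (7 * size l + 1)
  by drain_tac.
by apply: run_leq; [eapply run_seq; [exact: run_pop|exact: W]|lia].
Qed.

Lemma run_back21 (l : seq tok) : all (predC1 hash) l -> forall rest s1 s2 s3 r,
  run back21 (Store r rest s1 (l ++ hash :: s2) s3)
    (Store (Some hash) rest (rev l ++ s1) s2 s3) (5 * size l + 2).
Proof.
move=> hl rest s1 s2 s3 r.
have W : forall l : seq tok, all (predC1 hash) l -> forall s1,
  run (While not_hash (pushr S1 ;; Pop S2))
    (Store (ohead (l ++ hash :: s2)) rest s1 (behead (l ++ hash :: s2)) s3)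
    (Store (Some hash) rest (rev l ++ s1) s2 s3) (5 * size l + 1) by drain_tac.
by apply: run_leq; [eapply run_seq; [exact: run_pop|exact: W]|lia].
Qed.

Lemma run_fuel13 (l : seq tok) : all (predC1 hash) l -> forall rest s1 s2 s3 r,
  run fuel13 (Store r rest (l ++ hash :: s1) s2 s3)
    (Store (Some hash) rest s1 s2 (rev l ++ s3)) (5 * size l + 2).
Proof.
move=> hl rest s1 s2 s3 r.
have W : forall l : seq tok, all (predC1 hash) l -> forall s3,
  run (While not_hash (pushr S3 ;; Pop S1))
    (Store (ohead (l ++ hash :: s1)) rest (behead (l ++ hash :: s1)) s2 s3)
    (Store (Some hash) rest s1 s2 (rev l ++ s3)) (5 * size l + 1) by drain_tac.
by apply: run_leq; [eapply run_seq; [exact: run_pop|exact: W]|lia].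
Qed.

Lemma rev_nohash t : all (predC1 hash) (rev (code t)).
Proof. by rewrite all_rev code_nohash. Qed.

Definition drop_tree : cmd := mv ;; clear.

Lemma run_drop t rest s1 s2 s3 r : run drop_tree
  (Store r (code t ++ rest) s1 s2 s3) (Store (Some hash) rest s1 s2 s3)
  (25 * size (code t) + 12).
Proof.
apply: run_leq; first by eapply run_seq; [exact: run_mv|exact/run_clear/rev_nohash].
by rewrite size_rev; lia.
Qed.

(** Programs consume their argument; this keeps a second copy, reversed on stack 1, from where
    [back] restores it. *)
Definition save : cmd := mv ;; pushc S2 hash ;; copy ;; pushc S1 hash ;; back21.

Lemma run_save t rest s1 s2 s3 r : run save (Store r (code t ++ rest) s1 s2 s3)
  (Store (Some hash) (code t ++ rest) (rev (code t) ++ hash :: s1) s2 s3)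
  (32 * size (code t) + 18).
Proof.
apply: run_leq.
  eapply run_seq; first exact: run_mv.
  eapply run_seq; first run1.
  eapply run_seq; first exact/run_copy/rev_nohash.
  rewrite revK; eapply run_seq; first run1.
  exact/run_back21/code_nohash.
by rewrite size_rev; lia.
Qed.

Lemma run_restore t rest s1 s2 s3 r :
  run back (Store r rest (rev (code t) ++ hash :: s1) s2 s3)
    (Store (Some hash) (code t ++ rest) s1 s2 s3) (5 * size (code t) + 2).
Proof.
by have := run_back (rev_nohash t) rest s1 s2 s3 r; rewrite revK size_rev.
Qed.

Fixpoint push_all (l : seq tok) : cmd :=
  if l is a :: l' then pushc S0 a ;; push_all l' else Skip.

Lemma run_push_all l rest s1 s2 s3 r :
  run (push_all l) (Store r rest s1 s2 s3)
    (Store r (rev l ++ rest) s1 s2 s3) (2 * size l).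
Proof.
elim: l rest => [|a l IH] rest /=; first exact: run_skip.
rewrite rev_cons cat_rcons; apply: run_leq.
  by eapply run_seq; [run1|exact: IH].
by lia.
Qed.

Lemma run_push_code t rest s1 s2 s3 r :
  run (push_all (rev (code t))) (Store r rest s1 s2 s3)
    (Store r (code t ++ rest) s1 s2 s3) (2 * size (code t)).
Proof.
by have := run_push_all (rev (code t)) rest s1 s2 s3 r; rewrite revK size_rev.
Qed.

Lemma run_fuel t rest s1 s2 s3 r :
  run fuel13 (Store r rest (rev (code t) ++ hash :: s1) s2 s3)
    (Store (Some hash) rest s1 s2 (code t ++ s3)) (5 * size (code t) + 2).
Proof.
by have := run_fuel13 (rev_nohash t) rest s1 s2 s3 r; rewrite revK size_rev.
Qed.

(** * Polynomial-time functions on encodable types *)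

Class enc (A : Type) := Enc { E : A -> tree; E_inj : injective E }.

Definition sz {A} `{enc A} (a : A) : nat := size (code (E a)).

(** Powers of [sz a + 2] stand in for polynomials: the base is at least 2, so constants and sums are
    absorbed into the exponent, and products and compositions only change the exponent. *)
Definition pbound {A} `{enc A} (u : A -> nat) : Prop :=
  exists k, forall a, u a <= (sz a + 2) ^ k.

(** What lies below the argument and on the other stacks is arbitrary and is preserved; this frame
    condition allows programs to be nested. Only the register may be spoiled. *)
Definition implements {A B} `{enc A, enc B} (c : cmd) (f : A -> B) (u : A -> nat) :=
  forall a rest s1 s2 s3 r, exists r',
    run c (Store r (code (E a) ++ rest) s1 s2 s3)
          (Store r' (code (E (f a)) ++ rest) s1 s2 s3) (u a).

Definition ptime {A B} `{enc A, enc B} (f : A -> B) : Prop :=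
  exists c u, pbound u /\ implements c f u.

Section Bounds.
Context {A : Type} `{enc A}.

Lemma pbound_leq (u v : A -> nat) : pbound v -> (forall a, u a <= v a) -> pbound u.
Proof. by move=> [k h] l; exists k => a; apply: leq_trans (h a). Qed.

Lemma ltn_exp2 m n : m <= (n + 2) ^ m.
Proof. by apply/ltnW/ltn_expl; rewrite addn2. Qed.

Lemma pbound_const m : pbound (fun _ : A => m).
Proof. by exists m => a; apply: ltn_exp2. Qed.

Lemma pbound_sz : pbound (fun a : A => sz a).
Proof. by exists 1 => a; rewrite expn1 leq_addr. Qed.

Lemma pbound_mul u v : pbound u -> pbound v -> pbound (fun a : A => u a * v a).
Proof.
by move=> [k hu] [l hv]; exists (k + l) => a; rewrite expnD leq_mul.
Qed.

Lemma pbound_add u v : pbound u -> pbound v -> pbound (fun a : A => u a + v a).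
Proof.
move=> [k hu] [l hv]; exists (k + l).+1 => a.
have h2 : 2 <= sz a + 2 by rewrite addn2.
have lk : (sz a + 2) ^ k <= (sz a + 2) ^ (k + l) by rewrite leq_pexp2l ?addn2 ?leq_addr.
have ll : (sz a + 2) ^ l <= (sz a + 2) ^ (k + l) by rewrite leq_pexp2l ?addn2 ?leq_addl.
rewrite expnS; apply: leq_trans (leq_mul h2 (leqnn _)).
by rewrite mul2n -addnn leq_add // (leq_trans (hu a), leq_trans (hv a)).
Qed.

Lemma pbound_exp u k : pbound u -> pbound (fun a : A => u a ^ k).
Proof.
move=> [l h]; exists (l * k) => a; rewrite expnM.
by case: k => // k; rewrite leq_exp2r.
Qed.

Lemma pbound_comp {B} `{enc B} (f : A -> B) u :
  pbound (fun a => sz (f a)) -> pbound u -> pbound (fun a => u (f a)).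
Proof.
move=> hf [k hu]; apply: pbound_leq (fun a => hu (f a)).
exact/pbound_exp/pbound_add/pbound_const.
Qed.

End Bounds.

Ltac pb := repeat first
  [ exact: pbound_const | exact: pbound_sz | assumption | apply: pbound_add
  | apply: pbound_mul | apply: pbound_exp ].

(** Every pushed token costs time, so the running time bounds the growth of the stack. This is what
    keeps compositions polynomial. *)
Lemma ptime_sz {A B} `{enc A, enc B} (f : A -> B) :
  ptime f -> pbound (fun a => sz (f a)).
Proof.
move=> [c [u [hu hc]]]; apply: (@pbound_leq _ _ _ (fun a => sz a + u a)); first by pb.
by move=> a; have [r' /run_size] := hc a [::] [::] [::] [::] None; rewrite /= !cats0.
Qed.

(** The empty program suffices. Constructors reduce to pairing in this way: a cons cell, a [Some]
    and a successor have the tree of a pair. *)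
Lemma ptime_recode {A B} `{enc A, enc B} (f : A -> B) :
  (forall a, E (f a) = E a) -> ptime f.
Proof.
move=> hf; exists Skip, (fun=> 0); split; first by pb.
by move=> a *; rewrite hf; eexists; apply: run_skip.
Qed.

Lemma ptime_id {A} `{enc A} : ptime (fun a : A => a).
Proof. exact: ptime_recode. Qed.

Lemma ptime_comp {A B C} `{enc A, enc B, enc C} (g : B -> C) (f : A -> B) :
  ptime g -> ptime f -> ptime (fun a => g (f a)).
Proof.
move=> [cg [ug [hug hg]]] pf; have szf := ptime_sz pf.
case: pf => [cf [uf [huf hf]]].
exists (cf ;; cg), (fun a => uf a + ug (f a)); split.
  by pb; apply: pbound_comp.
move=> a rest s1 s2 s3 r.
have [r1 h1] := hf a rest s1 s2 s3 r; have [r2 h2] := hg (f a) rest s1 s2 s3 r1.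
by exists r2; apply: run_seq h1 h2.
Qed.

#[export] Instance enc_tree : enc tree := Enc (@inj_id tree).

Definition E_prod {A B} `{enc A, enc B} (p : A * B) : tree := Node (E p.1) (E p.2).

Lemma E_prod_inj {A B} `{enc A, enc B} : injective (@E_prod A B _ _).
Proof.
move=> [a b] [a' b']; rewrite /E_prod /= => -[] e1 e2.
by rewrite (E_inj e1) (E_inj e2).
Qed.

#[export] Instance enc_prod {A B} `{enc A, enc B} : enc (A * B) := Enc E_prod_inj.

Lemma sz_pair {A B} `{enc A, enc B} (a : A) (b : B) : sz (a, b) = (sz a + sz b).+1.
Proof. by rewrite /sz /= size_cat. Qed.

Lemma ptime_pair {A B C} `{enc A, enc B, enc C} (f : A -> B) (g : A -> C) :
  ptime f -> ptime g -> ptime (fun a => (f a, g a)).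
Proof.
move=> [cf [uf [huf hf]]] [cg [ug [hug hg]]].
(* [g] runs first because the code of the second component has to lie below that of the first. *)
exists (save ;; cg ;; back ;; cf ;; pushc S0 (Some true)).
exists (fun a => (32 * sz a + 18) + (ug a + ((5 * sz a + 2) + (uf a + 2)))).
split; first by pb.
move=> a rest s1 s2 s3 r.
have [r1 h1] := hg a rest (rev (code (E a)) ++ hash :: s1) s2 s3 (Some hash).
have [r2 h2] := hf a (code (E (g a)) ++ rest) s1 s2 s3 (Some hash).
exists r2; eapply run_seq; first exact: run_save.
eapply run_seq; first exact: h1.
eapply run_seq; first exact: run_restore.
eapply run_seq; first exact: h2.
by rewrite /= -catA; apply: run_push.
Qed.

Lemma ptime_fst0 {A B} `{enc A, enc B} : ptime (fun p : A * B => p.1).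
Proof.
exists (Pop S0 ;; mv ;; drop_tree ;; back).
exists (fun p => 1 + ((20 * sz p + 10) + ((25 * sz p + 12) + (5 * sz p + 2)))).
split; first by pb.
move=> [a b] rest s1 s2 s3 r; exists (Some hash).
have la : sz a <= sz (a, b) by rewrite sz_pair; lia.
have lb : sz b <= sz (a, b) by rewrite sz_pair; lia.
apply: run_leq.
  eapply run_seq; first exact: run_pop.
  rewrite /= -catA; eapply run_seq; first exact: run_mv.
  eapply run_seq; first exact: run_drop.
  exact: run_restore.
by move: la lb; rewrite /sz; lia.
Qed.

Lemma ptime_snd0 {A B} `{enc A, enc B} : ptime (fun p : A * B => p.2).
Proof.
exists (Pop S0 ;; drop_tree), (fun p => 1 + (25 * sz p + 12)).
split; first by pb.
move=> [a b] rest s1 s2 s3 r; exists (Some hash).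
have la : sz a <= sz (a, b) by rewrite sz_pair; lia.
apply: run_leq.
  eapply run_seq; first exact: run_pop.
  by rewrite /= -catA; apply: run_drop.
by move: la; rewrite /sz; lia.
Qed.

Lemma ptime_const {A B} `{enc A, enc B} (b : B) : ptime (fun _ : A => b).
Proof.
exists (drop_tree ;; push_all (rev (code (E b)))).
exists (fun a => (25 * sz a + 12) + 2 * sz b); split; first by pb.
move=> a rest s1 s2 s3 r; exists (Some hash).
eapply run_seq; first exact: run_drop.
exact: run_push_code.
Qed.

(* A nonempty tree has the code of the pair of its subtrees, so that the
   scrutinee [h a] can be handed over to the branch [f1] under its other type. *)
Lemma ptime_case {A B C D} `{enc A, enc B, enc C, enc D}
    (h : A -> B) (f0 : A -> C) (f1 : A * D -> C) (f : A -> C) :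
  ptime h -> ptime f0 -> ptime f1 ->
  (forall a, (E (h a) = Leaf /\ f a = f0 a) \/
             (exists d, [/\ E (h a) = E d, E (h a) <> Leaf & f a = f1 (a, d)])) ->
  ptime f.
Proof.
move=> ph [c0 [u0 [hu0 h0]]] [c1 [u1 [hu1 h1]]] hf.
have szh := ptime_sz ph; case: ph => [ch [uh [huh hh]]].
exists (save ;; ch ;; Pop S0 ;; If (pred1 (Some (Some true)))
  (pushc S0 (Some true) ;; back ;; pushc S0 (Some true) ;; c1) (back ;; c0)).
case: hu1 => k hu1.
exists (fun a => (32 * sz a + 18) + (uh a + (1 +
  (2 + (2 + ((5 * sz a + 2) + (2 + (u0 a + (sz a + sz (h a) + 1 + 2) ^ k)))))))).
split; first by pb.
move=> a rest s1 s2 s3 r.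
have [r1 hh1] := hh a rest (rev (code (E a)) ++ hash :: s1) s2 s3 (Some hash).
case: (hf a) => [[eN ->]|[d [eD nN ->]]].
  have [r2 h2] := h0 a rest s1 s2 s3 (Some hash).
  exists r2; apply: run_leq.
    eapply run_seq; first exact: run_save.
    eapply run_seq; first exact: hh1.
    rewrite eN; eapply run_seq; first exact: run_pop.
    apply: run_ifF => //=.
    eapply run_seq; first exact: run_restore.
    exact: h2.
  by rewrite /sz; lia.
have [r2 h2] := h1 (a, d) rest s1 s2 s3 (Some hash).
exists r2; apply: run_leq.
  eapply run_seq; first exact: run_save.
  eapply run_seq; first exact: hh1.
  case eh : (E (h a)) nN => [//|t1 t2] _.
  eapply run_seq; first exact: run_pop.
  apply: run_ifT => //=.
  eapply run_seq; first exact: run_push.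
  eapply run_seq; first exact: run_restore.
  eapply run_seq; first exact: run_push.
  have e : code (E (a, d)) ++ rest =
      Some true :: code (E a) ++ Some true :: (code t1 ++ code t2) ++ rest.
    by rewrite /= -eD eh -catA.
  by rewrite e in h2; exact: h2.
have := hu1 (a, d); rewrite sz_pair (_ : sz d = sz (h a)) ?/sz ?eD //.
by rewrite -(addn1 (_ + _)); lia.
Qed.

(** The code of [h a] is the loop counter: moved to stack 3, it loses one token per iteration. A
    bound on the iterates has to be assumed, since iterating a polynomial-time function can make
    sizes explode. *)
Lemma ptime_iter0 {A B S} `{enc A, enc B, enc S} (f : S -> S) (g : A -> S) (h : A -> B)
    (b : A -> nat) :
  ptime f -> ptime g -> ptime h -> pbound b ->
  (forall a j, j <= sz (h a) -> sz (iter j f (g a)) <= b a) ->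
  ptime (fun a => iter (sz (h a)) f (g a)).
Proof.
move=> [cf [uf [[k huf] hf]]] [cg [ug [hug hg]]] ph hb hs.
have szh := ptime_sz ph; case: ph => [ch [uh [huh hh]]].
exists (save ;; ch ;; mv ;; pushc S3 hash ;; fuel13 ;; back ;; cg ;; Pop S3 ;;
  While not_hash (cf ;; Pop S3)).
exists (fun a => (32 * sz a + 18) + (uh a + ((20 * sz (h a) + 10) + (2 +
  ((5 * sz (h a) + 2) + ((5 * sz a + 2) + (ug a + (1 +
   (sz (h a) * ((b a + 2) ^ k + 3) + 1))))))))).
split; first by pb.
move=> a rest s1 s2 s3 r.
have [r1 h1] := hh a rest (rev (code (E a)) ++ hash :: s1) s2 s3 (Some hash).
have [r2 h2] := hg a rest s1 s2 (code (E (h a)) ++ hash :: s3) (Some hash).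
have W : forall (l : seq tok) (x : S), all (predC1 hash) l ->
    (forall j, j <= size l -> sz (iter j f x) <= b a) ->
    run (While not_hash (cf ;; Pop S3))
    (Store (ohead (l ++ hash :: s3)) (code (E x) ++ rest) s1 s2 (behead (l ++ hash :: s3)))
    (Store (Some hash) (code (E (iter (size l) f x)) ++ rest) s1 s2 s3)
    (size l * ((b a + 2) ^ k + 3) + 1).
  elim=> [|y l IH] x /=; first by move=> *; apply: run_whileF.
  move=> /andP[hy hl] hx.
  have [r3 h3] := hf x rest s1 s2 (l ++ hash :: s3) (Some y).
  apply: run_leq.
    eapply run_whileT; first exact: not_hash_some.
      by eapply run_seq; [exact: h3|exact: run_pop].
    rewrite /= -/(iter (size l).+1 f x) iterSr; apply: IH => // j lj.
    by rewrite -iterSr; apply: hx.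
  have := huf x; have : (sz x + 2) ^ k <= (b a + 2) ^ k.
    by case: (k) => // k'; rewrite leq_exp2r // leq_add2r (hx 0).
  by rewrite mulSn; lia.
exists (Some hash); rewrite {2}/sz.
eapply run_seq; first exact: run_save.
eapply run_seq; first exact: h1.
eapply run_seq; first exact: run_mv.
eapply run_seq; first exact: run_push.
eapply run_seq; first exact: run_fuel.
eapply run_seq; first exact: run_restore.
eapply run_seq; first exact: h2.
eapply run_seq; first exact: run_pop.
by apply: W; [apply: code_nohash|apply: hs].
Qed.


(** * Encodings of data types and basic closure properties *)

Definition E_bool (b : bool) : tree := if b then Node Leaf Leaf else Leaf.
Lemma E_bool_inj : injective E_bool. Proof. by move=> [] []. Qed.
#[export] Instance enc_bool : enc bool := Enc E_bool_inj.

Lemma E_unit_inj : injective (fun _ : unit => Leaf). Proof. by move=> [] []. Qed.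
#[export] Instance enc_unit : enc unit := Enc E_unit_inj.

(** Unary, so bounds are polynomial in the value. The tree is that of a [seq unit] of length [n],
    which turns the size of such a list, and its inverse, into mere recodings. *)
Definition E_nat (n : nat) : tree := iter n (Node Leaf) Leaf.
Lemma E_nat_inj : injective E_nat.
Proof. by elim=> [|m IH] [|n] //= [] /IH ->. Qed.
#[export] Instance enc_nat_unary : enc nat := Enc E_nat_inj.

Definition E_seq {A} `{enc A} (s : seq A) : tree := foldr (fun a t => Node (E a) t) Leaf s.
Lemma E_seq_inj {A} `{enc A} : injective (@E_seq A _).
Proof. by elim=> [|a s IH] [|b t] //= [] e /IH ->; rewrite (E_inj e). Qed.
#[export] Instance enc_seq {A} `{enc A} : enc (seq A) := Enc E_seq_inj.

Definition E_option {A} `{enc A} (o : option A) : tree :=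
  if o is Some a then Node (E a) Leaf else Leaf.
Lemma E_option_inj {A} `{enc A} : injective (@E_option A _).
Proof. by case=> [a|] [b|] //= [] e; rewrite (E_inj e). Qed.
#[export] Instance enc_option {A} `{enc A} : enc (option A) := Enc E_option_inj.

Lemma sz_cons {A} `{enc A} (a : A) s : sz (a :: s) = (sz a + sz s).+1.
Proof. by rewrite /sz /= size_cat. Qed.

Lemma sz_nil {A} `{enc A} : sz ([::] : seq A) = 1.
Proof. by []. Qed.

Lemma sz_bool (b : bool) : sz b <= 3. Proof. by case: b. Qed.

Lemma sz_nat (n : nat) : sz n = n.*2.+1.
Proof. by rewrite /sz; elim: n => //= n; lia. Qed.

Lemma sz_seqE {A} `{enc A} (s : seq A) : sz s = (\sum_(a <- s) (sz a).+1).+1.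
Proof.
elim: s => [|a s IH]; first by rewrite big_nil.
by rewrite sz_cons big_cons IH; lia.
Qed.

Lemma sz_cat {A} `{enc A} (s t : seq A) : (sz (s ++ t)).+1 = sz s + sz t.
Proof. by rewrite !sz_seqE big_cat /=; lia. Qed.

Lemma sz_rev {A} `{enc A} (s : seq A) : sz (rev s) = sz s.
Proof.
elim: s => // a s IH; rewrite rev_cons -cats1 sz_cons.
by generalize (sz_cat (rev s) [:: a]); rewrite IH sz_cons sz_nil; lia.
Qed.

Lemma sz_take {A} `{enc A} j (s : seq A) : sz (take j s) <= sz s.
Proof.
by generalize (sz_cat (take j s) (drop j s)); rewrite cat_take_drop !sz_seqE; lia.
Qed.

Lemma sz_drop {A} `{enc A} j (s : seq A) : sz (drop j s) <= sz s.
Proof.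
by generalize (sz_cat (take j s) (drop j s)); rewrite cat_take_drop !sz_seqE; lia.
Qed.

Lemma size_sz {A} `{enc A} (s : seq A) : size s < sz s.
Proof. by elim: s => //= a s IH; rewrite sz_cons; lia. Qed.

Section Basic.
Context {A B C : Type} `{enc A, enc B, enc C}.

Lemma ptime_ext (f g : A -> B) : ptime f -> (forall a, f a = g a) -> ptime g.
Proof.
move=> [c [u [hu hc]]] e; exists c, u; split=> // a rest s1 s2 s3 r.
by rewrite -e; apply: hc.
Qed.

Lemma ptime_fst (f : A -> B * C) : ptime f -> ptime (fun a => (f a).1).
Proof. exact: (ptime_comp ptime_fst0). Qed.

Lemma ptime_snd (f : A -> B * C) : ptime f -> ptime (fun a => (f a).2).
Proof. exact: (ptime_comp ptime_snd0). Qed.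

Lemma ptime_if (b : A -> bool) (f g : A -> B) :
  ptime b -> ptime f -> ptime g -> ptime (fun a => if b a then f a else g a).
Proof.
move=> hb hf hg.
apply: (ptime_case hb hg (ptime_comp hf (@ptime_fst0 A (tree * tree) _ _))) => a.
by case: (b a); [right; exists (Leaf, Leaf)|left].
Qed.

Lemma ptime_seqcase (l : A -> seq B) (f0 : A -> C) (f1 : A -> B -> seq B -> C) :
  ptime l -> ptime f0 -> ptime (fun p : A * (B * seq B) => f1 p.1 p.2.1 p.2.2) ->
  ptime (fun a => if l a is b :: s then f1 a b s else f0 a).
Proof.
move=> hl h0 h1; apply: (ptime_case hl h0 h1) => a.
by case: (l a) => [|b s]; [left|right; exists (b, s)].
Qed.

Lemma ptime_natcase (n : A -> nat) (f0 : A -> C) (f1 : A -> nat -> C) :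
  ptime n -> ptime f0 -> ptime (fun p : A * nat => f1 p.1 p.2) ->
  ptime (fun a => if n a is m.+1 then f1 a m else f0 a).
Proof.
move=> hl h0 h1.
have h1' : ptime (fun p : A * (unit * nat) => f1 p.1 p.2.2).
  apply: (@ptime_comp _ _ _ _ _ _ (fun p : A * nat => f1 p.1 p.2)
    (fun p : A * (unit * nat) => (p.1, p.2.2))) => //.
  by apply: ptime_pair; [|apply: ptime_comp ptime_snd0 _];
    [exact: ptime_fst0|exact: ptime_snd0].
apply: (ptime_case hl h0 h1') => a.
by case: (n a) => [|m]; [left|right; exists (tt, m)].
Qed.

Lemma ptime_treecase (t : A -> tree) (f0 : A -> C) (f1 : A -> tree -> tree -> C) :
  ptime t -> ptime f0 -> ptime (fun p : A * (tree * tree) => f1 p.1 p.2.1 p.2.2) ->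
  ptime (fun a => match t a with Leaf => f0 a | Node b c => f1 a b c end).
Proof.
move=> hl h0 h1; apply: (ptime_case hl h0 h1) => a.
by case: (t a) => [|b c]; [left|right; exists (b, c)].
Qed.

Lemma ptime_cons (f : A -> B) (g : A -> seq B) :
  ptime f -> ptime g -> ptime (fun a => f a :: g a).
Proof.
move=> hf hg.
apply: (@ptime_comp _ _ _ _ _ _ (fun p : B * seq B => p.1 :: p.2) (fun a => (f a, g a))).
  exact: ptime_recode.
exact: ptime_pair.
Qed.

Lemma ptime_Some (f : A -> B) : ptime f -> ptime (fun a => Some (f a)).
Proof.
move=> hf.
apply: (@ptime_comp _ _ _ _ _ _ (fun p : B * unit => Some p.1) (fun a => (f a, tt))).
  exact: ptime_recode.
exact/ptime_pair/ptime_const.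
Qed.

Lemma ptime_succn (f : A -> nat) : ptime f -> ptime (fun a => (f a).+1).
Proof.
move=> hf.
apply: (@ptime_comp _ _ _ _ _ _ (fun p : unit * nat => p.2.+1) (fun a => (tt, f a))).
  exact: ptime_recode.
exact: (ptime_pair (ptime_const _)).
Qed.

Lemma ptime_E (f : A -> B) : ptime f -> ptime (fun a => E (f a)).
Proof. by apply: ptime_comp; apply: ptime_recode. Qed.

End Basic.

Section BoolOps.
Context {A : Type} `{enc A}.

Lemma ptime_andb (f g : A -> bool) : ptime f -> ptime g -> ptime (fun a => f a && g a).
Proof. by move=> hf hg; apply: ptime_ext (ptime_if hf hg (ptime_const false)) _. Qed.

Lemma ptime_orb (f g : A -> bool) : ptime f -> ptime g -> ptime (fun a => f a || g a).
Proof. by move=> hf hg; apply: ptime_ext (ptime_if hf (ptime_const true) hg) _. Qed.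

Lemma ptime_negb (f : A -> bool) : ptime f -> ptime (fun a => ~~ f a).
Proof.
by move=> hf; apply: ptime_ext (ptime_if hf (ptime_const false) (ptime_const true)) _.
Qed.

End BoolOps.

Ltac pt_head :=
  lazymatch goal with
  | |- ptime (fun x => x) => exact ptime_id
  | |- ptime fst => exact ptime_fst0
  | |- ptime snd => exact ptime_snd0
  | |- ptime (fun x => (@?f x, @?g x)) => apply (ptime_pair (f := f) (g := g))
  | |- ptime (fun x => fst (@?f x)) => apply (ptime_fst (f := f))
  | |- ptime (fun x => snd (@?f x)) => apply (ptime_snd (f := f))
  | |- ptime (fun x => (@?f x) && (@?g x)) => apply (ptime_andb (f := f) (g := g))
  | |- ptime (fun x => (@?f x) || (@?g x)) => apply (ptime_orb (f := f) (g := g))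
  | |- ptime (fun x => ~~ (@?f x)) => apply (ptime_negb (f := f))
  | |- ptime (fun x => (@?f x) :: (@?g x)) => apply (ptime_cons (f := f) (g := g))
  | |- ptime (fun x => Some (@?f x)) => apply (ptime_Some (f := f))
  | |- ptime (fun x => (@?f x).+1) => apply (ptime_succn (f := f))
  | |- ptime (fun x => E (@?f x)) => apply (ptime_E (f := f))
  | |- ptime (fun x => match _ with _ => _ end) =>
      first [ apply ptime_if | apply ptime_seqcase | apply ptime_natcase
            | apply ptime_treecase ]
  end.

Lemma ptime_app2 {A B C D} `{enc A, enc B, enc C, enc D} (f : A -> B -> C)
    (g : D -> A) (h : D -> B) :
  ptime (fun p : A * B => f p.1 p.2) -> ptime g -> ptime h ->
  ptime (fun x => f (g x) (h x)).
Proof.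
move=> hf hg hh.
exact: (ptime_comp (f := fun x => (g x, h x)) hf (ptime_pair hg hh)).
Qed.

Lemma ptime_app3 {A B C D F} `{enc A, enc B, enc C, enc D, enc F} (f : A -> B -> C -> D)
    (g : F -> A) (h : F -> B) (k : F -> C) :
  ptime (fun p : A * (B * C) => f p.1 p.2.1 p.2.2) -> ptime g -> ptime h -> ptime k ->
  ptime (fun x => f (g x) (h x) (k x)).
Proof.
move=> hf hg hh hk.
exact: (ptime_comp (f := fun x => (g x, (h x, k x))) hf
  (ptime_pair hg (ptime_pair hh hk))).
Qed.

Ltac pt0 := repeat (cbv beta; first [assumption | exact (ptime_const _) | pt_head]).

Section Fold.
Context {A B S : Type} `{enc A, enc B, enc S}.
Variables (f : A -> S -> B -> S) (i : A -> S) (l : A -> seq B) (b : A -> nat).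
Hypotheses (hf : ptime (fun p : A * (S * B) => f p.1 p.2.1 p.2.2))
  (hi : ptime i) (hl : ptime l) (hb : pbound b)
  (hs : forall a j, sz (foldl (f a) (i a) (take j (l a))) <= b a).

(** The iterated state carries the unread part of the list and the argument [a] along with the
    accumulator. [F] is the identity once the list is read, so [sz (l a)] iterations, more than the
    length of the list, give the right value. *)
Lemma ptime_foldl : ptime (fun a => foldl (f a) (i a) (l a)).
Proof.
pose F (st : seq B * (A * S)) : seq B * (A * S) :=
  if st.1 is x :: s then (s, (st.2.1, f st.2.1 st.2.2 x)) else st.
have itF a j : iter j F (l a, (a, i a)) =
    (drop j (l a), (a, foldl (f a) (i a) (take j (l a)))).
  elim: j => [|j IH]; first by rewrite drop0 take0.
  rewrite iterS IH /F /=; case: (ltnP j (size (l a))) => lj.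
    case el: (l a) => [|x0 s0]; first by rewrite el in lj.
    by rewrite -el (drop_nth x0) // (take_nth x0) // -cats1 foldl_cat.
  by rewrite (drop_oversize lj) drop_oversize ?(take_oversize lj) ?take_oversize // leqW.
have pF : ptime F.
  rewrite /F; pt0.
  by apply (ptime_app3 hf); pt0.
have := @ptime_iter0 A (seq B) (seq B * (A * S)) _ _ _ F (fun a => (l a, (a, i a))) l
  (fun a => sz (l a) + (sz a + b a) + 2) pF ltac:(pt0) hl.
case.
- by pb; apply: ptime_sz.
- move=> a j _; rewrite itF !sz_pair.
  by generalize (sz_drop j (l a)) (hs a j); lia.
move=> c hc; have {}hc : ptime (fun a => iter (sz (l a)) F (l a, (a, i a))) by exists c.
apply: ptime_ext (ptime_snd (ptime_snd hc)) _ => a.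
by rewrite itF /= take_oversize // ltnW // size_sz.
Qed.

End Fold.


(** * Polynomial time of the usual functions on lists and numbers *)

Lemma ptime_all {A B} `{enc A, enc B} (p : A -> B -> bool) (l : A -> seq B) :
  ptime (fun q : A * B => p q.1 q.2) -> ptime l -> ptime (fun a => all (p a) (l a)).
Proof.
move=> hp hl.
have := @ptime_foldl A B bool _ _ _ (fun a acc b => acc && p a b) (fun=> true) l (fun=> 3).
case.
- by pt0; apply (ptime_app2 hp); pt0.
- by pt0.
- by [].
- by pb.
- by move=> *; apply: sz_bool.
move=> c hc; have {hc} : ptime (fun a => foldl (fun acc b => acc && p a b) true (l a)).
  by exists c.
move/ptime_ext; apply=> a; rewrite -[RHS]andTb.
by elim: (l a) true => [|b s IH] t /=; [rewrite andbT|rewrite IH andbA].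
Qed.

Lemma ptime_has {A B} `{enc A, enc B} (p : A -> B -> bool) (l : A -> seq B) :
  ptime (fun q : A * B => p q.1 q.2) -> ptime l -> ptime (fun a => has (p a) (l a)).
Proof.
move=> hp hl.
have h : ptime (fun a => ~~ all (fun b => ~~ p a b) (l a)).
  apply: ptime_negb; apply: (ptime_all (p := fun a b => ~~ p a b)) => //.
  by pt0.
by apply: ptime_ext h _ => a; rewrite -has_predC; apply: eq_has => b /=; rewrite negbK.
Qed.

Lemma ptime_rev {A B} `{enc A, enc B} (l : A -> seq B) :
  ptime l -> ptime (fun a => rev (l a)).
Proof.
move=> hl.
have e (s t : seq B) : foldl (fun acc b => b :: acc) t s = rev s ++ t.
  by elim: s t => //= b s IH t; rewrite IH rev_cons cat_rcons.
have h : ptime (fun a => foldl (fun acc b => b :: acc) [::] (l a)).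
  apply: (@ptime_foldl A B (seq B) _ _ _ (fun _ acc b => b :: acc) (fun=> [::]) l
    (fun a => sz (l a))); try by pt0.
    exact: ptime_sz.
  by move=> a j; rewrite e cats0 sz_rev sz_take.
by apply: ptime_ext h _ => a; rewrite e cats0.
Qed.

Lemma ptime_map {A B C} `{enc A, enc B, enc C} (f : A -> B -> C) (l : A -> seq B) :
  ptime (fun q : A * B => f q.1 q.2) -> ptime l -> ptime (fun a => map (f a) (l a)).
Proof.
move=> hf hl.
have e a (s : seq B) (t : seq C) :
    foldl (fun acc b => f a b :: acc) t s = rev (map (f a) s) ++ t.
  by elim: s t => //= b s IH t; rewrite IH rev_cons cat_rcons.
have [k hk] := ptime_sz hf; have szl := ptime_sz hl.
have bm a j : sz (map (f a) (take j (l a))) <= sz (l a) * ((sz a + sz (l a) + 3) ^ k).+1 + 1.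
  have : forall s, sz s <= sz (l a) ->
      sz (map (f a) s) <= size s * ((sz a + sz (l a) + 3) ^ k).+1 + 1.
    elim=> [|b s IH]; first by rewrite sz_nil.
    rewrite sz_cons => hb; rewrite /= sz_cons mulSn.
    have := hk (a, b); rewrite /= sz_pair => h1.
    have : ((sz a + sz b).+1 + 2) ^ k <= (sz a + sz (l a) + 3) ^ k.
      by case: (k) => // k'; rewrite leq_exp2r //; lia.
    have := IH ltac:(lia); lia.
  move/(_ _ (sz_take j (l a))) => h; apply: leq_trans h _.
  rewrite leq_add2r leq_mul2r; apply/orP; right.
  by generalize (size_sz (take j (l a))) (sz_take j (l a)); lia.
have h : ptime (fun a => foldl (fun acc b => f a b :: acc) [::] (l a)).
  apply: (@ptime_foldl A B (seq C) _ _ _ (fun a acc b => f a b :: acc) (fun=> [::]) l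
    (fun a => sz (l a) * ((sz a + sz (l a) + 3) ^ k + 1) + 1)).
  - by pt0; apply (ptime_app2 hf); pt0.
  - by pt0.
  - by [].
  - by pb.
  - by move=> a j; rewrite e cats0 sz_rev (addn1 (_ ^ _)); apply: bm.
by apply: ptime_ext (ptime_rev h) _ => a; rewrite e cats0 revK.
Qed.

Lemma ptime_cat {A B} `{enc A, enc B} (s t : A -> seq B) :
  ptime s -> ptime t -> ptime (fun a => s a ++ t a).
Proof.
move=> hs ht.
have e (x y : seq B) : foldl (fun acc b => b :: acc) y x = rev x ++ y.
  by elim: x y => //= b x IH y; rewrite IH rev_cons cat_rcons.
have h : ptime (fun a => foldl (fun acc b => b :: acc) (t a) (rev (s a))).
  apply: (@ptime_foldl A B (seq B) _ _ _ (fun _ acc b => b :: acc) t (fun a => rev (s a))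
    (fun a => sz (s a) + sz (t a))); try by pt0.
  - exact: ptime_rev.
  - by apply: pbound_add; apply: ptime_sz.
  - move=> a j; rewrite e.
    generalize (sz_cat (rev (take j (rev (s a)))) (t a)) (sz_take j (rev (s a))).
    by rewrite !sz_rev; lia.
by apply: ptime_ext h _ => a; rewrite e revK.
Qed.

Lemma ptime_filter {A B} `{enc A, enc B} (p : A -> B -> bool) (l : A -> seq B) :
  ptime (fun q : A * B => p q.1 q.2) -> ptime l -> ptime (fun a => filter (p a) (l a)).
Proof.
move=> hp hl.
have e a (s t : seq B) :
    foldl (fun acc b => if p a b then b :: acc else acc) t s = rev (filter (p a) s) ++ t.
  by elim: s t => //= b s IH t; rewrite IH; case: ifP => _; rewrite ?rev_cons ?cat_rcons.
have szf a (s : seq B) : sz (filter (p a) s) <= sz s.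
  by elim: s => //= b s IH; case: ifP => _; rewrite !sz_cons; lia.
have h : ptime (fun a => foldl (fun acc b => if p a b then b :: acc else acc) [::] (l a)).
  apply: (@ptime_foldl A B (seq B) _ _ _ (fun a acc b => if p a b then b :: acc else acc)
    (fun=> [::]) l (fun a => sz (l a))).
  - by pt0; apply (ptime_app2 hp); pt0.
  - by pt0.
  - by [].
  - exact: ptime_sz.
  - by move=> a j; rewrite e cats0 sz_rev (leq_trans (szf _ _)) ?sz_take.
by apply: ptime_ext (ptime_rev h) _ => a; rewrite e cats0 revK.
Qed.

Lemma ptime_flatten {A B} `{enc A, enc B} (l : A -> seq (seq B)) :
  ptime l -> ptime (fun a => flatten (l a)).
Proof.
move=> hl.
have e (s : seq (seq B)) t : foldl (fun acc b => acc ++ b) t s = t ++ flatten s.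
  by elim: s t => [|b s IH] t /=; rewrite ?cats0 // IH catA.
have szf (s : seq (seq B)) : sz (flatten s) <= sz s.
  elim: s => //= b s IH; rewrite sz_cons.
  by generalize (sz_cat b (flatten s)); lia.
have h : ptime (fun a => foldl (fun acc b => acc ++ b) [::] (l a)).
  apply: (@ptime_foldl A (seq B) (seq B) _ _ _ (fun a acc b => acc ++ b)
    (fun=> [::]) l (fun a => sz (l a))).
  - by apply: ptime_cat; pt0.
  - by pt0.
  - by [].
  - exact: ptime_sz.
  - by move=> a j; rewrite e (leq_trans (szf _)) ?sz_take.
by apply: ptime_ext h _ => a; rewrite e.
Qed.

Lemma ptime_allpairs {A B C D} `{enc A, enc B, enc C, enc D} (f : A -> B -> C -> D)
    (s : A -> seq B) (t : A -> B -> seq C) :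
  ptime (fun p : A * (B * C) => f p.1 p.2.1 p.2.2) -> ptime s ->
  ptime (fun p : A * B => t p.1 p.2) ->
  ptime (fun a => [seq f a b c | b <- s a, c <- t a b]).
Proof.
move=> hf hs ht; apply: ptime_flatten.
apply: (ptime_map (f := fun a b => [seq f a b c | c <- t a b])) => //.
apply: (ptime_map (f := fun (p : A * B) c => f p.1 p.2 c)) => //.
by apply (ptime_app3 hf); pt0.
Qed.

Lemma ptime_size {A B} `{enc A, enc B} (l : A -> seq B) :
  ptime l -> ptime (fun a => size (l a)).
Proof.
move=> hl.
have h1 : ptime (fun s : seq unit => size s) by apply: ptime_recode; elim=> //= -[] s ->.
have h2 : ptime (fun a => [seq tt | _ <- l a]).
  by apply: (ptime_map (f := fun _ _ => tt)) => //; pt0.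
by apply: ptime_ext (ptime_comp h1 h2) _ => a; rewrite size_map.
Qed.

Lemma ptime_nseq {A B} `{enc A, enc B} (n : A -> nat) (b : A -> B) :
  ptime n -> ptime b -> ptime (fun a => nseq (n a) (b a)).
Proof.
move=> hn hb.
have h1 : ptime (fun n : nat => nseq n tt) by apply: ptime_recode; elim=> //= k ->.
have h2 : ptime (fun a => [seq b a | _ <- nseq (n a) tt]).
  by apply: (ptime_map (f := fun a _ => b a)); [apply: ptime_comp hb _; pt0|exact: ptime_comp hn].
by apply: ptime_ext h2 _ => a; rewrite map_nseq.
Qed.

Lemma ptime_addn {A} `{enc A} (m n : A -> nat) :
  ptime m -> ptime n -> ptime (fun a => m a + n a).
Proof.
move=> hm hn.
have h : ptime (fun a => size (nseq (m a) tt ++ nseq (n a) tt)).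
  by apply/ptime_size/ptime_cat; apply: ptime_nseq => //; pt0.
by apply: ptime_ext h _ => a; rewrite size_cat !size_nseq.
Qed.

Lemma ptime_muln {A} `{enc A} (m n : A -> nat) :
  ptime m -> ptime n -> ptime (fun a => m a * n a).
Proof.
move=> hm hn.
have h : ptime (fun a => size [seq tt | _ <- nseq (m a) tt, _ <- nseq (n a) tt]).
  apply/ptime_size.
  apply: (ptime_allpairs (f := fun _ _ _ => tt) (t := fun a _ => nseq (n a) tt)).
  - by pt0.
  - by apply: ptime_nseq => //; pt0.
  - apply: ptime_nseq; last by pt0.
    by apply: ptime_comp hn _; pt0.
by apply: ptime_ext h _ => a; rewrite size_allpairs !size_nseq.
Qed.

Lemma ptime_expn {A} `{enc A} (m : A -> nat) k : ptime m -> ptime (fun a => m a ^ k).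
Proof.
move=> hm; elim: k => [|k IH]; first exact: (ptime_const 1).
by apply: ptime_ext (ptime_muln hm IH) _ => a; rewrite expnS.
Qed.

Lemma ptime_iter {A S} `{enc A, enc S} (f : A -> S -> S) (n : A -> nat) (i : A -> S)
    (b : A -> nat) :
  ptime (fun p : A * S => f p.1 p.2) -> ptime n -> ptime i -> pbound b ->
  (forall a j, j <= n a -> sz (iter j (f a) (i a)) <= b a) ->
  ptime (fun a => iter (n a) (f a) (i a)).
Proof.
move=> hf hn hi hb hs.
have e a j s : foldl (fun s _ => f a s) s (nseq j tt) = iter j (f a) s.
  by elim: j s => //= j IH s; rewrite IH -iterSr.
have h : ptime (fun a => foldl (fun s _ => f a s) (i a) (nseq (n a) tt)).
  apply: (@ptime_foldl A unit S _ _ _ (fun a s _ => f a s) i (fun a => nseq (n a) tt) b) => //.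
  - by apply (ptime_app2 hf); pt0.
  - by apply: ptime_nseq => //; pt0.
  - move=> a j; case: (leqP j (n a)) => lj; first by rewrite take_nseq // e hs.
    by rewrite take_oversize ?size_nseq; [rewrite e; apply: hs|apply: ltnW].
by apply: ptime_ext h _ => a; rewrite e.
Qed.

Lemma ptime_predn {A} `{enc A} (n : A -> nat) : ptime n -> ptime (fun a => (n a).-1).
Proof.
move=> hn.
have h : ptime (fun a => if n a is m.+1 then m else 0) by pt0.
by apply: ptime_ext h _ => a; case: (n a).
Qed.

Lemma ptime_subn {A} `{enc A} (m n : A -> nat) :
  ptime m -> ptime n -> ptime (fun a => m a - n a).
Proof.
move=> hm hn.
have h : ptime (fun a => iter (n a) predn (m a)).
  apply: (@ptime_iter A nat _ _ (fun _ => predn) n m (fun a => sz (m a))) => //.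
  - by apply: ptime_predn; pt0.
  - exact: ptime_sz.
  - by move=> a j _; rewrite iter_predn !sz_nat; lia.
by apply: ptime_ext h _ => a; rewrite iter_predn.
Qed.

Lemma ptime_behead {A B} `{enc A, enc B} (l : A -> seq B) :
  ptime l -> ptime (fun a => behead (l a)).
Proof.
move=> hl; have h : ptime (fun a => if l a is b :: s then s else [::]) by pt0.
by apply: ptime_ext h _ => a; case: (l a).
Qed.

Lemma ptime_head {A B} `{enc A, enc B} (d : A -> B) (l : A -> seq B) :
  ptime d -> ptime l -> ptime (fun a => head (d a) (l a)).
Proof.
move=> hd hl; have h : ptime (fun a => if l a is b :: s then b else d a) by pt0.
by apply: ptime_ext h _ => a; case: (l a).
Qed.

Lemma ptime_drop {A B} `{enc A, enc B} (n : A -> nat) (l : A -> seq B) :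
  ptime n -> ptime l -> ptime (fun a => drop (n a) (l a)).
Proof.
move=> hn hl.
have h : ptime (fun a => iter (n a) behead (l a)).
  apply: (@ptime_iter A (seq B) _ _ (fun _ => behead) n l (fun a => sz (l a))) => //.
  - by apply: ptime_behead; pt0.
  - exact: ptime_sz.
  - by move=> a j _; rewrite -drop_behead sz_drop.
by apply: ptime_ext h _ => a; rewrite -drop_behead.
Qed.

Lemma ptime_nth {A B} `{enc A, enc B} (d : A -> B) (l : A -> seq B) (n : A -> nat) :
  ptime d -> ptime l -> ptime n -> ptime (fun a => nth (d a) (l a) (n a)).
Proof.
move=> hd hl hn; have h := ptime_head hd (ptime_drop hn hl).
by apply: ptime_ext h _ => a; rewrite -nth0 nth_drop addn0.
Qed.

Lemma ptime_iota {A} `{enc A} (m n : A -> nat) :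
  ptime m -> ptime n -> ptime (fun a => iota (m a) (n a)).
Proof.
move=> hm hn.
have e k j : iter j (fun s => k + size s :: s) [::] = rev (iota k j).
  by elim: j => // j IH; rewrite iterS IH size_rev size_iota -addn1 iotaD rev_cat.
have szi k j : sz (iota k j) <= j * (2 * (k + j) + 2) + 1.
  elim: j k => // j IH k /=; rewrite sz_cons sz_nat.
  by have := IH k.+1; rewrite addSnnS mulSn; lia.
have h : ptime (fun a => iter (n a) (fun s => m a + size s :: s) [::]).
  apply: (@ptime_iter A (seq nat) _ _ (fun a s => m a + size s :: s) n (fun=> [::])
    (fun a => n a * (2 * (m a + n a) + 2) + 1)) => //.
  - apply: ptime_cons; last by pt0.
    by apply: ptime_addn; [apply: ptime_comp hm _; pt0|apply: ptime_size; pt0].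
  - by pt0.
  - have bm (u : A -> nat) : ptime u -> pbound u.
      by move=> /ptime_sz /pbound_leq; apply=> a; rewrite sz_nat; lia.
    by have := bm _ hm; have := bm _ hn; move=> *; pb.
  - move=> a j lj; rewrite e sz_rev; apply: leq_trans (szi _ _) _.
    by rewrite leq_add2r leq_mul //; lia.
by apply: ptime_ext (ptime_rev h) _ => a; rewrite e revK.
Qed.

Fixpoint tree_eqb (a b : tree) : bool :=
  match a, b with
  | Leaf, Leaf => true
  | Node a1 a2, Node b1 b2 => tree_eqb a1 b1 && tree_eqb a2 b2
  | _, _ => false
  end.

Lemma tree_eqP a b : reflect (a = b) (tree_eqb a b).
Proof.
apply: (iffP idP) => [|<-]; last by elim: a => //= a1 -> a2 ->.
by elim: a b => [|a1 IH1 a2 IH2] [|b1 b2] //= /andP[/IH1-> /IH2->].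
Qed.

(** Recursion on two trees is turned into iteration on a list of pairs still to be compared. Each
    step removes at least one token from the left-hand trees, which bounds the number of steps, and
    the state never grows. *)
Definition teq_step (st : seq (tree * tree) * bool) : seq (tree * tree) * bool :=
  if st.1 is p :: w then
    match p.1 with
    | Leaf => match p.2 with Leaf => (w, st.2) | Node _ _ => (w, false) end
    | Node a1 a2 => match p.2 with
        | Leaf => (w, false)
        | Node b1 b2 => ((a1, b1) :: (a2, b2) :: w, st.2)
        end
    end
  else st.

Lemma teq_iter n w ok : \sum_(p <- w) size (code p.1) <= n ->
  iter n teq_step (w, ok) = ([::], ok && all (fun p => tree_eqb p.1 p.2) w).
Proof.
elim: n w ok => [|n IH] [|[a b] w] ok; rewrite ?big_nil ?big_cons ?andbT //.
- by case: a.
- by move=> _; rewrite iterSr IH ?big_nil ?andbT.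
rewrite iterSr /=; case: a b => [|a1 a2] [|b1 b2] /=; rewrite ?andbF.
- by rewrite addSn add0n ltnS => h; rewrite IH.
- by rewrite addSn add0n ltnS => h; rewrite IH.
- by rewrite size_cat => h; rewrite IH //=; lia.
- by rewrite size_cat => h; rewrite IH ?big_cons /= ?andbA //; lia.
Qed.

Lemma ptime_tree_eqb : ptime (fun p : tree * tree => tree_eqb p.1 p.2).
Proof.
have ps : ptime teq_step by rewrite /teq_step; pt0.
have h : ptime (fun p => iter (sz p) teq_step ([:: p], true)).
  apply: (@ptime_iter0 _ _ _ _ _ _ teq_step (fun p => ([:: p], true)) (fun p => p)
    (fun p => sz ([:: p], true))) => //; try by pt0.
    by apply: ptime_sz; pt0.
  move=> p j _; elim: j => // j IH; apply: leq_trans IH; rewrite iterS.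
  case: (iter _ _ _) => [[|[a b] w] ok]; rewrite /teq_step //=.
  case: a b => [|a1 a2] [|b1 b2] /=; rewrite !sz_pair ?sz_cons ?sz_pair /sz /=;
    rewrite ?size_cat /=; case: ok => /=; lia.
apply: ptime_ext (ptime_snd h) _ => -[a b]; rewrite teq_iter /= ?andbT //.
by rewrite big_cons big_nil sz_pair /sz /=; lia.
Qed.

Lemma ptime_eq {A} {B : eqType} `{enc A, enc B} (f g : A -> B) :
  ptime f -> ptime g -> ptime (fun a => f a == g a).
Proof.
move=> hf hg.
have h := ptime_comp ptime_tree_eqb (ptime_pair (ptime_E hf) (ptime_E hg)).
apply: ptime_ext h _ => a /=; apply/tree_eqP/eqP => [e|-> //]; exact: E_inj e.
Qed.

Lemma ptime_in {A} {B : eqType} `{enc A, enc B} (f : A -> B) (l : A -> seq B) :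
  ptime f -> ptime l -> ptime (fun a => f a \in l a).
Proof.
move=> hf hl; have h : ptime (fun a => has (fun b => b == f a) (l a)).
  apply: (ptime_has (p := fun a b => b == f a)) => //.
  by apply: ptime_eq; [pt0|apply: ptime_comp hf _; pt0].
by apply: ptime_ext h _ => a; rewrite (has_pred1 (f a)).
Qed.

Lemma ptime_leq {A} `{enc A} (m n : A -> nat) :
  ptime m -> ptime n -> ptime (fun a => m a <= n a).
Proof.
by move=> hm hn; apply: ptime_eq (ptime_const 0) => //; apply: ptime_subn.
Qed.

(** A case analysis over a finite type is a chain of equality tests along its enumeration. This is
    how the transition function of an arbitrary machine becomes computable. *)
Lemma ptime_finmatch {A C} {B : finType} `{enc A, enc B, enc C} (h : A -> B)
    (g : B -> A -> C) :
  ptime h -> (forall b, ptime (g b)) -> ptime (fun a => g (h a) a).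
Proof.
move=> hh hg.
have [b0 _|B0] := pickP B; last first.
  apply: (ptime_ext (f := fun a => g (h a) a)) => //; exists Skip, (fun=> 0).
  by split; [pb|move=> a; have := B0 (h a)].
have : ptime (fun a => foldr (fun b r => if h a == b then g b a else r) (g b0 a) (enum B)).
  elim: (enum B) => //= b s IH.
  by apply: ptime_if => //; apply: ptime_eq => //; apply: ptime_const.
move/ptime_ext; apply=> a; have := mem_enum B (h a).
elim: (enum B) => //= b s IH; rewrite in_cons eq_sym.
by case: eqP => [<-|].
Qed.

Ltac pt_more :=
  lazymatch goal with
  | |- ptime (fun x => all (fun b => @?p x b) (@?l x)) => apply (ptime_all (p := p) (l := l))
  | |- ptime (fun x => has (fun b => @?p x b) (@?l x)) => apply (ptime_has (p := p) (l := l))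
  | |- ptime (fun x => filter (fun b => @?p x b) (@?l x)) =>
      apply (ptime_filter (p := p) (l := l))
  | |- ptime (fun x => map (fun b => @?f x b) (@?l x)) => apply (ptime_map (f := f) (l := l))
  | |- ptime (fun x => flatten (@?l x)) => apply (ptime_flatten (l := l))
  | |- ptime (fun x => cat (@?f x) (@?g x)) => apply (ptime_cat (s := f) (t := g))
  | |- ptime (fun x => rev (@?f x)) => apply (ptime_rev (l := f))
  | |- ptime (fun x => size (@?f x)) => apply (ptime_size (l := f))
  | |- ptime (fun x => nseq (@?f x) (@?g x)) => apply (ptime_nseq (n := f) (b := g))
  | |- ptime (fun x => addn (@?f x) (@?g x)) => apply (ptime_addn (m := f) (n := g))
  | |- ptime (fun x => muln (@?f x) (@?g x)) => apply (ptime_muln (m := f) (n := g))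
  | |- ptime (fun x => subn (@?f x) (@?g x)) => apply (ptime_subn (m := f) (n := g))
  | |- ptime (fun x => expn (@?f x) ?k) => apply (ptime_expn k (m := f))
  | |- ptime (fun x => leq (@?f x) (@?g x)) => apply (ptime_leq (m := f) (n := g))
  | |- ptime (fun x => predn (@?f x)) => apply (ptime_predn (n := f))
  | |- ptime (fun x => iota (@?f x) (@?g x)) => apply (ptime_iota (m := f) (n := g))
  | |- ptime (fun x => nth (@?d x) (@?f x) (@?g x)) =>
      apply (ptime_nth (d := d) (l := f) (n := g))
  | |- ptime (fun x => head (@?d x) (@?f x)) => apply (ptime_head (d := d) (l := f))
  | |- ptime (fun x => behead (@?f x)) => apply (ptime_behead (l := f))
  | |- ptime (fun x => @?f x == @?g x) => apply (ptime_eq (f := f) (g := g))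
  | |- ptime (fun x => @?f x \in @?g x) => apply (ptime_in (f := f) (l := g))
  end.

Ltac pt_user :=
  lazymatch goal with
  | |- ptime (fun x => ?g (@?f x)) =>
      apply (ptime_comp (g := g) (f := f)); [solve [assumption | auto with ptime] |]
  end.

Create HintDb ptime.

Ltac pt := repeat (cbv beta;
  first [ assumption | exact (ptime_const _) | pt_head | pt_more | pt_user ]).


(** * From programs to Turing machines and back *)

Lemma poly_above k : exists p : {poly nat}, forall n, horner p n = (n + 2) ^ k.
Proof.
elim: k => [|k [p hp]]; first by exists 1%:P%R => n; rewrite hornerC expn0.
exists (p * 'X + p *+ 2)%R => n.
rewrite hornerD hornerMX hornerMn hp.
transitivity ((n + 2) ^ k * n + ((n + 2) ^ k + (n + 2) ^ k)); first by [].
by rewrite expnS mulnDl mulnC mul2n addnn.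
Qed.

Lemma poly_below (p : {poly nat}) : exists k, forall n, horner p n <= (n + 2) ^ k.
Proof.
rewrite /horner; elim: (polyseq p) => [|a s [k hk]]; first by exists 0.
exists (k.+1 + a).+1 => n /=.
have h1 : horner_rec s n * n <= (n + 2) ^ (k.+1 + a).
  apply: leq_trans (leq_mul (hk n) (leq_addr 2 n)) _.
  by rewrite -expnSr leq_pexp2l ?addn2 ?leq_addr.
have h2 : a <= (n + 2) ^ (k.+1 + a).
  apply: leq_trans (ltn_exp2 a n) _.
  by rewrite leq_pexp2l ?addn2 ?leq_addl.
have h3 : 2 * (n + 2) ^ (k.+1 + a) <= (n + 2) ^ (k.+1 + a).+1.
  by rewrite expnS leq_mul2r leq_addl orbT.
by apply: leq_trans (leq_add h1 h2) _; rewrite addnn -mul2n.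
Qed.

Definition nonempty : pred (option tok) := isSome.
Definition is_true_tok : pred (option tok) := pred1 (Some (Some true)).

Definition unload (i j : stk) : cmd := Pop i ;; While nonempty (pushr j ;; Pop i).

Definition encode_body : cmd :=
  (If is_true_tok
    (pushc S0 (Some false) ;; pushc S0 (Some false) ;; pushc S0 (Some true))
    (pushc S0 (Some false)) ;; pushc S0 (Some true) ;; Pop S1).

(** The code of a list begins with its first element, so the input is first reversed onto stack 1
    and the code is then built from the last bit. *)
Definition encode_input : cmd :=
  unload S0 S1 ;; pushc S0 (Some false) ;; Pop S1 ;; While nonempty encode_body.

Definition decode_body : cmd :=
  (Pop S0 ;; If is_true_tok (Pop S0 ;; Pop S0 ;; pushc S1 (Some true))
    (pushc S1 (Some false)) ;; Pop S0).

Definition decode_output : cmd :=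
  Pop S0 ;; While is_true_tok decode_body ;; unload S1 S3.

Lemma run_encode_input (x : seq bool) : exists r,
  run encode_input (Store None [seq Some b | b <- x] [::] [::] [::])
    (Store r (code (E x)) [::] [::] [::]) (20 * size x + 20).
Proof.
have W1 : forall (l s : seq tok), run (While nonempty (pushr S1 ;; Pop S0))
    (Store (ohead l) (behead l) s [::] [::]) (Store None [::] (rev l ++ s) [::] [::])
    (5 * size l + 1).
  elim=> [|a l IH] s /=; first exact: run_whileF.
  rewrite rev_cons cat_rcons; apply: run_leq.
    by eapply run_whileT; [by []|run1|exact: IH].
  by rewrite /=; lia.
have W2 : forall (l y : seq bool), run (While nonempty encode_body)
    (Store (ohead [seq Some b | b <- l]) (code (E y)) (behead [seq Some b | b <- l]) [::] [::])
    (Store None (code (E (rev l ++ y))) [::] [::] [::]) (15 * size l + 1).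
  elim=> [|a l IH] y /=; first exact: run_whileF.
  rewrite rev_cons cat_rcons.
  by case: a; (apply: run_leq;
    [ eapply run_whileT; [by []|rewrite /encode_body; run1|first [exact: (IH (true :: y))|exact: (IH (false :: y))]]
    | rewrite /=; lia ]).
eexists; apply: run_leq.
  eapply run_seq; first by eapply run_seq; [exact: run_pop|exact: W1].
  eapply run_seq; first run1.
  eapply run_seq; first exact: run_pop.
  rewrite /= cats0 -map_rev.
  by have := W2 (rev x) [::]; rewrite revK cats0; apply.
by rewrite size_map size_rev /=; lia.
Qed.

Lemma run_decode_output (y : seq bool) r : exists r' s,
  run decode_output (Store r (code (E y)) [::] [::] [::])
    (Store r' s [::] [::] [seq Some b | b <- y]) (20 * size y + 20).
Proof.
have W1 : forall (l s : seq tok) s0, run (While nonempty (pushr S3 ;; Pop S1))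
    (Store (ohead l) s0 (behead l) [::] s) (Store None s0 [::] [::] (rev l ++ s))
    (5 * size l + 1).
  elim=> [|a l IH] s s0 /=; first exact: run_whileF.
  rewrite rev_cons cat_rcons; apply: run_leq.
    by eapply run_whileT; [by []|run1|exact: IH].
  by rewrite /=; lia.
have W2 : forall (l : seq bool) s, run (While is_true_tok decode_body)
    (Store (ohead (code (E l))) (behead (code (E l))) s [::] [::])
    (Store (Some (Some false)) [::] ([seq Some b | b <- rev l] ++ s) [::] [::])
    (12 * size l + 1).
  elim=> [|a l IH] s /=; first exact: run_whileF.
  rewrite rev_cons map_rcons cat_rcons.
  by case: a; (apply: run_leq;
    [ eapply run_whileT; [by []|rewrite /decode_body; run1|first [exact: (IH (Some true :: s))|exact: (IH (Some false :: s))]]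
    | rewrite /=; lia ]).
exists None, [::]; apply: run_leq.
  eapply run_seq; first exact: run_pop.
  eapply run_seq; first exact: W2.
  eapply run_seq; first exact: run_pop.
  by have := W1 (map some (rev y)) [::] [::]; rewrite -map_rev revK !cats0; apply.
by rewrite size_map size_rev; lia.
Qed.

Lemma sz_bits (x : seq bool) : sz x <= 4 * size x + 1.
Proof. by elim: x => // b x IH; rewrite sz_cons /=; have := sz_bool b; lia. Qed.

Lemma ptime_polytime (f : seq bool -> seq bool) : ptime f -> polytime f.
Proof.
move=> pf; have szf := ptime_sz pf; case: pf => [c [u [hu hc]]].
(* The exponent below is [3 * k] because [sz x + 2] is at most [4 * size x + 3], hence at most
   [(size x + 2) ^ 3]. *)
have hb : pbound (fun x : seq bool => 20 * sz x + 20 + (u x + (20 * sz (f x) + 20))) by pb.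
case: hb => k hk; have [p hp] := poly_above (3 * k).
exists (machine (compile 0 (encode_input ;; c ;; decode_output))), p => x _.
have [r1 h1] := run_encode_input x.
have [r2 h2] := hc x [::] [::] [::] [::] r1; rewrite !cats0 in h2.
have [r3 [s h3]] := run_decode_output (f x) r2.
have [n hn ln] := run_seq h1 (run_seq h2 h3).
apply: computes_within_leq (exec_computes hn).
rewrite hp; apply: (leq_trans ln).
have h4 : 20 * size x + 20 + (u x + (20 * size (f x) + 20)) <= (sz x + 2) ^ k.
  apply: leq_trans (hk x).
  by generalize (size_sz x) (size_sz (f x)); lia.
apply: (leq_trans h4); rewrite expnM; case: (k) => // k'; rewrite leq_exp2r //.
apply: leq_trans (leq_add (sz_bits x) (leqnn 2)) _.
by rewrite !expnS expn0; nia.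
Qed.

Lemma ptime_class_P (f : seq bool -> bool) : ptime f -> class_P f.
Proof.
by move=> pf; exists f; split=> //; apply: ptime_polytime; apply: ptime_cons;
  [|apply: ptime_const].
Qed.

(** * Encoding of configurations and simulation of a Turing machine *)

Section FinEnc.
Variable T : finType.

Definition E_fin (x : T) : tree := E (enum_rank x : nat).
Lemma E_fin_inj : injective E_fin.
Proof. by move=> x y /(@E_inj nat _) /val_inj /enum_rank_inj. Qed.
Definition enc_fin : enc T := Enc E_fin_inj.

Lemma sz_fin (x : T) : @sz _ enc_fin x <= (2 * #|T|).+1.
Proof.
rewrite /sz /= /E_fin; generalize (sz_nat (enum_rank x)); rewrite /sz => ->.
by rewrite -mul2n ltnS leq_mul2l /= ltnW.
Qed.
End FinEnc.

Lemma ptime_same {A B C} `{enc A, enc B, enc C} (h : A -> B) (f : A -> C) :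
  ptime h -> (forall a, E (h a) = E (f a)) -> ptime f.
Proof.
move=> [c [u [hu hc]]] e; exists c, u; split=> // a rest s1 s2 s3 r.
by rewrite -e; apply: hc.
Qed.

Section FfunEnc.
Context {n : nat} {A : Type} `{enc A}.

Definition E_ffun (g : {ffun 'I_n -> A}) : tree := E [seq g i | i <- enum 'I_n].
Lemma E_ffun_inj : injective E_ffun.
Proof.
move=> g h /(@E_inj (seq A) _) e; apply/ffunP => i.
by move/eq_in_map: e => /(_ i); rewrite mem_enum; apply.
Qed.
#[export] Instance enc_ffun : enc {ffun 'I_n -> A} := Enc E_ffun_inj.

Lemma ptime_ffun {B} `{enc B} (g : B -> 'I_n -> A) :
  (forall i, ptime (fun x => g x i)) -> ptime (fun x => [ffun i => g x i]).
Proof.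
move=> hg; apply: (@ptime_same _ (seq A) _ _ _ _ (fun x => [seq g x i | i <- enum 'I_n])).
  by elim: (enum 'I_n) => [|i s IH] /=; [apply: ptime_const|apply: ptime_cons].
by move=> x; congr (@E (seq A) _ _); apply: eq_map => i; rewrite ffunE.
Qed.

Lemma ptime_ffun_app {B} `{enc B} (h : B -> {ffun 'I_n -> A}) (i : 'I_n) :
  ptime h -> ptime (fun x => h x i).
Proof.
move=> hh.
have h1 : ptime (fun x => [seq E (h x j) | j <- enum 'I_n]).
  apply: ptime_same hh _ => x /=; rewrite /E_ffun.
  by elim: (enum 'I_n) => //= j s ->.
have h2 := ptime_nth (ptime_const Leaf) h1 (ptime_const (i : nat)).
apply: ptime_same h2 _ => x.
by rewrite (nth_map i) ?size_enum_ord // nth_ord_enum.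
Qed.

Lemma sz_ffun (g : {ffun 'I_n -> A}) m :
  (forall i, sz (g i) <= m) -> sz g <= n * m.+1 + 1.
Proof.
move=> hm; have -> : sz g = sz [seq g i | i <- enum 'I_n] by [].
rewrite -[X in X * _](size_enum_ord n).
elim: (enum 'I_n) => //= i s IH; rewrite sz_cons mulSn.
by have := hm i; lia.
Qed.

End FfunEnc.

Section TapeEnc.
Context {S : Type} `{enc S}.
Definition E_tape (t : tape S) : tree := E (lft t, (cur t, rgt t)).
Lemma E_tape_inj : injective E_tape.
Proof. by move=> [l c r] [l' c' r'] /(@E_inj (seq S * (S * seq S)) _) [-> -> ->]. Qed.
#[export] Instance enc_tape : enc (tape S) := Enc E_tape_inj.

Lemma ptime_tape {B} `{enc B} (l : B -> seq S) (c : B -> S) (r : B -> seq S) :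
  ptime l -> ptime c -> ptime r -> ptime (fun x => Tape (l x) (c x) (r x)).
Proof.
move=> hl hc hr.
by apply: (@ptime_same _ _ _ _ _ _ (fun x => (l x, (c x, r x)))); first by pt.
Qed.

Lemma ptime_untape {B} `{enc B} (t : B -> tape S) : ptime t ->
  ptime (fun x => (lft (t x), (cur (t x), rgt (t x)))).
Proof. by move=> ht; apply: ptime_same ht _. Qed.

Lemma ptime_lft {B} `{enc B} (t : B -> tape S) : ptime t -> ptime (fun x => lft (t x)).
Proof. by move=> /ptime_untape; apply: ptime_fst. Qed.
Lemma ptime_cur {B} `{enc B} (t : B -> tape S) : ptime t -> ptime (fun x => cur (t x)).
Proof. by move=> /ptime_untape /ptime_snd; apply: ptime_fst. Qed.
Lemma ptime_rgt {B} `{enc B} (t : B -> tape S) : ptime t -> ptime (fun x => rgt (t x)).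
Proof. by move=> /ptime_untape /ptime_snd; apply: ptime_snd. Qed.
End TapeEnc.


Section Simulation.
Variable M : turing_machine.

Local Instance enc_state : enc (state M) := enc_fin (state M).
Local Instance enc_sym : enc (sym M) := enc_fin (sym M).
Notation ix := 'I_(ntapes M).+1.

Let K : nat := (2 * #|sym M|).+1.
Let Q : nat := (2 * #|state M|).+1.
Let sz_sym (s : sym M) : sz s <= K. Proof. exact: sz_fin. Qed.
Let sz_state (q : state M) : sz q <= Q. Proof. exact: sz_fin. Qed.

Lemma ptime_write_move (a : sym M * move) : ptime (fun t : tape (sym M) => write_move t a).
Proof.
case: a => s [] /=; rewrite /write_move /=; apply: ptime_tape;
  repeat first [exact: ptime_const | exact: ptime_id | apply: ptime_lft | apply: ptime_rgt
    | apply: ptime_behead | apply: ptime_head | apply: ptime_cons].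
Qed.

(** The state and the symbols under the heads range over a finite type; once they are fixed, a step
    is a fixed local change of each tape. *)
Lemma ptime_step : ptime (@step M).
Proof.
pose g (v : state M * {ffun ix -> sym M}) (c : config M) : config M :=
  if halted v.1 then c else
  ((delta v.1 v.2).1, [ffun i => write_move (c.2 i) ((delta v.1 v.2).2 i)]).
apply: (ptime_ext (f := fun c : config M => g (c.1, [ffun i => cur (c.2 i)]) c)); last first.
  by move=> c; rewrite /g /step /=.
apply: (@ptime_finmatch _ _ (state M * {ffun ix -> sym M})%type _ (enc_prod (A := state M))).
  apply: ptime_pair; first exact: ptime_fst0.
  by apply: ptime_ffun => i; apply: ptime_cur; apply: ptime_ffun_app; apply: ptime_snd0.
move=> v; rewrite /g; case: (halted v.1); first exact: ptime_id.
apply: ptime_pair; first exact: ptime_const.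
apply: ptime_ffun => i; apply: (ptime_comp (ptime_write_move _)).
by apply: ptime_ffun_app; apply: ptime_snd0.
Qed.

Lemma ptime_init : ptime (init M).
Proof.
apply: ptime_pair; first exact: ptime_const.
apply: ptime_ffun => i; apply: ptime_tape; first exact: ptime_const.
- apply: ptime_head; first exact: ptime_const.
  case: (i == ord0); last exact: ptime_const.
  apply: (ptime_map (f := fun _ b => letter M (Some b))); last exact: ptime_id.
  apply: (@ptime_finmatch _ _ bool _ _ _ snd (fun b _ => letter M (Some b))) => [|b];
    [exact: ptime_snd0|exact: ptime_const].
- apply: ptime_behead.
  case: (i == ord0); last exact: ptime_const.
  apply: (ptime_map (f := fun _ b => letter M (Some b))); last exact: ptime_id.
  apply: (@ptime_finmatch _ _ bool _ _ _ snd (fun b _ => letter M (Some b))) => [|b];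
    [exact: ptime_snd0|exact: ptime_const].
Qed.

Definition read_sym (s : sym M) : seq bool :=
  if s == letter M (Some true) then [:: true]
  else if s == letter M (Some false) then [:: false] else [::].

Definition read_tape (t : tape (sym M)) : seq bool :=
  flatten [seq read_sym s | s <- cur t :: rgt t].

Lemma read_symE (o : option bool) : read_sym (letter M o) = seq_of_opt o.
Proof. by case: o => [[]|]; rewrite /read_sym !(inj_eq (@letter_inj M)). Qed.

(** Symbols that are not bits are skipped when reading. This is sound because [outputs] prescribes
    the whole tape from the head rightwards: the bits of [y], then blanks. *)
Lemma outputs_read (c : config M) y : outputs c y -> read_tape (c.2 ord_max) = y.
Proof.
rewrite /outputs /read_tape; elim: (cur _ :: _) y => [|s l IH] y h.
  by case: y h => // b y /(_ 0) /= /(@letter_inj M).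
have := h 0; rewrite /= => ->; rewrite read_symE.
case: y h => [|b y] h /=; last by congr (_ :: _); apply: IH => i; apply: (h i.+1).
by apply: IH => i; rewrite onth0n; apply: (h i.+1).
Qed.

Lemma ptime_read : ptime (fun c : config M => read_tape (c.2 ord_max)).
Proof.
apply: ptime_flatten; apply: (ptime_map (f := fun _ => read_sym)).
  by apply: (@ptime_finmatch _ _ (sym M) _ _ _ snd (fun s _ => read_sym s)) => [|s];
    [exact: ptime_snd0|exact: ptime_const].
by apply: ptime_cons; [apply: ptime_cur|apply: ptime_rgt];
  apply: ptime_ffun_app; apply: ptime_snd0.
Qed.

Definition tape_width (t : tape (sym M)) : nat := size (lft t) + size (rgt t).

Lemma sz_tape (t : tape (sym M)) :
  sz t <= (tape_width t).+1 * K.+1 + 5.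
Proof.
have hs (l : seq (sym M)) : sz l <= size l * K.+1 + 1.
  by elim: l => // s l IH; rewrite sz_cons /= mulSn; have := sz_sym s; lia.
case: t => l c r; have -> : sz (Tape l c r) = sz (l, (c, r)) by [].
rewrite !sz_pair /tape_width /=; have := hs l; have := hs r; have := sz_sym c.
by rewrite mulSn mulnDl; lia.
Qed.

(** A step lengthens each tape by at most one cell, so configurations stay of linear size, as
    iteration in polynomial time demands. *)
Lemma sz_iter_step x j :
  sz (iter j (@step M) (init M x)) <= Q.+2 +
    ((ntapes M).+1 * ((size x + j).+1 * K.+1 + 5).+1 + 1).
Proof.
have hw i : tape_width ((iter j (@step M) (init M x)).2 i) <= size x + j.
  elim: j => [|j IH] /=.
    rewrite ffunE /load /tape_width /=; case: ifP => _ //=.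
    by rewrite size_behead size_map; lia.
  move: IH; case: (iter _ _ _) => q v; rewrite /step /=; case: ifP => _ /=; first lia.
  rewrite ffunE /write_move /tape_width; case: (_ i) => l c r /=.
  by case: (_.2) => /=; rewrite ?size_behead; lia.
case: (iter _ _ _) hw => q v hw; rewrite sz_pair.
have : sz v <= (ntapes M).+1 * ((size x + j).+1 * K.+1 + 5).+1 + 1.
  apply: sz_ffun => i; apply: leq_trans (sz_tape _) _.
  by rewrite leq_add2r leq_mul2r ltnS hw orbT.
by have := sz_state q; lia.
Qed.

Lemma ptime_run k : ptime (fun x => read_tape
  ((iter ((size x + 2) ^ k) (@step M) (init M x)).2 ord_max)).
Proof.
apply: (ptime_comp ptime_read).
apply: (@ptime_iter _ _ _ _ (fun _ => @step M) (fun x => (size x + 2) ^ k) (init M)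
  (fun x => Q + 2 + ((ntapes M).+1 *
     ((sz x + (sz x + 2) ^ k + 1) * (K + 1) + 6) + 1))).
- exact: ptime_comp ptime_step ptime_snd0.
- have h : ptime (fun x : seq bool => size x) by apply/ptime_size/ptime_id.
  by pt.
- exact: ptime_init.
- by pb.
move=> x j lj; apply: leq_trans (sz_iter_step x j) _.
have h1 : size x + j <= sz x + (sz x + 2) ^ k.
  apply: leq_add; first exact/ltnW/size_sz.
  apply: (leq_trans lj); case: (k) => // k'; rewrite leq_exp2r // leq_add2r.
  exact/ltnW/size_sz.
have h2 : (size x + j).+1 * K.+1 <= (sz x + (sz x + 2) ^ k + 1) * (K + 1).
  by rewrite !addn1 leq_mul.
have h3 : ((size x + j).+1 * K.+1 + 5).+1 <= (sz x + (sz x + 2) ^ k + 1) * (K + 1) + 6.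
  by lia.
by have := leq_mul (leqnn (ntapes M).+1) h3; lia.
Qed.

End Simulation.

(** Makes a kernelization, known only as a machine, composable with other functions. [g] simulates
    for the full time bound, which does no harm as [step] fixes halted configurations; off the codes
    of [dom] its values are arbitrary. *)
Lemma polytime_on_ptime (A B : Type) (eA : A -> seq bool) (eB : B -> seq bool)
    (dom : A -> Prop) (f : A -> B) :
  polytime_on eA eB dom f ->
  exists2 g : seq bool -> seq bool, ptime g & forall a, dom a -> g (eA a) = eB (f a).
Proof.
move=> [M [p hM]]; have [k hk] := poly_below p.
exists (fun x => read_tape ((iter ((size x + 2) ^ k) (@step M) (init M x)).2 ord_max)).
  exact: ptime_run.
move=> a /hM /(computes_within_leq (hk _)) [_ h]; exact: outputs_read h.
Qed.


(** * Clique identification as a partition problem *)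

(** A pseudocomplete colouring: all colours occur and every two colours meet along an edge, but
    classes may contain edges and may be disconnected. *)
Definition pseudo_clique (G : graph) (C : finType) (f : G -> C) : Prop :=
  (forall c, exists u, f u = c) /\
  (forall c d, c != d -> exists u v, [/\ f u = c, f v = d & adj u v]).

Lemma card_identify (G : graph) (u v : G) : u != v -> #|identify u v|.+1 = #|G|.
Proof.
move=> uv; rewrite card_option card_sig.
rewrite [RHS](cardD1 u) [X in _ = _ + X](cardD1 v) !inE (eq_sym v u) uv /= !add1n.
by do 2!congr _.+1; apply: eq_card => x; rewrite !inE andbT andbC.
Qed.

(** [f] is the composite of the quotient maps. Edges lift along each of them because a neighbour of
    the new vertex is a neighbour of [u] or of [v]. *)
Lemma identifications_map n (G H : graph) : identifications n G H ->
  exists f : G -> H, [/\ forall c, exists u, f u = c, #|G| = #|H| + n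
    & forall c d, adj c d -> exists u v, [/\ f u = c, f v = d & adj u v]].
Proof.
elim=> {n G H} [G|n G H u v uv _ [f [fs fc fa]]].
  exists id; split=> [c||c d]; [by exists c|by rewrite addn0|by exists c, d].
pose g (x : G) : identify u v := insub x.
have gu : g u = None by rewrite /g insubF ?eqxx.
have gv : g v = None by rewrite /g insubF ?eqxx ?andbF.
have gS (x : {x | (x != u) && (x != v)}) : g (val x) = Some x by rewrite /g valK.
exists (f \o g); split.
- move=> c; have [[x|] <-] := fs c; first by exists (val x); rewrite /= gS.
  by exists u; rewrite /= gu.
- by rewrite -(card_identify uv) fc addnS.
move=> c d /fa [x [y [<- <-]]] /=.
case: x y => [x|] [y|] //=.
- by exists (val x), (val y); rewrite /= !gS.
- by case/orP=> h; [exists (val x), u|exists (val x), v]; rewrite /= gS ?gu ?gv adj_sym.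
- by case/orP=> h; [exists u, (val y)|exists v, (val y)]; rewrite /= gS ?gu ?gv.
Qed.

(** As long as two vertices share a class, identifying them keeps the colouring and lowers [n]. At
    [n = 0] the surjection [f] is a bijection, so classes are vertices and the graph is complete. *)
Lemma pseudo_clique_identifications n (G : graph) (C : finType) (f : G -> C) :
  pseudo_clique f -> #|G| = #|C| + n ->
  exists2 H, identifications n G H & complete H.
Proof.
elim: n G f => [|n IH] G f [fs fa] hc.
  exists G; first exact: Ident0.
  have fi : injective f.
    have : #|image f G| == #|G|.
      rewrite hc addn0; apply/eqP/eq_card => c; rewrite inE.
      by have [u <-] := fs c; apply: image_f.
    by move/image_injP => h x y; apply: h.
  move=> u v uv; have fuv : f u != f v by rewrite (inj_eq fi).
  by have [u' [v' [/fi <- /fi <-]]] := fa _ _ fuv.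
case: (boolP (injectiveb f)) => [/injectiveP fi|/injectivePn [u [v uv fuv]]].
  by have := leq_card f fi; lia.
pose g (x : identify u v) : C := if x is Some y then f (val y) else f u.
pose h (x : G) : identify u v := insub x.
have hu : h u = None by rewrite /h insubF ?eqxx.
have hv : h v = None by rewrite /h insubF ?eqxx ?andbF.
have hS (x : {x | (x != u) && (x != v)}) : h (val x) = Some x by rewrite /h valK.
have gh x : g (h x) = f x.
  rewrite /h; case: insubP => [y _ <- //|]; rewrite negb_and !negbK.
  by case/orP=> /eqP ->.
have hadj x y : adj x y -> h x != h y -> adj (h x) (h y).
  rewrite /h; case: insubP => [x' _ <-|hx]; case: insubP => [y' _ <-|hy] //= xy _.
    move: hy; rewrite negb_and !negbK => /orP[] /eqP e;
    by move: xy; rewrite e adj_sym => ->; rewrite ?orbT.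
  move: hx; rewrite negb_and !negbK => /orP[] /eqP e;
    by move: xy; rewrite e => ->; rewrite ?orbT.
have [||H H1 H2] := IH (identify u v) g.
- split=> [c|c d cd]; first by have [x <-] := fs c; exists (h x).
  have [x [y [ex ey xy]]] := fa _ _ cd; exists (h x), (h y); rewrite !gh; split=> //.
  by apply: hadj => //; apply: contraNneq cd => e; rewrite -ex -ey -!gh e.
- by have := card_identify uv; lia.
by exists H => //; apply: IdentS H1.
Qed.

Lemma clique_identifiableP (G : graph) k :
  clique_identifiable G k <->
  exists (C : finType) (f : G -> C), pseudo_clique f /\ #|G| <= #|C| + k.
Proof.
split=> [[j [H [jk hI hC]]]|[C [f [pf hc]]]].
  have [f [fs fc fa]] := identifications_map hI.
  exists H, f; split; last by lia.
  by split=> // c d cd; apply/fa/hC.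
have lC : #|C| <= #|G|.
  have [g gK] := fin_all_exists pf.1.
  exact: leq_card g (can_inj gK).
have [H h1 h2] := pseudo_clique_identifications pf (esym (subnKC lC)).
by exists (#|G| - #|C|), H; split=> //; lia.
Qed.

(** * Set splitting and satisfiability as clique identification *)

Lemma card_tnth n (T : Type) (P : pred T) (t : n.-tuple T) :
  #|[set i | P (tnth t i)]| = count P t.
Proof.
rewrite -[in RHS](map_tnth_enum t) count_map cardsE cardE size_filter enumT.
by apply: eq_count => i.
Qed.

Section ListGraph.
Variables (T : Type) (r : rel T) (r_sym : symmetric r) (vs : seq T).
Notation tn := (tnth (in_tuple vs)).

Definition list_adj : rel 'I_(size vs) := fun i j => (i != j) && r (tn i) (tn j).

Lemma list_adj_sym : symmetric list_adj.
Proof. by move=> i j; rewrite /list_adj eq_sym r_sym. Qed.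

Lemma list_adj_irr : irreflexive list_adj.
Proof. by move=> i; rewrite /list_adj eqxx. Qed.

(** Vertices are positions, so repeated entries of [vs] become distinct vertices; this is how copies
    arise. *)
Definition list_graph : graph := Graph list_adj_sym list_adj_irr.

Definition list_matrix : seq bool :=
  let l := zip (iota 0 (size vs)) vs in
  [seq (a.1 != b.1) && r a.2 b.2 | a <- l, b <- l].

Lemma enc_list_graph : enc_graph list_graph = list_matrix.
Proof.
have e : zip (iota 0 (size vs)) vs = [seq (val i, tn i) | i <- enum 'I_(size vs)].
  rewrite -val_enum_ord -[X in zip _ X](map_tnth_enum (in_tuple vs)) zip_map.
  by elim: (enum _) => //= i s ->.
rewrite /list_matrix /= e /enc_graph -map_comp; congr flatten; apply: eq_map => i.
by rewrite /= -map_comp; apply: eq_map => j.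
Qed.

End ListGraph.

Section SetSplitting.
Variables (U : eqType) (us : seq U) (cs : seq (seq U)).
Hypotheses (us_uniq : uniq us) (us_size : 1 < size us) (us_cs : us \in cs).

(** At most [size us - 2] vertices are not representatives of their class. A copy that shares its
    class is such a vertex or the representative of one, so fewer than [2 * size us] copies of a set
    can share. *)
Definition split_vertices : seq (option U * seq U) :=
  [seq (Some u, [::]) | u <- us] ++
  flatten (nseq (2 * size us) [seq (None, c) | c <- cs]).

(** Set vertices are also pairwise adjacent, so each can form a class of its own. *)
Definition split_rel (a b : option U * seq U) : bool :=
  match a.1, b.1 with
  | Some u, None => u \in b.2
  | None, Some u => u \in a.2
  | _, _ => true
  end.

Lemma split_rel_sym : symmetric split_rel.
Proof. by move=> [[u|] c] [[v|] d]. Qed.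

Definition split_graph : graph := list_graph split_rel_sym split_vertices.

Notation tn := (tnth (in_tuple split_vertices)).

Lemma tn_set i : (tn i).1 = None -> (tn i).2 \in cs.
Proof.
have := mem_tnth i (in_tuple split_vertices); rewrite mem_cat.
case/orP=> [/mapP [u _ -> //]|/flattenP [l]].
by rewrite mem_nseq => /andP[_ /eqP->] /mapP [c hc ->].
Qed.

Lemma tn_elt i w : (tn i).1 = Some w -> w \in us.
Proof.
have := mem_tnth i (in_tuple split_vertices); rewrite mem_cat.
case/orP=> [/mapP [u hu ->] [<-] //|/flattenP [l]].
by rewrite mem_nseq => /andP[_ /eqP->] /mapP [c hc ->].
Qed.

Lemma ex_elt u : u \in us -> exists i, tn i = (Some u, [::]).
Proof.
move=> hu; have /tnthP [i ->] : (Some u, [::]) \in in_tuple split_vertices.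
  by rewrite mem_cat (map_f (fun u => (Some u, _))).
by exists i.
Qed.

Lemma ex_set : exists i, tn i = (None, us).
Proof.
have /tnthP [i ->] : (None, us) \in in_tuple split_vertices; last by exists i.
rewrite mem_cat; apply/orP; right; apply/flattenP; exists [seq (None, c) | c <- cs].
  by rewrite mem_nseq eqxx andbT; lia.
exact: (map_f (fun c => (None, c))).
Qed.

Lemma tn_inj i j w : (tn i).1 = Some w -> (tn j).1 = Some w -> i = j.
Proof.
have h k : (tn k).1 = Some w -> k = index w us :> nat.
  rewrite (tnth_nth (None, [::])) /= nth_cat size_map; case: ltnP => lk.
    by rewrite (nth_map w) //= => -[<-]; rewrite index_uniq.
  have : forall l, all (fun a : option U * seq U => a.1 == None) l ->
    forall k, (nth (None, [::]) l k).1 = None.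
    by elim=> [|a l IH] /= => [_ []|/andP[/eqP ha /IH {}IH] []].
  move=> -> //; apply/allP => a /flattenP [l]; rewrite mem_nseq => /andP[_ /eqP->].
  by move=> /mapP [c _ ->].
by move=> /h hi /h hj; apply: val_inj; rewrite /= hi hj.
Qed.

Lemma card_sets : #|[set i | (tn i).1 == None]| + size us = size split_vertices.
Proof.
rewrite (card_tnth (fun a => a.1 == None)) /= count_cat size_cat size_map.
rewrite count_map (eq_count (a2 := pred0)) // count_pred0 add0n addnC; congr (_ + _).
apply/eqP; rewrite -all_count; apply/allP => a /flattenP [l].
by rewrite mem_nseq => /andP[_ /eqP->] /mapP [c _ ->].
Qed.

Lemma card_copies c : c \in cs -> 2 * size us <= #|[set i | tn i == (None, c)]|.
Proof.
move=> hc; rewrite (card_tnth (pred1 (None, c))) /= count_cat.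
apply: leq_trans (leq_addl _ _); rewrite count_flatten map_nseq sumn_nseq.
rewrite -[X in X <= _]mul1n leq_mul2r; apply/orP; right.
by rewrite -has_count has_pred1 (map_f (fun c => (None, c))).
Qed.

(** A copy of the full set [us] is adjacent to every other vertex. Having [us] among the sets also
    makes both sides of a splitting nonempty. *)
Lemma split_connected : connected split_graph.
Proof.
have [w hw] := ex_set; split; first by apply/card_gt0P; exists w.
have hc u : connect (@adj split_graph) u w.
  case: (eqVneq u w) => [-> //|uw]; apply: connect1.
  rewrite /= /list_adj uw hw /split_rel /=.
  by case e: (tn u).1 => [x|] //; apply: tn_elt e.
move=> u v; apply: connect_trans (hc u) _.
by rewrite (sym_connect_sym (@adj_sym split_graph)); apply: hc.
Qed.

Definition splits (S : pred U) : Prop := forall c b, c \in cs ->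
  exists u, [/\ u \in us, u \in c & S u = b].

(** The classes are the two sides of the splitting and every set vertex alone: [size us - 2] fewer
    classes than vertices. *)
Lemma split_identifiable S : splits S -> clique_identifiable split_graph (size us - 2).
Proof.
move=> hS; apply/clique_identifiableP.
pose CL := [set i | (tn i).1 == None].
pose C : finType := (bool + {i | i \in CL})%type.
pose f (i : split_graph) : C :=
  if (tn i).1 is Some w then inl (S w)
  else if insub i is Some s then inr s else inl true.
have fU i w : (tn i).1 = Some w -> f i = inl (S w) by rewrite /f => ->.
have fC (s : {i | i \in CL}) : f (val s) = inr s.
  rewrite /f valK; case: s => i hi /=.
  by have := hi; rewrite inE => /eqP ->.
exists C, f; split; last first.
  rewrite card_sum card_bool card_sig /= card_ord.
  have -> : #|[pred x in CL]| = #|CL| by apply: eq_card => i; rewrite !inE.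
  by have := card_sets; rewrite -/CL; lia.
have exb b : exists i w, [/\ tn i = (Some w, [::]), S w = b & w \in us].
  have [w [hw _ hb]] := hS us b us_cs; have [i hi] := ex_elt hw.
  by exists i, w.
have adjC b (s : {i | i \in CL}) : exists i, f i = inl b /\ @adj split_graph i (val s).
  have hs : (tn (val s)).1 = None by case: s => i /=; rewrite inE => /eqP.
  have [w [hw1 hw2 hb]] := hS _ b (tn_set hs); have [i hi] := ex_elt hw1.
  exists i; split; first by rewrite (fU i w) ?hb ?hi.
  rewrite /= /list_adj; apply/andP; split; last by rewrite /split_rel hi hs.
  by apply/eqP => /(congr1 (fun j => (tn j).1)); rewrite hi hs.
split=> [[b|s]|[b|s] [b'|s'] hcd].
- by have [i [w [hi hb _]]] := exb b; exists i; rewrite (fU i w) ?hb ?hi.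
- by exists (val s).
- have [i [w [hi hb _]]] := exb b; have [j [w' [hj hb' _]]] := exb b'.
  exists i, j; rewrite (fU i w) ?hi // (fU j w') ?hj // hb hb'; split=> //.
  rewrite /= /list_adj /split_rel hi hj andbT; apply: contraNneq hcd => e.
  by move: hi; rewrite e hj => -[ew]; rewrite -hb -hb' ew.
- by have [i [hi ha]] := adjC b s'; exists i, (val s').
- by have [i [hi ha]] := adjC b' s; exists (val s), i; rewrite fC hi adj_sym.
exists (val s), (val s'); rewrite !fC; split=> //.
have hs : (tn (val s)).1 = None by case: (s) => i /=; rewrite inE => /eqP.
have hs' : (tn (val s')).1 = None by case: (s') => i /=; rewrite inE => /eqP.
rewrite /= /list_adj /split_rel hs hs' andbT.
by apply: contraNneq hcd => /val_inj ->.
Qed.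

(* Fewer than [size us] vertices are not representatives of their class, so some
   copy of each set is alone in its class; a class without set vertices thus
   contains an element of every set, and by counting there are two such classes. *)
Lemma identifiable_split : clique_identifiable split_graph (size us - 2) ->
  exists S, splits S.
Proof.
move=> /clique_identifiableP [C [f [[fs fa] hc]]].
pose CL := [set i | (tn i).1 == None].
have [g gK] : exists g : C -> split_graph, forall c, f (g c) = c.
  exact: fin_all_exists fs.
pose W := ~: (g @: [set: C]).
have cW : #|W| <= size us - 2.
  have : #|g @: [set: C]| = #|C| by rewrite card_imset ?cardsT //; apply: can_inj gK.
  by have := cardsC (g @: [set: C]); rewrite -/W; lia.
have alone c : c \in cs -> exists2 j, tn j = (None, c) & forall i, f i = f j -> i = j.
  move=> hcs; case: (boolP [exists j, (tn j == (None, c)) && [forall i, (f i == f j) ==> (i == j)]]).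
    case/existsP=> j /andP[/eqP hj /forallP h]; exists j => // i /eqP e.
    by have := h i; rewrite e => /eqP.
  rewrite negb_exists => /forallP h.
  have : #|[set i | tn i == (None, c)]| <= #|W :|: [set g (f w) | w in W]|.
    apply/subset_leq_card/subsetP => j; rewrite inE => hj.
    have := h j; rewrite hj negb_forall => /existsP [i].
    rewrite negb_imply => /andP[/eqP fij nij]; rewrite inE.
    case: (boolP (j \in W)) => //=; rewrite inE negbK => /imsetP [c' _ ej].
    apply/imsetP; exists i; last by rewrite fij ej gK.
    rewrite inE; apply/imsetP => -[c'' _ ei]; case/negP: nij.
    by move: fij; rewrite ei ej !gK => ->.
  move=> hle; exfalso; move: hle.
  have := card_copies hcs; have := (leq_card_setU W [set g (f w) | w in W]).1.
  by have := leq_imset_card (fun w => g (f w)) W; lia.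
(* There are at least [#|G| - (size us - 2)] classes, for [G] the split graph, and exactly
   [#|G| - size us] set vertices, so two classes contain none. *)
have [x [y [hx hy xy]]] : exists x y, [/\ x \in ~: (f @: CL), y \in ~: (f @: CL) & x != y].
  apply/card_gt1P; have := cardsC (f @: CL); have := leq_imset_card f CL.
  by have := card_sets; move: hc; rewrite -/CL /= card_ord; lia.
have hit z c : z \in ~: (f @: CL) -> c \in cs ->
    exists i w, [/\ (tn i).1 = Some w, f i = z & w \in c].
  move=> hz hcs; have [j hj j1] := alone c hcs.
  have zj : z != f j.
    apply: contraTneq hz => ->; rewrite inE negbK; apply: imset_f.
    by rewrite inE hj.
  have [u [v [fu fv uv]]] := fa _ _ zj.
  move: uv; rewrite (j1 v fv) /= /list_adj /split_rel hj /= => /andP[_].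
  case e: (tn u).1 => [w|] h; first by exists u, w.
  by move: hz; rewrite inE -fu => /negP[]; apply: imset_f; rewrite inE e.
exists (fun w => [exists i, ((tn i).1 == Some w) && (f i == x)]) => c [] hcs.
  have [i [w [hi fi hw]]] := hit x c hx hcs; exists w; split=> //; first exact: tn_elt hi.
  by apply/existsP; exists i; rewrite hi fi !eqxx.
have [i [w [hi fi hw]]] := hit y c hy hcs; exists w; split=> //; first exact: tn_elt hi.
apply/existsP => -[j /andP[/eqP hj /eqP fj]]; case/negP: xy.
by rewrite -fj -fi (tn_inj hi hj).
Qed.

End SetSplitting.

Section Satisfiability.
Variables (V : eqType) (vars : seq V) (clauses : seq (seq (bool * V))).
Hypotheses (vars_uniq : uniq vars) (vars_size : 0 < size vars)
  (vars_in : forall c l, c \in clauses -> l \in c -> l.2 \in vars).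

Definition satisfiable : Prop :=
  exists a : V -> bool, forall c, c \in clauses -> exists2 l, l \in c & a l.2 = l.1.

(* [None] is a literal that may be taken to be false, by symmetry of the two
   sides of a splitting. *)
Definition sat_elts : seq (option (bool * V)) :=
  None :: [seq Some (b, v) | b <- [:: true; false], v <- vars].

(** The pairs put the two literals of a variable on opposite sides. A clause together with [None]
    must have a literal on the side opposite to [None], that is, a true one. *)
Definition sat_sets : seq (seq (option (bool * V))) :=
  sat_elts :: [seq [:: Some (true, v); Some (false, v)] | v <- vars] ++
  [seq None :: [seq Some l | l <- c] | c <- clauses].

Definition sat_graph : graph := split_graph sat_elts sat_sets.

Lemma size_sat_elts : size sat_elts = (2 * size vars).+1.
Proof. by rewrite /= !size_cat !size_map /=; lia. Qed.

Lemma mem_sat_elts b v : (Some (b, v) \in sat_elts) = (v \in vars).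
Proof.
rewrite in_cons (_ : (_ == None) = false) // orFb; apply/allpairsP/idP => [[[b' v'] [_ /= hv [_ ->]]] //|hv].
by exists (b, v); split=> //; case: b.
Qed.

Lemma sat_elts_uniq : uniq sat_elts.
Proof.
rewrite cons_uniq; apply/andP; split; first by apply/allpairsP => -[p [_ _]].
by apply: allpairs_uniq => // -[b v] [b' v'] _ _ [-> ->].
Qed.

Lemma sat_connected : connected sat_graph.
Proof.
have sz : 1 < size sat_elts by rewrite size_sat_elts; lia.
exact: split_connected sat_elts_uniq sz (mem_head _ _).
Qed.

Lemma sat_identifiable :
  clique_identifiable sat_graph (2 * size vars - 1) <-> satisfiable.
Proof.
have -> : 2 * size vars - 1 = size sat_elts - 2 by rewrite size_sat_elts; lia.
have sz : 1 < size sat_elts by rewrite size_sat_elts; lia.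
split=> [/(identifiable_split sat_elts_uniq sz (mem_head _ _)) [S hS]|[a ha]].
  (* A literal counts as true if it lies opposite to [None]. *)
  exists (fun v => S (Some (true, v)) != S None) => c hc.
  have [u [hu huc hSu]] := hS (None :: [seq Some l | l <- c]) (~~ S None)
    ltac:(by rewrite in_cons mem_cat (map_f (fun c => None :: map Some c)) ?orbT).
  move: huc; rewrite in_cons => /orP[/eqP eu|/mapP [[b v] hl eu]].
    by move: hSu; rewrite eu; case: (S None).
  exists (b, v) => //=; have hv : v \in vars by have := vars_in hc hl.
  case: b hl eu => hl eu; first by rewrite -eu hSu; case: (S None).
  have hb b' := hS [:: Some (true, v); Some (false, v)] b'
    ltac:(by rewrite in_cons mem_cat (map_f (fun v => [:: Some (true, v); Some (false, v)])) ?orbT).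
  have [u1 [_ h1 s1]] := hb (~~ S None); have [u2 [_ h2 s2]] := hb (S None).
  move: hSu; rewrite eu => hF; apply/eqP.
  move: h2; rewrite !inE => /orP[] /eqP e2; first by rewrite -e2 s2.
  by move: hF; rewrite -e2 s2; case: (S None).
apply: (split_identifiable sat_elts_uniq sz (mem_head _ _)
  (S :=
  fun o => if o is Some l then a l.2 == l.1 else false)) => c b.
(* The full set meets both sides through the two literals of any one variable. *)
have [v0 hv0] : exists v, v \in vars by case: vars vars_size => // v *; exists v; rewrite mem_head.
rewrite in_cons mem_cat => /or3P [/eqP->|/mapP [v hv ->]|/mapP [d hd ->]].
- exists (Some (a v0 == b, v0)); rewrite mem_sat_elts; split=> //.
  by rewrite /=; case: (a v0) b => -[].
- exists (Some (a v == b, v)); rewrite mem_sat_elts; split=> //.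
    by case: (_ == b); rewrite !inE eqxx ?orbT.
  by rewrite /=; case: (a v) b => -[].
case: b; last by exists None; split.
have [l hl al] := ha _ hd; exists (Some l); split; last by rewrite /= al eqxx.
- by case: l hl {al} => b v hl; rewrite mem_sat_elts; apply: vars_in hd hl.
- by rewrite in_cons map_f.
Qed.

End Satisfiability.


(** * Runs of a Turing machine as satisfying assignments *)

Lemma onth_double (x s : seq bool) k :
  onth (flatten [seq [:: b; b] | b <- x] ++ s) k =
  if k < 2 * size x then onth x k./2 else onth s (k - 2 * size x).
Proof.
elim: x k => [|b x IH] k /=; first by rewrite subn0.
rewrite mulnS; case: k => [|[|k]] //=.
Qed.

Section Tableau.
Variables (M : turing_machine) (T n P : nat) (X : seq (seq bool)).
Notation ix := 'I_(ntapes M).+1.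

Definition letters : finType := (state M * {ffun ix -> sym M})%type.

(* Cell contents relative to the head, which is kept at position [T]. *)
Definition look (t : tape (sym M)) (p : nat) : sym M :=
  if p < T then nth (blank M) (lft t) (T - p.+1)
  else nth (blank M) (cur t :: rgt t) (p - T).

(** All tapes are bundled into one letter, and every cell repeats the state, so the letter at
    position [T] alone determines the transition. *)
Definition cell (c : config M) (p : nat) : letters := (c.1, [ffun i => look (c.2 i) p]).

(** [a0] is the letter under the head; [a1], [a2], [a3] are those at positions p - 1, p, p + 1. As
    positions are relative to the head, a move shifts the tape the other way, and the flags say
    which of the three positions is the head's, where the newly written symbol stands. *)
Definition next (b1 b2 b3 : bool) (a : letters * (letters * (letters * letters))) :
    letters :=
  let: (a0, (a1, (a2, a3))) := a in
  if halted a0.1 then a2 else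
  let d := delta a0.1 a0.2 in
  (d.1, [ffun i => match (d.2 i).2 with
                   | MoveL => if b1 then (d.2 i).1 else a1.2 i
                   | Stay => if b2 then (d.2 i).1 else a2.2 i
                   | MoveR => if b3 then (d.2 i).1 else a3.2 i
                   end]).

Lemma look_write t a p : 0 < p -> look (write_move t a) p =
  match a.2 with
  | MoveL => if p.-1 == T then a.1 else look t p.-1
  | Stay => if p == T then a.1 else look t p
  | MoveR => if p.+1 == T then a.1 else look t p.+1
  end.
Proof.
case: a t => s mv [l c r] p0; rewrite /look /write_move /=; case: mv => /=.
- case: (ltngtP p T) => hp.
  + rewrite ifF ?ifT; try lia.
    rewrite -[behead l]drop1 nth_drop; congr nth; lia.
  + case: (eqVneq p.-1 T) => e; first by have -> : p - T = 1 by lia.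
    rewrite ifF; try lia.
    have -> : p - T = (p - T - 2).+2 by lia.
    by have -> : p.-1 - T = (p - T - 2).+1 by lia.
  + rewrite ifF ?ifT; try lia.
    have -> : p - T = 0 by lia.
    have -> : T - p.-1.+1 = 0 by lia.
    by rewrite nth0.
- case: (ltngtP p T) => hp //; last by rewrite hp subnn.
  by have -> : p - T = (p - T - 1).+1 by lia.
- case: (ltngtP p T) => hp.
  + case: (eqVneq p.+1 T) => e; first by have -> : T - p.+1 = 0 by lia.
    rewrite ifT; try lia.
    have -> : T - p.+1 = (T - p.+2).+1 by lia.
    by [].
  + rewrite !ifF; try lia.
    have -> : p - T = (p - T - 1).+1 by lia.
    have -> : p.+1 - T = (p - T - 1).+2 by lia.
    by rewrite /= nth_behead.
  + rewrite !ifF; try lia.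
    have -> : p.+1 - T = 1 by lia.
    by rewrite hp subnn /= nth0.
Qed.

Lemma cell_step (c : config M) p : 0 < p ->
  cell (step c) p = next (p.-1 == T) (p == T) (p.+1 == T)
    (cell c T, (cell c p.-1, (cell c p, cell c p.+1))).
Proof.
move=> p0; rewrite /step /next /=; case: ifP => // _.
have -> : [ffun i => look (c.2 i) T] = [ffun i => cur (c.2 i)].
  by apply/ffunP => i; rewrite !ffunE /look ltnn subnn.
congr (_, _); apply/ffunP => i; rewrite !ffunE look_write //.
Qed.

Definition fact : eqType := (nat * (nat * letters))%type.
Definition pos (v : fact) : bool * fact := (true, v).
Definition neg (v : fact) : bool * fact := (false, v).

Definition input (o : option bool) : letters :=
  (start M, [ffun i : ix => if i == ord0 then letter M o else blank M]).

Lemma input_inj : injective input.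
Proof.
move=> o o' [] /ffunP /(_ ord0); rewrite !ffunE eqxx.
exact: letter_inj.
Qed.

Lemma cell_init w p : cell (init M w) p = input (if p < T then None else onth w (p - T)).
Proof.
congr (_, _); apply/ffunP => i; rewrite !ffunE /look /load /=.
case: (ltnP p T) => hp; first by rewrite nth_nil; case: ifP.
rewrite -[_ :: _]/(head _ _ :: behead _).
have nhb (s : seq (sym M)) k : nth (blank M) (head (blank M) s :: behead s) k = nth (blank M) s k.
  by case: s => //; case: k => [|[|k]].
rewrite nhb; case: ifP => _; last by rewrite nth_nil.
rewrite onthE; move: (p - T) => k.
by elim: w k => [|b w IH] [|k] //=.
Qed.

Definition tab_vars : seq fact :=
  [seq (t, v) | t <- iota 0 T.+1, v <- [seq (p, a) | p <- iota 0 (2 * T).+1, a <- enum letters]].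

Definition quads : seq (letters * (letters * (letters * letters))) :=
  enum {: letters * (letters * (letters * letters))}.

(** Clauses only propagate facts; nothing forces a cell to carry a single letter. A satisfying
    assignment may contain spurious facts, but it contains those of a genuine run that decide its
    outcome. *)
Definition step_clause (tp : nat * nat) (a : letters * (letters * (letters * letters))) :
    seq (bool * fact) :=
  [:: neg (tp.1, (T, a.1)); neg (tp.1, (tp.2.-1, a.2.1)); neg (tp.1, (tp.2, a.2.2.1));
      neg (tp.1, (tp.2.+1, a.2.2.2));
      pos (tp.1.+1, (tp.2, next (tp.2.-1 == T) (tp.2 == T) (tp.2.+1 == T) a))].

Definition step_clauses : seq (seq (bool * fact)) :=
  [seq step_clause tp a |
    tp <- [seq (t, p) | t <- iota 0 T, p <- iota 1 (2 * T - 1)], a <- quads].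

Definition left_clauses : seq (seq (bool * fact)) :=
  [seq [:: pos (0, (p, input None))] | p <- iota 0 T].

(** The input starts under the head, at position [T], and [pairs] doubles the bits of the word: bit
    [l] stands at [T + 2 * l] and again one cell further, where [copy_clauses] repeats it. *)
Definition word_clauses : seq (seq (bool * fact)) :=
  [seq [:: pos (0, (T + 2 * l, input (Some true))); pos (0, (T + 2 * l, input (Some false)))]
    | l <- iota 0 n].

Definition copy_clauses : seq (seq (bool * fact)) :=
  [seq [:: neg (0, (T + 2 * l, input (Some b))); pos (0, ((T + 2 * l).+1, input (Some b)))]
    | l <- iota 0 n, b <- [:: true; false]].

(* The word obtained from the prefix of length [l.+1] of [x] by flipping its
   last letter; if no word of [X] starts with it, it is forbidden.  These
   constraints say that the input word belongs to [X]. *)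
Definition flip (x : seq bool) (l i : nat) : bool :=
  if i == l then ~~ nth false x i else nth false x i.

Definition flip_out (xl : seq bool * nat) : bool :=
  ~~ has (fun x => all (fun i => nth false x i == flip xl.1 xl.2 i) (iota 0 xl.2.+1)) X.

Definition member_clauses : seq (seq (bool * fact)) :=
  [seq [seq neg (0, (T + 2 * i, input (Some (flip xl.1 xl.2 i)))) | i <- iota 0 xl.2.+1]
    | xl <- [seq xl <- [seq (x, l) | x <- X, l <- iota 0 n] | flip_out xl]].

(** The last clause puts a blank after the [P] cells reserved for the certificate. Thus a first
    blank exists, and it determines the length of the certificate. *)
Definition sep_clauses : seq (seq (bool * fact)) :=
  [:: [:: pos (0, (T + 2 * n, input (Some false)))];
      [:: pos (0, (T + 2 * n + 1, input (Some true)))];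
      [:: pos (0, (T + 2 * n + 2 + P, input None))] ].

Definition cert_clauses : seq (seq (bool * fact)) :=
  [seq [:: pos (0, (T + 2 * n + 2 + j, input (Some true)));
           pos (0, (T + 2 * n + 2 + j, input (Some false)));
           pos (0, (T + 2 * n + 2 + j, input None))] | j <- iota 0 P].

Definition blank_clauses : seq (seq (bool * fact)) :=
  [seq [:: neg (0, (T + 2 * n + 2 + j, input None));
           pos (0, ((T + 2 * n + 2 + j).+1, input None))] | j <- iota 0 (T - 2 * n - 2)].

Definition rejecting : seq letters :=
  [seq a : letters <- enum letters | a.2 (ord_max : ix) == letter M (Some false)].

Definition final_clauses : seq (seq (bool * fact)) :=
  [seq [:: neg (T, (T, a))] | a <- rejecting].

Definition tab_clauses : seq (seq (bool * fact)) :=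
  step_clauses ++ left_clauses ++ word_clauses ++ copy_clauses ++ member_clauses ++
  sep_clauses ++ cert_clauses ++ blank_clauses ++ final_clauses.

Lemma mem_tab_vars t p a : ((t, (p, a)) \in tab_vars) = (t <= T) && (p <= 2 * T).
Proof.
apply/allpairsP/andP => [[[t' [p' a']] [ht hv [-> -> _]]]|[ht hp]].
  case/allpairsP: hv => [[p'' a''] [hp _ [-> _]]].
  by move: ht hp; rewrite !mem_iota /=; lia.
exists (t, (p, a)); split=> //; first by rewrite mem_iota /=; lia.
apply/allpairsP; exists (p, a); split=> //; first by rewrite mem_iota /=; lia.
by rewrite mem_enum.
Qed.

Lemma tab_vars_uniq : uniq tab_vars.
Proof.
apply: allpairs_uniq; [exact: iota_uniq| |by move=> [? ?] [? ?] _ _ [-> ->]].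
apply: allpairs_uniq; [exact: iota_uniq|exact: enum_uniq|].
by move=> [? ?] [? ?] _ _ [-> ->].
Qed.

Lemma tab_vars_gt0 : 0 < size tab_vars.
Proof.
by have := mem_tab_vars 0 0 (input None); case: tab_vars.
Qed.

Hypothesis T_large : 2 * n + 3 + P <= T.

Lemma tab_vars_in c l : c \in tab_clauses -> l \in c -> l.2 \in tab_vars.
Proof.
have inl : forall l' s, (l : bool * fact) \in l' :: s -> l = l' \/ l \in s.
  by move=> l' s; rewrite in_cons => /orP[/eqP|]; [left|right].
have hv (k : bool * fact) : k.2.1 <= T -> k.2.2.1 <= 2 * T -> k.2 \in tab_vars.
  by case: k => b [t [p a]] /= ht hp; rewrite mem_tab_vars ht.
move: tab_vars hv => tv hv; rewrite !mem_cat; case/orP.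
  case/allpairsP=> -[[t p] a] [/= /allpairsP [[t' p'] [/= ht hp [-> ->]]] _ ->].
  move: ht hp; rewrite !mem_iota => ht hp.
  do 5!(case/inl=> [->|]; first by apply: hv => /=; lia).
  by rewrite in_nil.
case/orP; first (case/mapP=> p; rewrite mem_iota => hp ->;
  by do 1!(case/inl=> [->|]; first by apply: hv => /=; lia); rewrite in_nil).
case/orP; first (case/mapP=> p; rewrite mem_iota => hp ->;
  by do 2!(case/inl=> [->|]; first by apply: hv => /=; lia); rewrite in_nil).
case/orP; first (case/allpairsP=> -[p b] [/= + _ ->]; rewrite mem_iota => hp;
  by do 2!(case/inl=> [->|]; first by apply: hv => /=; lia); rewrite in_nil).
case/orP.
  case/mapP=> -[x p]; rewrite mem_filter => /andP[_ /allpairsP [[x' p'] [_ hp [-> ->]]]] -> /mapP [i].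
  by move: hp; rewrite !mem_iota /= => hp hi ->; apply: hv => /=; lia.
case/orP; first (by rewrite /sep_clauses !inE => /or3P[] /eqP -> /inl [->|]; rewrite ?in_nil //;
  apply: hv => /=; lia).
case/orP; first (case/mapP=> p; rewrite mem_iota => hp ->;
  by do 3!(case/inl=> [->|]; first by apply: hv => /=; lia); rewrite in_nil).
case/orP; first (case/mapP=> p; rewrite mem_iota => hp ->;
  by do 2!(case/inl=> [->|]; first by apply: hv => /=; lia); rewrite in_nil).
case/mapP=> a _ ->.
by case/inl=> [->|]; [apply: hv => /=; lia|rewrite in_nil].
Qed.

Hypotheses (X_nonempty : 0 < size X) (X_size : forall x, x \in X -> size x = n).

(** For a verifier with one output bit and [T] at least its running time, not reading [false] means
    reading [true]; halting needs no clause. *)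
Definition accepting (x y : seq bool) : Prop :=
  cur ((iter T (@step M) (init M (pairs x y))).2 ord_max) != letter M (Some false).

Section Complete.
Variables (x y : seq bool).
Hypotheses (xX : x \in X) (yP : size y <= P) (acc : accepting x y).

Let c0 := init M (pairs x y).
Let asg (v : fact) : bool := v.2.2 == cell (iter v.1 (@step M) c0) v.2.1.

Lemma asg0 p o : asg (0, (p, input o)) = (o == (if p < T then None else onth (pairs x y) (p - T))).
Proof. by rewrite /asg /= cell_init (inj_eq input_inj). Qed.

Let onth_pairs k : onth (pairs x y) k =
  if k < 2 * n then onth x k./2 else onth (false :: true :: y) (k - 2 * n).
Proof. by rewrite onth_double (X_size xX). Qed.

Let onth_x l : l < n -> onth x l = Some (nth false x l).
Proof. by move=> h; rewrite onthE (nth_map false) // (X_size xX). Qed.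

Let onth_even l : l < n -> onth (pairs x y) (T + 2 * l - T) = Some (nth false x l).
Proof.
move=> hl; rewrite addKn onth_pairs ltn_mul2l hl mul2n doubleK; exact: onth_x.
Qed.

Let onth_odd l : l < n -> onth (pairs x y) ((T + 2 * l).+1 - T) = Some (nth false x l).
Proof.
move=> hl; rewrite -addnS addKn onth_pairs ifT; last by lia.
by rewrite mul2n -[_.+1./2]/(uphalf l.*2) uphalf_double; apply: onth_x.
Qed.

Let onth_tail j : onth (pairs x y) (T + 2 * n + j - T) = onth (false :: true :: y) j.
Proof. by rewrite -addnA addKn onth_pairs ltnNge leq_addr addKn. Qed.

Lemma tab_complete : satisfiable tab_clauses.
Proof.
exists asg => c; rewrite !mem_cat; case/orP.
  case/allpairsP=> -[[t p] [a0 [a1 [a2 a3]]]] [/= /allpairsP [[t' p'] [/= _ + [-> ->]]] _ ->].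
  rewrite mem_iota => hp; have p0 : 0 < p' by lia.
  rewrite /step_clause /=.
  case e0: (asg (t', (T, a0))); last by exists (neg (t', (T, a0))); rewrite ?inE ?eqxx.
  case e1: (asg (t', (p'.-1, a1))); last first.
    by exists (neg (t', (p'.-1, a1))); rewrite ?inE ?eqxx ?orbT.
  case e2: (asg (t', (p', a2))); last first.
    by exists (neg (t', (p', a2))); rewrite ?inE ?eqxx ?orbT.
  case e3: (asg (t', (p'.+1, a3))); last first.
    by exists (neg (t', (p'.+1, a3))); rewrite ?inE ?eqxx ?orbT.
  exists (pos (t'.+1, (p', next (p'.-1 == T) (p' == T) (p'.+1 == T) (a0, (a1, (a2, a3)))))).
    by rewrite !inE eqxx !orbT.
  apply/eqP; rewrite [RHS](cell_step _ p0).
  by move/eqP: e0 => <-; move/eqP: e1 => <-; move/eqP: e2 => <-; move/eqP: e3 => <-.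
case/orP.
  case/mapP=> p; rewrite mem_iota => hp ->; eexists; first exact: mem_head.
  by rewrite asg0 ifT //; lia.
case/orP.
  case/mapP=> l; rewrite mem_iota => hl ->.
  exists (pos (0, (T + 2 * l, input (Some (nth false x l))))).
    by case: (nth _ _ _); rewrite !inE eqxx ?orbT.
  rewrite /= asg0 ifF; last by lia.
  by rewrite onth_even ?eqxx //; lia.
case/orP.
  case/allpairsP=> -[l b] [/= + _ ->]; rewrite mem_iota => hl.
  have hl' : l < n by lia.
  have e1 := onth_even hl'; have e2 := onth_odd hl'.
  case eb: (Some b == Some (nth false x l)).
    exists (pos (0, ((T + 2 * l).+1, input (Some b)))); first by rewrite !inE eqxx orbT.
    by rewrite /= asg0 ifF ?e2 //; lia.
  exists (neg (0, (T + 2 * l, input (Some b)))); first by rewrite mem_head.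
  by rewrite /= asg0 ifF ?e1 //; lia.
case/orP.
  case/mapP=> -[x' l]; rewrite mem_filter => /andP[ho hxl] ->.
  have hl : l < n.
    by case/allpairsP: hxl => -[x'' l'] [_ hl [_ ->]]; move: hl; rewrite mem_iota.
  (* No member of [X] starts with the forbidden word, so [x] differs from it at some [i], which
     makes the [i]-th literal true. *)
  move/hasPn: ho => /(_ x xX); cbv beta.
  rewrite -has_predC => /hasP [i]; rewrite mem_iota => hi hne.
  have ne : (nth false x i == flip x' l i) = false by apply/negbTE.
  have hi' : i < n by move: hi => /=; lia.
  exists (neg (0, (T + 2 * i, input (Some (flip x' l i))))); first by apply/mapP; exists i; rewrite ?mem_iota.
  rewrite /= asg0 ifF; last by lia.
  rewrite onth_even //.
  by apply/eqP => -[e]; rewrite e eqxx in ne.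
case/orP.
  rewrite !inE => /or3P[] /eqP ->; (eexists; first exact: mem_head); rewrite /= asg0 ifF; try lia.
  - by have := onth_tail 0; rewrite addn0 => ->.
  - by rewrite onth_tail.
  - by rewrite -[_ + 2 + P]addnA onth_tail add2n /= onth_default.
case/orP.
  case/mapP=> j; rewrite mem_iota => hj ->.
  exists (pos (0, (T + 2 * n + 2 + j, input (onth y j)))).
    by case: (onth y j) => [[]|]; rewrite !inE eqxx ?orbT.
  rewrite /= asg0 ifF; last by lia.
  by rewrite -[_ + 2 + j]addnA onth_tail add2n eqxx.
case/orP.
  case/mapP=> j; rewrite mem_iota => hj ->.
  have e1 : onth (pairs x y) (T + 2 * n + 2 + j - T) = onth y j.
    by rewrite -[_ + 2 + j]addnA onth_tail add2n.
  have e2 : onth (pairs x y) ((T + 2 * n + 2 + j).+1 - T) = onth y j.+1.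
    by rewrite -[_ + 2 + j]addnA -addnS onth_tail add2n.
  case ej: (None == onth y j).
    exists (pos (0, ((T + 2 * n + 2 + j).+1, input None))); first by rewrite !inE eqxx orbT.
    rewrite /= asg0 ifF ?e2; last by lia.
    rewrite onth_default // leqW // -onthNE.
    by move: ej; case: (onth y j).
  exists (neg (0, (T + 2 * n + 2 + j, input None))); first by rewrite mem_head.
  by rewrite /= asg0 ifF ?e1 //; lia.
case/mapP=> a; rewrite mem_filter => /andP[ha _] ->; eexists; first exact: mem_head.
rewrite /= /asg /=; apply/eqP => ea; move: ha; rewrite ea /= ffunE /look ltnn subnn /=.
by apply/negP.
Qed.

End Complete.

(** A word and a certificate are read off the facts at time 0, choosing [true] where a cell offers
    both bits. All letters of the resulting initial configuration are then facts, and the step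
    clauses carry this along the run. *)
Lemma tab_sound : satisfiable tab_clauses ->
  exists x y, [/\ x \in X, size y <= P & accepting x y].
Proof.
case=> a hA.
have hleft p : p < T -> a (0, (p, input None)).
  move=> hp; have [|l] := hA [:: pos (0, (p, input None))].
    rewrite !mem_cat; apply/orP; right; apply/orP; left.
    by apply/mapP; exists p; rewrite ?mem_iota.
  by rewrite inE => /eqP ->.
pose w l := a (0, (T + 2 * l, input (Some true))).
have hw l : l < n -> a (0, (T + 2 * l, input (Some (w l)))).
  move=> hl; have [|k] := hA [:: pos (0, (T + 2 * l, input (Some true)));
      pos (0, (T + 2 * l, input (Some false)))].
    rewrite !mem_cat; do 2!(apply/orP; right); apply/orP; left.
    by apply/mapP; exists l; rewrite ?mem_iota.
  rewrite !inE /w => /orP[] /eqP -> /= e; first by rewrite e.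
  by case e': (a (0, (T + 2 * l, input (Some true)))).
have hw1 l : l < n -> a (0, ((T + 2 * l).+1, input (Some (w l)))).
  move=> hl; have [|k] := hA [:: neg (0, (T + 2 * l, input (Some (w l))));
      pos (0, ((T + 2 * l).+1, input (Some (w l))))].
    rewrite !mem_cat; do 3!(apply/orP; right); apply/orP; left.
    by apply/allpairsP; exists (l, w l); split; rewrite ?mem_iota //=; case: (w l).
  by rewrite !inE => /orP[] /eqP -> //=; rewrite hw.
(* If a member agrees with [w] on [m] letters but not on the next, flipping that letter gives the
   prefix of [w] of length [m.+1]. Its clause would be violated, so it is not forbidden and another
   member starts with it. *)
have hmem m : m <= n -> exists2 x, x \in X & forall i, i < m -> nth false x i = w i.
  elim: m => [_|m IH hm].
    by case: X X_nonempty => // x s _; exists x; rewrite ?mem_head.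
  have [x xX hx] := IH (ltnW hm).
  case: (eqVneq (nth false x m) (w m)) => [e|ne].
    by exists x => // i; rewrite ltnS leq_eqVlt => /orP[/eqP->|/hx].
  have hf i : i <= m -> flip x m i = w i.
    rewrite leq_eqVlt /flip => /orP[/eqP->|hi]; last by rewrite ifF ?hx //; lia.
    by rewrite eqxx; case: (nth _ _ _) (w m) ne => -[].
  case: (boolP (flip_out (x, m))) => [ho|].
    have [|k] := hA [seq neg (0, (T + 2 * i, input (Some (flip x m i)))) | i <- iota 0 m.+1].
      rewrite !mem_cat; do 4!(apply/orP; right); apply/orP; left.
      apply/mapP; exists (x, m) => //; rewrite mem_filter ho /=.
      by apply/allpairsP; exists (x, m); split; rewrite ?mem_iota.
    case/mapP=> i; rewrite mem_iota ltnS => hi -> /=; rewrite hf //.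
    by rewrite hw //; lia.
  rewrite negbK => /hasP [x' hx' /allP h]; exists x' => // i hi.
  by have := h i; rewrite mem_iota /= hi => /(_ isT) /eqP ->; rewrite hf.
have [x xX hx] := hmem n (leqnn n).
have hsep0 : a (0, (T + 2 * n, input (Some false))).
  have [|k] := hA [:: pos (0, (T + 2 * n, input (Some false)))].
    rewrite !mem_cat; do 5!(apply/orP; right); apply/orP; left.
    by rewrite !inE eqxx.
  by rewrite inE => /eqP ->.
have hsep1 : a (0, (T + 2 * n + 1, input (Some true))).
  have [|k] := hA [:: pos (0, (T + 2 * n + 1, input (Some true)))].
    rewrite !mem_cat; do 5!(apply/orP; right); apply/orP; left.
    by rewrite !inE eqxx orbT.
  by rewrite inE => /eqP ->.
have hsep2 : a (0, (T + 2 * n + 2 + P, input None)).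
  have [|k] := hA [:: pos (0, (T + 2 * n + 2 + P, input None))].
    rewrite !mem_cat; do 5!(apply/orP; right); apply/orP; left.
    by rewrite !inE eqxx !orbT.
  by rewrite inE => /eqP ->.
(* The certificate ends at the first cell with a blank fact; the blank clauses spread blanks to the
   right up to position [2 * T]. *)
have exl : exists j, a (0, (T + 2 * n + 2 + j, input None)) by exists P.
case: (ex_minnP exl) => m hm minm.
have mP : m <= P by apply: minm.
have hblank j : m <= j -> T + 2 * n + 2 + j <= 2 * T -> a (0, (T + 2 * n + 2 + j, input None)).
  elim: j => [|j IH]; first by rewrite leqn0 => /eqP em _; move: hm; rewrite em.
  rewrite leq_eqVlt => /orP[/eqP <- //|hj] hT.
  have [|k] := hA [:: neg (0, (T + 2 * n + 2 + j, input None));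
           pos (0, ((T + 2 * n + 2 + j).+1, input None))].
    rewrite !mem_cat; do 7!(apply/orP; right); apply/orP; left.
    by apply/mapP; exists j; rewrite // mem_iota; lia.
  rewrite !inE => /orP[] /eqP -> /=; last by rewrite (addnS _ j).
  by rewrite IH //; lia.
pose v j := a (0, (T + 2 * n + 2 + j, input (Some true))).
have hv j : j < m -> a (0, (T + 2 * n + 2 + j, input (Some (v j)))).
  move=> hj; have [|k] := hA [:: pos (0, (T + 2 * n + 2 + j, input (Some true)));
           pos (0, (T + 2 * n + 2 + j, input (Some false)));
           pos (0, (T + 2 * n + 2 + j, input None))].
    rewrite !mem_cat; do 6!(apply/orP; right); apply/orP; left.
    by apply/mapP; exists j; rewrite // mem_iota; lia.
  rewrite !inE /v => /or3P[] /eqP -> /= e; first by rewrite e.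
    by case e': (a (0, (T + 2 * n + 2 + j, input (Some true)))).
  by have := minm _ e; lia.
pose y := mkseq v m.
exists x, y; split=> //; first by rewrite size_mkseq.
pose c0 := init M (pairs x y).
have h0 p : p <= 2 * T -> a (0, (p, cell c0 p)).
  move=> hp; rewrite cell_init; case: ltnP => hpT; first exact: hleft.
  rewrite onth_double (X_size xX); case: ltnP => h1.
    have hl : (p - T)./2 < n by lia.
    have -> : onth x (p - T)./2 = Some (w (p - T)./2).
      by rewrite onthE (nth_map false) ?(X_size xX) // hx.
    case: (boolP (odd (p - T))) => od.
      have e : p = (T + 2 * (p - T)./2).+1 by lia.
      by rewrite {1}e; apply: hw1.
    have e : p = T + 2 * (p - T)./2 by lia.
    by rewrite {1}e; apply: hw.
  have [j e] : exists j, p = T + 2 * n + j by exists (p - T - 2 * n); lia.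
  have -> : p - T - 2 * n = j by lia.
  case: j e => [|[|j]] e /=.
  - by rewrite e addn0.
  - by rewrite e.
  have -> : p = T + 2 * n + 2 + j by lia.
  case: (ltnP j m) => hj.
    rewrite onthE (nth_map false) ?size_mkseq // nth_mkseq //; exact: hv.
  by rewrite onth_default ?size_mkseq //; apply: hblank; lia.
(* A step clause needs both neighbours, so one position is lost at either end per step. Of the
   initial range up to [2 * T], exactly position [T] is left at time [T]. *)
have hrun t : t <= T -> forall p, t <= p -> p + t <= 2 * T ->
    a (t, (p, cell (iter t (@step M) c0) p)).
  elim: t => [_|t IH ht] p hp1 hp2; first by apply: h0; lia.
  have p0 : 0 < p by lia.
  set c := iter t (@step M) c0 in IH.
  have [|k] := hA (step_clause (t, p) (cell c T, (cell c p.-1, (cell c p, cell c p.+1)))).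
    rewrite !mem_cat; apply/orP; left.
    apply/allpairsP; exists ((t, p), (cell c T, (cell c p.-1, (cell c p, cell c p.+1)))).
    split=> //=; last by rewrite mem_enum.
    by apply/allpairsP; exists (t, p); split=> //=; rewrite mem_iota; lia.
  have ht' : t <= T by lia.
  rewrite !inE -cell_step // => /or4P [/eqP->|/eqP->|/eqP->|/orP[/eqP->|/eqP->]] //=;
    by rewrite IH //; lia.
apply/negP => /eqP hF.
have [|k] := hA [:: neg (T, (T, cell (iter T (@step M) c0) T))].
  rewrite !mem_cat; do 8!(apply/orP; right).
  apply: map_f; rewrite mem_filter mem_enum andbT /= ffunE /look ltnn subnn /=.
  exact/eqP.
by rewrite inE => /eqP -> /=; rewrite hrun //; lia.
Qed.

End Tableau.


(** * Decoding of pairs, lists and binary numbers *)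

Definition unpair_step (st : seq bool * seq bool * bool) : seq bool * seq bool * bool :=
  if st.2 then st else
  if st.1.2 is a :: r then
    if r is b :: r' then
      if a == b then (a :: st.1.1, r', false) else (st.1.1, r', true)
    else (st.1.1, [::], true)
  else (st.1.1, [::], true).

Definition unpair (s : seq bool) : seq bool * seq bool :=
  let st := iter (size s) unpair_step ([::], s, false) in (rev st.1.1, st.1.2).

Arguments unpair : simpl never.

Lemma pairs_cons b x y : pairs (b :: x) y = b :: b :: pairs x y.
Proof. by []. Qed.

Lemma size_pairs x y : size (pairs x y) = 2 * size x + 2 + size y.
Proof. by elim: x => [|b x IH] //; rewrite pairs_cons /= IH; lia. Qed.

Lemma pairsK x y : unpair (pairs x y) = (x, y).
Proof.
rewrite /unpair.
have h n acc : size x < n ->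
    iter n unpair_step (acc, pairs x y, false) = (rev x ++ acc, y, true).
  elim: x n acc => [|b x IH] [|n] acc //= hn; rewrite -iterS iterSr.
    rewrite /unpair_step /=; elim: n {hn} => // n IHn.
    by rewrite iterS IHn.
  rewrite pairs_cons {2}/unpair_step /= eqxx IH //.
  by rewrite rev_cons cat_rcons.
by rewrite h ?cats0 ?revK // size_pairs; lia.
Qed.

Lemma unpair_iter_size j s :
  let st := iter j unpair_step ([::], s, false) in sz st.1.1 + sz st.1.2 <= (sz s).+1.
Proof.
elim: j => [|j IH] //=; apply: leq_trans IH.
case: (iter _ _ _) => [[acc [|a [|b r]]] [|]]; rewrite /unpair_step /= ?sz_cons ?sz_nil //; try lia.
by case: eqP => [->|_] /=; rewrite ?sz_cons ?sz_nil; lia.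
Qed.

Lemma unpair_size s : sz (unpair s).1 + sz (unpair s).2 <= (sz s).+1.
Proof. by rewrite /unpair /= sz_rev; apply: unpair_iter_size. Qed.

Lemma ptime_unpair : ptime unpair.
Proof.
have h : ptime (fun s => iter (size s) unpair_step ([::], s, false)).
  apply: (@ptime_iter _ _ _ _ (fun _ => unpair_step) (fun s => size s)
     (fun s => ([::], s, false)) (fun s => sz s + 6)).
  - by rewrite /unpair_step; pt.
  - by pt.
  - by pt.
  - by pb.
  - move=> s j _; have := unpair_iter_size j s; case: (iter _ _ _) => [[u v] b] /=.
    by rewrite !sz_pair; have := sz_bool b; lia.
by rewrite /unpair; pt.
Qed.
#[export] Hint Resolve ptime_unpair : ptime.

Lemma ptime_pairs : ptime (fun p : seq bool * seq bool => pairs p.1 p.2).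
Proof. by rewrite /pairs; pt. Qed.

(** The empty string can stand for the empty list because [pairs] never yields it. *)
Definition encl (l : seq (seq bool)) : seq bool := foldr pairs [::] l.

Definition decl_step (st : seq (seq bool) * seq bool) : seq (seq bool) * seq bool :=
  if st.2 is [::] then st else ((unpair st.2).1 :: st.1, (unpair st.2).2).

Definition decl (s : seq bool) : seq (seq bool) :=
  rev (iter (size s) decl_step ([::], s)).1.

Lemma decl_stepE acc s : s != [::] ->
  decl_step (acc, s) = ((unpair s).1 :: acc, (unpair s).2).
Proof. by case: s. Qed.

Lemma enclK l : decl (encl l) = l.
Proof.
have h n acc : size l <= n -> iter n decl_step (acc, encl l) = (rev l ++ acc, [::]).
  elim: l n acc => [|x l IH] n acc hn.
    by elim: n {hn} => // n IHn; rewrite iterS IHn.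
  have e : decl_step (acc, encl (x :: l)) = (x :: acc, encl l).
    rewrite -[encl (x :: l)]/(pairs x (encl l)) decl_stepE ?pairsK //.
    by rewrite -size_eq0 size_pairs; lia.
  by case: n hn => // n hn; rewrite iterSr e IH // rev_cons cat_rcons.
rewrite /decl h ?cats0 ?revK //.
by elim: l {h} => //= x l IH; rewrite size_pairs; lia.
Qed.

Lemma size_encl l m : all (fun x => size x <= m) l -> size (encl l) <= size l * (2 * m + 2).
Proof.
by elim: l => //= x l IH /andP[hx /IH hl]; rewrite size_pairs mulSn; lia.
Qed.

Lemma ptime_decl : ptime decl.
Proof.
have h : ptime (fun s => iter (size s) decl_step ([::], s)).
  apply: (@ptime_iter _ _ _ _ (fun _ => decl_step) (fun s => size s)
     (fun s => ([::], s)) (fun s => 3 * sz s + 4)).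
  - have h : ptime (fun st : seq (seq bool) * seq bool =>
        if st.2 is b :: r then ((unpair st.2).1 :: st.1, (unpair st.2).2) else st) by pt.
    by apply: ptime_comp (ptime_snd0); apply: ptime_ext h _ => -[acc [|b r]].
  - by pt.
  - by pt.
  - by pb.
  - move=> s j lj; generalize (size_sz s).
    have : sz (iter j decl_step ([::], s)) <= sz s + 2 * j + 2.
      elim: j lj => [|j IH] lj; first by rewrite sz_pair sz_nil /=; lia.
      rewrite iterS; have := IH (ltnW lj); case: (iter _ _ _) => acc t.
      rewrite /decl_step /=; have := unpair_size t.
      by case: t => [|b t] /=; rewrite ?sz_pair ?sz_cons; lia.
    by lia.
by rewrite /decl; pt.
Qed.
#[export] Hint Resolve ptime_decl : ptime.

Definition bits_value (b : seq bool) : nat := foldr (fun (b : bool) v => b + v.*2) 0 b.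

Lemma enc_pos_value p : bits_value (enc_pos p) = BinPos.Pos.to_nat p.
Proof. by elim: p => [p|p|] //= ->; lia. Qed.

Lemma enc_nat_value k : bits_value (enc_nat k) = k.
Proof.
rewrite /enc_nat; case e: (BinNat.N.of_nat k) => [|p]; first by rewrite /=; lia.
by rewrite enc_pos_value; lia.
Qed.

Lemma enc_nat_last k : last true (enc_nat k).
Proof.
rewrite /enc_nat; case: (BinNat.N.of_nat k) => // p.
have : forall b, last b (enc_pos p) by elim: p => [p IH|p IH|] b //=.
exact.
Qed.

Lemma enc_nat_surj b : last true b -> exists k, b = enc_nat k.
Proof.
case: b => [|a b hb]; first by exists 0.
have [p ->] : exists p, a :: b = enc_pos p.
  elim: b a hb => [|c b IH] a /=; first by move=> ->; exists BinNums.xH.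
  by move=> /IH [p e]; exists (if a then BinNums.xI p else BinNums.xO p); rewrite e; case: a.
exists (BinPos.Pos.to_nat p); rewrite /enc_nat.
by have -> : BinNat.N.of_nat (BinPos.Pos.to_nat p) = BinNums.Npos p by lia.
Qed.

(** The number [k] is given in binary and may be exponential in its length, while numbers are
    computed in unary. It is therefore truncated at [d] after every bit, the minimum being written
    as [d - (d - v)]. *)
Definition capped (d : nat) (b : seq bool) : nat :=
  foldr (fun (x : bool) v => d - (d - (if x then (v + v).+1 else v + v))) 0 b.

Lemma cappedE d b : capped d b = minn d (bits_value b).
Proof. by elim: b => [|[] b IH] /=; rewrite ?IH; lia. Qed.

Lemma ptime_foldr {A B S} `{enc A, enc B, enc S} (f : A -> B -> S -> S) (i : A -> S)
    (l : A -> seq B) (b : A -> nat) :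
  ptime (fun p : A * (S * B) => f p.1 p.2.2 p.2.1) -> ptime i -> ptime l -> pbound b ->
  (forall a j, sz (foldr (f a) (i a) (drop j (l a))) <= b a) ->
  ptime (fun a => foldr (f a) (i a) (l a)).
Proof.
move=> hf hi hl hb hs.
have h : ptime (fun a => foldl (fun s x => f a x s) (i a) (rev (l a))).
  apply: (@ptime_foldl _ _ _ _ _ _ (fun a s x => f a x s) i (fun a => rev (l a)) b) => //.
    by pt.
  move=> a j; rewrite take_rev foldl_rev; exact: hs.
by apply: ptime_ext h _ => a; rewrite foldl_rev.
Qed.

Lemma ptime_capped {A} `{enc A} (d : A -> nat) (b : A -> seq bool) :
  ptime d -> ptime b -> ptime (fun a => capped (d a) (b a)).
Proof.
move=> hd hb; rewrite /capped.
apply: (ptime_foldr (f := fun a (x : bool) v => d a - (d a - (if x then (v + v).+1 else v + v)))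
  (b := fun a => sz (d a))) => //.
- have h : ptime (fun p : A * (nat * bool) => d p.1) by apply: ptime_comp hd _; pt.
  by pt.
- by pt.
- exact: ptime_sz.
- move=> a j; have := cappedE (d a) (drop j (b a)); rewrite /capped => ->.
  by rewrite !sz_nat; lia.
Qed.

Lemma ptime_undup {A} {B : eqType} `{enc A, enc B} (l : A -> seq B) :
  ptime l -> ptime (fun a => undup (l a)).
Proof.
move=> hl.
have e (s : seq B) : foldr (fun x u => if x \in u then u else x :: u) [::] s = undup s.
  by elim: s => //= x s ->; rewrite mem_undup.
have szu (s : seq B) : sz (undup s) <= sz s.
  by elim: s => //= x s IH; case: ifP => _; rewrite !sz_cons; lia.
have h : ptime (fun a => foldr (fun x u => if x \in u then u else x :: u) [::] (l a)).
  apply: (ptime_foldr (f := fun _ x u => if x \in u then u else x :: u)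
    (b := fun a => sz (l a))) => //; try by pt.
    exact: ptime_sz.
  by move=> a j; rewrite e (leq_trans (szu _)) ?sz_drop.
by apply: ptime_ext h _.
Qed.

(** * Membership in NP *)

Lemma all_iota (P : pred nat) n : all P (iota 0 n) = [forall i : 'I_n, P i].
Proof.
apply/allP/forallP => h i; first by apply: h; rewrite mem_iota add0n ltn_ord.
by rewrite mem_iota /= => hi; apply: (h (Ordinal hi)).
Qed.

Lemma has_iota (P : pred nat) n : has P (iota 0 n) = [exists i : 'I_n, P i].
Proof.
apply/hasP/existsP => [[i]|[i h]]; last by exists (i : nat); rewrite ?mem_iota ?add0n ?ltn_ord.
by rewrite mem_iota /= => hi h; exists (Ordinal hi).
Qed.

Lemma nth_allpairs (A B C : Type) a b c (f : A -> B -> C) s t i j :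
  i < size s -> j < size t ->
  nth c [seq f x y | x <- s, y <- t] (i * size t + j) = f (nth a s i) (nth b t j).
Proof.
elim: s i => // x s IH [|i] hi hj /=; rewrite nth_cat size_map.
  by rewrite mul0n add0n hj (nth_map b).
by rewrite mulSn -addnA ltnNge leq_addr /= addKn IH.
Qed.

Lemma graph_iso (G H : graph) (h : G -> H) (h' : H -> G) :
  cancel h' h -> (forall u v, adj (h u) (h v) = adj u v) -> #|G| = #|H| ->
  (forall k, clique_identifiable G k -> clique_identifiable H k) /\
  (connected G -> connected H).
Proof.
move=> hK ha hc; split.
  move=> k /clique_identifiableP [C [f [[fs fa] fc]]]; apply/clique_identifiableP.
  have h'K : cancel h h'.
    have bh' : bijective h' by apply: inj_card_bij; [apply: can_inj hK|rewrite hc].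
    exact/(bij_can_sym bh').
  exists C, (f \o h'); split; last by rewrite -hc.
  split=> [c|c d cd]; first by have [u <-] := fs c; exists (h u); rewrite /= h'K.
  have [u [v [<- <- uv]]] := fa _ _ cd.
  by exists (h u), (h v); rewrite /= !h'K ha.
move=> [G0 Gc]; split; first by rewrite -hc.
move=> u v; rewrite -[u]hK -[v]hK.
have /connectP [p hp ->] := Gc (h' u) (h' v).
elim: p (h' u) hp => [|w p IH] x /=; first by rewrite connect0.
by move=> /andP[xw /IH]; apply: connect_trans; apply: connect1; rewrite ha.
Qed.

Lemma size_enc_graph (G : graph) : size (enc_graph G) = #|G| * #|G|.
Proof. by rewrite size_allpairs -cardE. Qed.

Lemma nth_enc_graph (G : graph) (i j : 'I_#|G|) :
  nth false (enc_graph G) (i * #|G| + j) = adj (enum_val i) (enum_val j).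
Proof.
have hi : i < size (enum G) by rewrite -cardE.
have hj : j < size (enum G) by rewrite -cardE.
have := nth_allpairs (enum_val i) (enum_val i) false (@adj G) hi hj.
by rewrite -cardE -!enum_val_nth.
Qed.

(** The language asks for some graph with the given code, and a code determines the graph only up to
    isomorphism; the number of vertices is the square root of its length. *)
Lemma enc_graph_iso (G H : graph) : enc_graph G = enc_graph H ->
  (forall k, clique_identifiable G k -> clique_identifiable H k) /\
  (connected G -> connected H).
Proof.
move=> e; have hc : #|G| = #|H|.
  have := congr1 size e; rewrite !size_enc_graph => h.
  by apply/eqP; rewrite -(eqn_exp2r _ _ (isT : 0 < 2)) -!mulnn h.
apply: (@graph_iso _ _ (fun u => enum_val (cast_ord hc (enum_rank u)))
  (fun u => enum_val (cast_ord (esym hc) (enum_rank u)))) => //.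
- by move=> u; rewrite enum_valK cast_ordKV enum_rankK.
move=> u v; rewrite -nth_enc_graph -e /= -hc nth_enc_graph.
by rewrite !enum_rankK.
Qed.

Section MatrixGraph.
Variables (m : seq bool) (n : nat).
Definition entry (i j : nat) : bool := nth false m (i * n + j).
Hypotheses (m_size : size m = n * n) (m_sym : forall i j : 'I_n, entry i j = entry j i)
  (m_irr : forall i : 'I_n, entry i i = false).

Definition matrix_graph : graph :=
  @Graph 'I_n (fun i j => entry i j) m_sym m_irr.

Lemma enc_matrix_graph : enc_graph matrix_graph = m.
Proof.
apply: (@eq_from_nth _ false); rewrite size_enc_graph card_ord // => q hq.
have n0 : 0 < n by case: (n) hq.
have hi : q %/ n < n by rewrite ltn_divLR.
have hj : q %% n < n by rewrite ltn_mod.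
rewrite (divn_eq q n) -[X in _ * X + _](size_enum_ord n).
rewrite (nth_allpairs (Ordinal hi) (Ordinal hi)) ?size_enum_ord //.
by rewrite /= /entry !nth_enum_ord.
Qed.
End MatrixGraph.

(** Filtering [iota 0 n] keeps the list free of repetitions, so its size stays bounded under
    iteration. *)
Definition grow (m : seq bool) (n : nat) (s : seq nat) : seq nat :=
  [seq i <- iota 0 n | (i \in s) || has (fun j => entry m n j i) s].

Definition reach (m : seq bool) (n : nat) : seq nat := iter n (grow m n) [:: 0].

(** The certificate [cols] is a colouring of the vertices by bit strings. The numeral is capped at
    [n - size (undup cols)], the number of identifications required, so reaching the cap means that
    [k] suffices. *)
Definition check_core (conn : bool) (q : seq bool * (seq bool * seq (seq bool))) : bool :=
  let m := q.1 in let b := q.2.1 in let cols := q.2.2 in let n := size q.2.2 in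
  [&& size m == n * n, last true b,
      all (fun i => all (fun j => entry m n i j == entry m n j i) (iota 0 n)) (iota 0 n),
      all (fun i => ~~ entry m n i i) (iota 0 n),
      all (fun i => all (fun j => (nth [::] cols i == nth [::] cols j) ||
        has (fun i' => has (fun j' => (nth [::] cols i' == nth [::] cols i) &&
          ((nth [::] cols j' == nth [::] cols j) && entry m n i' j')) (iota 0 n)) (iota 0 n))
        (iota 0 n)) (iota 0 n),
      n - size (undup cols) <= capped (n - size (undup cols)) b
    & ~~ conn || ((0 < n) && all (fun i => i \in reach m n) (iota 0 n))].

Definition check (conn : bool) (s y : seq bool) : bool :=
  (pairs (unpair s).1 (unpair s).2 == s) &&
  check_core conn ((unpair s).1, ((unpair s).2, decl y)).

Section CheckGraph.
Variables (m : seq bool) (n : nat).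
Hypotheses (m_size : size m = n * n) (m_sym : forall i j : 'I_n, entry m n i j = entry m n j i)
  (m_irr : forall i : 'I_n, entry m n i i = false).
Let G := matrix_graph m_sym m_irr.

Lemma check_connected :
  (0 < n) && all (fun i => i \in reach m n) (iota 0 n) <-> connected G.
Proof.
have sound j i : i \in iter j (grow m n) [:: 0] -> 0 < n ->
    exists2 u : G, u = i :> nat & forall z : G, z = 0 :> nat -> connect (@adj G) z u.
  elim: j i => [|j IH] i /=.
    rewrite inE => /eqP -> n0; exists (Ordinal n0) => // z hz.
    by rewrite (_ : z = Ordinal n0) ?connect0 //; apply: val_inj.
  rewrite mem_filter mem_iota /= => /andP[/orP[h|/hasP [k hk hki]] hi] n0; first exact: IH.
  have [u hu hz] := IH _ hk n0; exists (Ordinal hi) => // z /hz h.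
  by apply: connect_trans h (connect1 _); rewrite /= hu.
have mono j k : j <= k -> forall i : 'I_n, (i : nat) \in iter j (grow m n) [:: 0] ->
    (i : nat) \in iter k (grow m n) [:: 0].
  move=> /subnK <-; elim: (k - j) => // d IH i /IH h.
  by rewrite addSn iterS mem_filter h mem_iota /= ltn_ord.
split=> [/andP[n0 /allP h]|[]].
  split; first by rewrite card_ord.
  pose z : G := Ordinal n0.
  have hz u : connect (@adj G) z u.
    have [|//|u' /val_inj -> -> //] := sound n (u : nat).
    by apply: h; rewrite mem_iota /= ltn_ord.
  move=> u v; apply: connect_trans (hz v).
  by rewrite (sym_connect_sym (@adj_sym G)).
rewrite card_ord => n0 hc; rewrite n0 /=; apply/allP => i; rewrite mem_iota /= => hi.
pose z : G := Ordinal n0.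
have /connectP [p0 hp0 ei] := hc z (Ordinal hi).
(* A path without repetitions has fewer than [n] edges, so [n] rounds of [grow] reach its end. *)
case: (shortenP hp0) ei => p hp up _ ei.
have sp : size p < n.
  by have := max_card (mem (z :: p)); rewrite (card_uniqP up) card_ord.
have -> : i = (last z p : nat) by rewrite -ei.
have walk : forall q (x : G) j, path (@adj G) x q -> (x : nat) \in iter j (grow m n) [:: 0] ->
    (last x q : nat) \in iter (size q + j) (grow m n) [:: 0].
  elim=> //= w q IH x j /andP[xw hq] hx; rewrite -iterS -addnS; apply: IH => //=.
  rewrite mem_filter mem_iota /= ltn_ord andbT; apply/orP; right.
  by apply/hasP; exists (x : nat).
apply: (mono (size p + 0)); first by lia.
exact: walk.
Qed.

Lemma check_coreP (conn : bool) b cols : size cols = n -> last true b ->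
  (check_core conn (m, (b, cols)) <->
   [/\ forall i j : 'I_n, nth [::] cols i != nth [::] cols j ->
         exists i' j' : 'I_n, [/\ nth [::] cols i' = nth [::] cols i,
           nth [::] cols j' = nth [::] cols j & entry m n i' j'],
       n <= size (undup cols) + bits_value b
     & conn -> connected G]).
Proof.
move=> hn hb; rewrite /check_core /= hn m_size eqxx hb /= !all_iota.
have -> : [forall i : 'I_n, all (fun j => entry m n i j == entry m n j i) (iota 0 n)].
  by apply/forallP => i; rewrite all_iota; apply/forallP => j; rewrite m_sym.
have -> : [forall i : 'I_n, ~~ entry m n i i] by apply/forallP => i; rewrite m_irr.
rewrite cappedE leq_min leqnn /= leq_subLR.
have hcol : [forall i : 'I_n, all (fun j => (nth [::] cols i == nth [::] cols j) ||
        has (fun i' => has (fun j' => (nth [::] cols i' == nth [::] cols i) &&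
          ((nth [::] cols j' == nth [::] cols j) && entry m n i' j')) (iota 0 n)) (iota 0 n))
        (iota 0 n)] <-> (forall i j : 'I_n, nth [::] cols i != nth [::] cols j ->
         exists i' j' : 'I_n, [/\ nth [::] cols i' = nth [::] cols i,
           nth [::] cols j' = nth [::] cols j & entry m n i' j']).
  split=> [/forallP h i j ne|h].
    have := h i; rewrite all_iota => /forallP /(_ j); rewrite (negbTE ne) /= has_iota.
    case/existsP=> i'; rewrite has_iota => /existsP [j' /and3P[/eqP h1 /eqP h2 h3]].
    by exists i', j'.
  apply/forallP => i; rewrite all_iota; apply/forallP => j.
  case: eqP => //= /eqP ne; have [i' [j' [h1 h2 h3]]] := h i j ne.
  rewrite has_iota; apply/existsP; exists i'; rewrite has_iota; apply/existsP; exists j'.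
  by rewrite h1 h2 !eqxx.
have hconn : ~~ conn || ((0 < n) && [forall i : 'I_n, (i : nat) \in reach m n]) <->
    (conn -> connected G).
  case: conn => //=; rewrite -check_connected all_iota.
  by split=> [h _ //|]; apply.
split=> [/and3P[/hcol h1 h2 /hconn h3]|[/hcol h1 h2 /hconn h3]]; first by split.
by apply/and3P.
Qed.

Lemma check_core_identifiable (conn : bool) b cols : size cols = n -> last true b ->
  check_core conn (m, (b, cols)) ->
  clique_identifiable G (bits_value b) /\ (conn -> connected G).
Proof.
move=> hn hb /(check_coreP conn hn hb) [h1 h2 h3]; split=> //.
apply/clique_identifiableP.
have hm (i : G) : nth [::] cols i \in undup cols by rewrite mem_undup mem_nth // hn.
exists (seq_sub (undup cols)), (fun i => SeqSub (hm i)); split; last first.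
  by rewrite card_ord card_seq_sub ?undup_uniq.
split=> [[c hc]|c d cd].
  have := hc; rewrite mem_undup => hc'; have hi : index c cols < n by rewrite -hn index_mem.
  by exists (Ordinal hi); apply: val_inj; rewrite /= nth_index.
have ex (c' : seq_sub (undup cols)) : exists i : 'I_n, nth [::] cols i = val c'.
  case: c' => c' hc' /=; have := hc'; rewrite mem_undup => hc.
  have hi : index c' cols < n by rewrite -hn index_mem.
  by exists (Ordinal hi); rewrite /= nth_index.
have [i hi] := ex c; have [j hj] := ex d.
have [|i' [j' [e1 e2 e3]]] := h1 i j; first by rewrite hi hj.
by exists i', j'; split=> //; apply: val_inj; rewrite /= ?e1 ?e2.
Qed.

Lemma identifiable_check_core (conn : bool) k b : last true b -> bits_value b = k ->
  clique_identifiable G k -> (conn -> connected G) ->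
  exists cols, [/\ size cols = n, all (fun c => size c <= n) cols
    & check_core conn (m, (b, cols))].
Proof.
move=> hb vb /clique_identifiableP [C [f [[fs fa] fc]]] hconn.
have [g gK] := fin_all_exists fs.
have lC : #|C| <= n by rewrite -[n]card_ord; apply: leq_card g (can_inj gK).
(* Unary names for the classes are short enough: there are at most [n] classes. *)
pose col (c : C) : seq bool := nseq (enum_rank c) true.
have col_inj : injective col.
  by move=> c d /(congr1 size); rewrite !size_nseq => /val_inj /enum_rank_inj.
pose cols := [seq col (f i) | i <- enum 'I_n].
have scols : size cols = n by rewrite size_map size_enum_ord.
have ncol (i : 'I_n) : nth [::] cols i = col (f i).
  by rewrite (nth_map i) ?size_enum_ord // nth_ord_enum.
exists cols; split=> //.
  apply/allP => c /mapP [i _ ->]; rewrite size_nseq.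
  by apply: leq_trans lC; apply: ltnW.
apply/check_coreP => //; split=> //.
  move=> i j; rewrite !ncol (inj_eq col_inj) => /fa [u [v [hu hv uv]]].
  by exists u, v; rewrite !ncol hu hv.
have -> : size (undup cols) = #|C|.
  rewrite cardE -(size_map col); apply/perm_size/uniq_perm.
  - exact: undup_uniq.
  - by rewrite map_inj_uniq ?enum_uniq.
  move=> c; rewrite mem_undup; apply/mapP/mapP => [[i _ ->]|[d _ ->]].
    by exists (f i); rewrite ?mem_enum.
  by exists (g d); rewrite ?mem_enum ?gK.
by rewrite vb -[n]card_ord.
Qed.

End CheckGraph.

Lemma check_sound (conn : bool) s y : check conn s y ->
  exists G k, [/\ s = enc_instance (G, k), conn -> connected G & clique_identifiable G k].
Proof.
rewrite /check; case: (unpair s) => m b /= /andP[/eqP <- h].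
have := h; rewrite /check_core /=; set n := size (decl y).
case/and4P=> /eqP hm hb; rewrite !all_iota => /forallP h1 /andP[/forallP h2 _].
have m_sym (i j : 'I_n) : entry m n i j = entry m n j i.
  by have := h1 i; rewrite all_iota => /forallP /(_ j) /eqP.
have m_irr (i : 'I_n) : entry m n i i = false by apply/negbTE/h2.
have [k hk] := enc_nat_surj hb.
have [||H1 H2] := check_core_identifiable hm m_sym m_irr (conn := conn) (b := b) (cols := decl y) _ _ h => //.
exists (matrix_graph m_sym m_irr), k; split=> //.
  by rewrite /enc_instance /= enc_matrix_graph // -hk.
by move: H1; rewrite hk enc_nat_value.
Qed.

Lemma check_complete (conn : bool) (G : graph) k :
  (conn -> connected G) -> clique_identifiable G k ->
  exists2 y, size y <= (size (enc_instance (G, k)) + 2) ^ 2 & check conn (enc_instance (G, k)) y.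
Proof.
move=> hconn hG; set n := #|G|; set m := enc_graph G.
have hm : size m = n * n by apply: size_enc_graph.
have m_sym (i j : 'I_n) : entry m n i j = entry m n j i.
  by rewrite /entry !nth_enc_graph adj_sym.
have m_irr (i : 'I_n) : entry m n i i = false by rewrite /entry nth_enc_graph adj_irr.
have [i1 i2] := @enc_graph_iso G (matrix_graph m_sym m_irr) (esym (enc_matrix_graph hm m_sym m_irr)).
have [cols [h1 h2 h3]] := identifiable_check_core hm (enc_nat_last k) (enc_nat_value k)
  (i1 k hG) (fun c => i2 (hconn c)).
exists (encl cols).
  apply: leq_trans (size_encl h2) _; rewrite size_pairs /= -/m hm h1.
  by rewrite -mulnn; nia.
by rewrite /check /enc_instance pairsK enclK eqxx.
Qed.

Lemma ptime_check conn : ptime (fun w => check conn (unpair w).1 (unpair w).2).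
Proof.
have hp (A : Type) (eA : enc A) (f g : A -> seq bool) : ptime f -> ptime g -> ptime (fun a => pairs (f a) (g a)).
  exact: (ptime_app2 ptime_pairs).
have he (A : Type) (eA : enc A) (f : A -> seq bool) (n i j : A -> nat) : ptime f -> ptime n -> ptime i ->
    ptime j -> ptime (fun a => entry (f a) (n a) (i a) (j a)).
  by move=> *; rewrite /entry; pt.
have hr : ptime (fun q : seq bool * nat => reach q.1 q.2).
  apply: (@ptime_iter _ _ _ _ (fun q => grow q.1 q.2) snd (fun=> [:: 0])
    (fun q => sz (iota 0 q.2) + 3)); try by pt.
  - by rewrite /grow; pt; apply: he; pt.
  - by apply: pbound_add; [apply: ptime_sz; pt|pb].
  - move=> q [|j] _; first by rewrite sz_cons sz_nil sz_nat; lia.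
    have szf (p : pred nat) l : sz (filter p l) <= sz l.
      by elim: l => //= x l IH; case: ifP => _; rewrite !sz_cons; lia.
    exact: leq_trans (szf _ _) (leq_addr _ _).
have hc : ptime (check_core conn).
  rewrite /check_core; cbv zeta.
  have hu : ptime (fun q : seq bool * (seq bool * seq (seq bool)) => undup q.2.2).
    by apply: ptime_undup; pt.
  have hl : ptime (fun q : seq bool * (seq bool * seq (seq bool)) => last true q.2.1).
    have h : ptime (fun q : seq bool * (seq bool * seq (seq bool)) => head true (rev q.2.1)) by pt.
    by apply: ptime_ext h _ => -[m [b c]] /=; elim/last_ind: b => // b x _; rewrite rev_rcons last_rcons.
  have hr' : ptime (fun p : seq bool * (seq bool * seq (seq bool)) * nat =>
      reach p.1.1 (size p.1.2.2)).
    by apply: (ptime_comp hr (f := fun p => (p.1.1, size p.1.2.2))); pt.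
  have hcap : ptime (fun q : seq bool * (seq bool * seq (seq bool)) =>
      capped (size q.2.2 - size (undup q.2.2)) q.2.1) by apply: ptime_capped; pt.
  by repeat (cbv beta; first [apply he | progress pt]).
rewrite /check.
have h2 : ptime (fun w => pairs (unpair (unpair w).1).1 (unpair (unpair w).1).2).
  by apply: hp; pt.
by pt.
Qed.

Lemma clique_identification_NP (C : graph -> Prop) (conn : bool) :
  (forall G, C G <-> (conn -> connected G)) -> class_NP (clique_identification C).
Proof.
move=> hC; have [p hp] := poly_above 2.
exists (fun w => check conn (unpair w).1 (unpair w).2), p; split.
  exact: ptime_class_P (ptime_check conn).
move=> x; split=> [[G [k [-> /hC h1 h2]]]|[y [_]]].
  have [y h3 h4] := check_complete h1 h2.
  by exists y; rewrite hp pairsK.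
rewrite pairsK /= => /check_sound [G [k [-> h1 h2]]].
by exists G, k; split=> //; apply/hC.
Qed.


(** * The composition and NP-hardness *)

Lemma ptime_optcase {A B C} `{enc A, enc B, enc C} (o : A -> option B) (f0 : A -> C)
    (f1 : A -> B -> C) :
  ptime o -> ptime f0 -> ptime (fun p : A * B => f1 p.1 p.2) ->
  ptime (fun a => if o a is Some b then f1 a b else f0 a).
Proof.
move=> ho h0 h1.
have h1' : ptime (fun p : A * (B * unit) => f1 p.1 p.2.1) by apply (ptime_app2 h1); pt.
apply: (ptime_case ho h0 h1') => a.
by case: (o a) => [b|]; [right; exists (b, tt)|left].
Qed.

Fixpoint binc (s : seq bool) : seq bool :=
  match s with
  | [::] => [:: true]
  | false :: s' => true :: s'
  | true :: s' => false :: binc s'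
  end.

Lemma enc_nat_iter k : enc_nat k = iter k binc [::].
Proof.
elim: k => //= k <-; rewrite /enc_nat.
have ep p : enc_pos (BinPos.Pos.succ p) = binc (enc_pos p) by elim: p => //= p ->.
case e: (BinNat.N.of_nat k) => [|p].
  by have -> : BinNat.N.of_nat k.+1 = BinNums.Npos BinNums.xH by lia.
by have -> : BinNat.N.of_nat k.+1 = BinNums.Npos (BinPos.Pos.succ p) by lia.
Qed.

(** The argument is unary, so [k] increments are affordable. As the least significant bit comes
    first, an increment is one scan from left to right with a carry flag. *)
Lemma ptime_enc_nat : ptime enc_nat.
Proof.
pose st (u : bool * seq bool) (x : bool) : bool * seq bool :=
  if u.1 then (if x then (true, false :: u.2) else (false, true :: u.2)) else (false, x :: u.2).
pose fin (u : bool * seq bool) : seq bool := rev (if u.1 then true :: u.2 else u.2).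
have e1 s acc : fin (foldl st (false, acc) s) = rev acc ++ s.
  elim: s acc => [|x s IH] acc /=; first by rewrite cats0.
  by rewrite IH rev_cons cat_rcons.
have e2 s acc : fin (foldl st (true, acc) s) = rev acc ++ binc s.
  elim: s acc => [|[] s IH] acc /=; first by rewrite /fin /= rev_cons cats1.
    by rewrite IH rev_cons cat_rcons.
  by rewrite /st /= -/st e1 rev_cons cat_rcons.
have sst s u : size (foldl st u s).2 = size u.2 + size s.
  by elim: s u => [|x s IH] u /=; rewrite ?addn0 // IH /st; case: u.1 x => -[] /=; lia.
have hf : ptime (fun s : seq bool => foldl st (true, [::]) s).
  apply: (@ptime_foldl _ _ _ _ _ _ (fun _ => st) (fun=> (true, [::])) (fun s => s)
    (fun s => 4 * sz s + 10)); try by pt.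
  - by rewrite /st; pt.
  - by pb.
  move=> s j; have := sst (take j s) (true, [::]); case: (foldl _ _ _) => b t /=.
  rewrite sz_pair; have := sz_bits t; have := sz_bool b; generalize (size_sz s).
  by have := geq_minr j (size s); rewrite -size_take_min; lia.
have hb : ptime binc.
  have h : ptime (fun s => fin (foldl st (true, [::]) s)) by rewrite /fin; pt.
  by apply: ptime_ext h _ => s; rewrite e2.
have h : ptime (fun k => iter k binc [::]).
  apply: (@ptime_iter _ _ _ _ (fun _ => binc) (fun k => k) (fun=> [::])
    (fun k => 4 * sz k + 1)); try by pt.
  - by pb.
  move=> k j lj; apply: leq_trans (sz_bits _) _; rewrite leq_add2r leq_mul2l /=.
  have : size (iter j binc [::]) <= j.
    have hs : forall s, size (binc s) <= (size s).+1 by elim=> [|[] s IHs].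
    elim: j {lj} => // j IH; rewrite iterS.
    by apply: leq_trans (hs _) _; rewrite ltnS.
  by rewrite sz_nat; lia.
by apply: ptime_ext h _ => k; rewrite enc_nat_iter.
Qed.
#[export] Hint Resolve ptime_enc_nat : ptime.

Lemma ptime_horner {A} `{enc A} (p : {poly nat}) (u : A -> nat) :
  ptime u -> ptime (fun a => horner p (u a)).
Proof.
move=> hu; rewrite /horner; elim: (polyseq p) => [|c s IH]; first exact: ptime_const 0.
have h : ptime (fun a => muln (horner_rec s (u a)) (u a) + c) by pt.
by apply: ptime_ext h _.
Qed.

(** * Polynomial time of the graph construction and of the tableau *)

Section GraphTime.
Context {A : Type} {V : eqType} `{enc A, enc V}.

Lemma ptime_split_rel : ptime (fun p : (option V * seq V) * (option V * seq V) =>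
  split_rel p.1 p.2).
Proof.
have h : ptime (fun p : (option V * seq V) * (option V * seq V) =>
    if p.1.1 is Some u then (if p.2.1 is Some _ then true else u \in p.2.2)
    else if p.2.1 is Some u then u \in p.1.2 else true).
  by apply: ptime_optcase; [pt|apply: ptime_optcase; pt|apply: ptime_optcase; pt].
by apply: ptime_ext h _ => -[[[u|] c] [[v|] d]].
Qed.

Lemma ptime_split_matrix (us : A -> seq V) (cs : A -> seq (seq V)) :
  ptime us -> ptime cs ->
  ptime (fun a => list_matrix (@split_rel V) (split_vertices (us a) (cs a))).
Proof.
move=> hus hcs.
have hv : ptime (fun a => split_vertices (us a) (cs a)).
  rewrite /split_vertices; pt.
have hz : ptime (fun a => zip (iota 0 (size (split_vertices (us a) (cs a))))
    (split_vertices (us a) (cs a))).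
  have h : ptime (fun a => [seq (i, nth (None, [::]) (split_vertices (us a) (cs a)) i)
    | i <- iota 0 (size (split_vertices (us a) (cs a)))]).
    apply: (ptime_map (f := fun a i => (i, nth (None, [::]) (split_vertices (us a) (cs a)) i)));
      last by pt.
    have h1 : ptime (fun q : A * nat => split_vertices (us q.1) (cs q.1)).
      by apply: (ptime_comp (g := fun a => split_vertices (us a) (cs a))); pt.
    by pt.
  apply: ptime_ext h _ => a; move: (split_vertices _ _) => l.
  rewrite -[in RHS](mkseq_nth (None, [::]) l) /mkseq size_map size_iota.
  by elim: (iota _ _) => //= i s ->.
rewrite /list_matrix; cbv zeta; apply: ptime_flatten.
apply: (ptime_map (f := fun a x => [seq (x.1 != y.1) && split_rel x.2 y.2
  | y <- zip (iota 0 (size (split_vertices (us a) (cs a)))) (split_vertices (us a) (cs a))])) => //.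
apply: (ptime_map (f := fun (q : A * (nat * (option V * seq V))) y =>
  (q.2.1 != y.1) && split_rel q.2.2 y.2)); last by apply: ptime_comp hz _; pt.
by apply: ptime_andb; [pt|apply (ptime_app2 ptime_split_rel); pt].
Qed.

End GraphTime.

Lemma ptime_sat_matrix {A : Type} {V : eqType} `{enc A, enc V} (vs : A -> seq V) (cs : A -> seq (seq (bool * V))) :
  ptime vs -> ptime cs ->
  ptime (fun a => list_matrix (@split_rel _)
    (split_vertices (sat_elts (vs a)) (sat_sets (vs a) (cs a)))).
Proof.
move=> hv hc.
have he : ptime (fun a => sat_elts (vs a)).
  have h : ptime (fun a => None :: [seq Some (true, v) | v <- vs a] ++
      [seq Some (false, v) | v <- vs a]) by pt.
  by apply: ptime_ext h _ => a; rewrite /sat_elts /= cats0.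
apply: ptime_split_matrix => //; rewrite /sat_sets; pt.
Qed.


Section TableauTime.
Variable M : turing_machine.
#[local] Instance enc_letters : enc (letters M) := enc_fin (letters M).
#[local] Instance enc_fact : enc (fact M) := (_ : enc (nat * (nat * letters M))).

Lemma ptime_input : ptime (input M).
Proof.
by apply: (@ptime_finmatch _ _ (option bool) _ _ _ (fun o => o) (fun o _ => input M o)) => [|o]; pt.
Qed.

Lemma ptime_next {A} `{enc A} (b1 b2 b3 : A -> bool)
    (q : A -> letters M * (letters M * (letters M * letters M))) :
  ptime b1 -> ptime b2 -> ptime b3 -> ptime q ->
  ptime (fun a => next (b1 a) (b2 a) (b3 a) (q a)).
Proof.
move=> h1 h2 h3 hq.
apply: (@ptime_finmatch _ _ bool _ _ _ b1 (fun c1 a => next c1 (b2 a) (b3 a) (q a))) => // c1.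
apply: (@ptime_finmatch _ _ bool _ _ _ b2 (fun c2 a => next c1 c2 (b3 a) (q a))) => // c2.
apply: (@ptime_finmatch _ _ bool _ _ _ b3 (fun c3 a => next c1 c2 c3 (q a))) => // c3.
apply: (@ptime_finmatch _ _ (letters M * (letters M * (letters M * letters M)))%type _
  (enc_prod (A := letters M)) _ q (fun c4 a => next c1 c2 c3 c4)) => // c4.
exact: ptime_const.
Qed.

Notation ctx := (nat * (nat * (nat * seq (seq bool))))%type.

Lemma ptime_flip {A} `{enc A} (x : A -> seq bool) (l i : A -> nat) :
  ptime x -> ptime l -> ptime i -> ptime (fun a => flip (x a) (l a) (i a)).
Proof. by move=> hx hl hi; rewrite /flip; pt. Qed.

Lemma ptime_tab_clauses :
  ptime (fun q : ctx => tab_clauses M q.1 q.2.1 q.2.2.1 q.2.2.2).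
Proof.
have hi := ptime_input.
rewrite /tab_clauses; repeat apply: ptime_cat.
- rewrite /step_clauses /step_clause /pos /neg; pt; by apply ptime_next; pt.
- by rewrite /left_clauses /pos; pt.
- by rewrite /word_clauses /pos; pt.
- by rewrite /copy_clauses /pos /neg; pt.
- rewrite /member_clauses /neg /flip_out.
  by repeat (cbv beta; first [apply ptime_flip | progress pt]).
- by rewrite /sep_clauses /pos; pt.
- by rewrite /cert_clauses /pos; pt.
- by rewrite /blank_clauses /pos /neg; pt.
- by rewrite /final_clauses /neg; pt.
Qed.

Lemma ptime_tab_vars {A} `{enc A} (T : A -> nat) :
  ptime T -> ptime (fun a => tab_vars M (T a)).
Proof. by move=> hT; rewrite /tab_vars; pt. Qed.

End TableauTime.

(** An OR-composition into connected graphs, polynomial in the whole list but with a parameter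
    computed from the common length of the words alone. *)
Record composition (L : language) := Composition {
  comp_graph : seq (seq bool) -> graph;
  comp_param : nat -> nat;
  comp_graph_ptime : ptime (fun X => enc_graph (comp_graph X));
  comp_param_ptime : ptime comp_param;
  comp_connected : forall X, connected (comp_graph X);
  comp_correct : forall n X, 0 < size X -> (forall x, x \in X -> size x = n) ->
    (clique_identifiable (comp_graph X) (comp_param n) <-> exists2 x, x \in X & L x) }.

Lemma NP_composition L : class_NP L -> exists C : composition L, True.
Proof.
move=> [V [p [[f [[M [q hM]] hV]] hL]]].
have [kq hq] := poly_below q.
pose P n := horner p n.
(* The power bounds the running time of the verifier, whose input has length at most
   [2 * n + 2 + P n]. The second summand leaves room for that input between positions [T] and
   [2 * T]. *)
pose T n := (2 * n + P n + 4) ^ kq + (2 * n + 3 + P n).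
pose len (X : seq (seq bool)) := size (head [::] X).
pose vars n := tab_vars M (T n).
pose cnf X := tab_clauses M (T (len X)) (len X) (P (len X)) X.
pose G X := sat_graph (vars (len X)) (cnf X).
pose K n := 2 * size (vars n) - 1.
have TL n : 2 * n + 3 + P n <= T n by rewrite /T; lia.
have pP (A : Type) (eA : enc A) (u : A -> nat) : ptime u -> ptime (fun a => P (u a)).
  exact: ptime_horner.
have pT (A : Type) (eA : enc A) (u : A -> nat) : ptime u -> ptime (fun a => T (u a)).
  by move=> hu; rewrite /T; have := pP _ _ _ hu => h; pt.
have pl : ptime len by rewrite /len; pt.
have hacc n x y : size x = n -> size y <= P n -> accepting M (T n) x y <-> V (pairs x y).
  move=> hx hy.
  have hle : horner q (size (pairs x y)) <= T n.
    apply: leq_trans (hq _) _; rewrite /T; apply: leq_trans (leq_addr _ _).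
    by rewrite size_pairs hx; case: (kq) => // k; rewrite leq_exp2r //; lia.
  have [_ hout] := computes_within_leq hle (hM (pairs x y) I).
  have h0 : cur ((iter (T n) (@step M) (init M (pairs x y))).2 ord_max) =
    letter M (Some (f (pairs x y))) := hout 0.
  rewrite hV /accepting h0 (inj_eq (@letter_inj M)).
  by case: (f _).
unshelve eexists; last exact: I.
apply: (@Composition L G K).
- have hm : ptime (fun X => list_matrix (@split_rel _)
      (split_vertices (sat_elts (vars (len X))) (sat_sets (vars (len X)) (cnf X)))).
    apply: (@ptime_sat_matrix _ (fact M) _ (enc_fact M)).
      by apply: ptime_tab_vars; apply: pT.
    apply: (ptime_comp (ptime_tab_clauses M)
      (f := fun X => (T (len X), (len X, (P (len X), X))))).
    by have h1 := pT _ _ _ pl; have h2 := pP _ _ _ pl; pt.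
  by apply: ptime_ext hm _ => X; rewrite enc_list_graph.
- have h : ptime (fun n => size (vars n)).
    apply: (@ptime_size _ (fact M) _ (enc_fact M)); apply: ptime_tab_vars; apply: pT.
    exact: ptime_id.
  by rewrite /K; pt.
- move=> X; have h1 := tab_vars_uniq M (T (len X)).
  have h2 := tab_vars_gt0 M (T (len X)).
  by apply: sat_connected.
move=> n X X0 Xn; have TLn := TL n.
have ln : len X = n by rewrite /len; case: X X0 Xn => // x X _; apply; rewrite mem_head.
have h1 := tab_vars_uniq M (T n); have h2 := tab_vars_gt0 M (T n).
have vin c l : c \in cnf X -> l \in c -> l.2 \in vars n.
  by rewrite /cnf ln => hc hl; apply: (@tab_vars_in M (T n) n (P n) X TLn c l hc hl).
rewrite /G /K ln; apply: (iff_trans (sat_identifiable h1 h2 vin)).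
rewrite /cnf ln; split=> [hs|[x hx /hL [y [hy hv]]]].
  have [x [y [hx hy ha]]] := tab_sound TLn X0 Xn hs.
  exists x => //; apply/hL; exists y; rewrite (Xn x hx); split=> //.
  by apply/(hacc n x y (Xn x hx) hy).
rewrite (Xn x hx) in hy.
have ha : accepting M (T n) x y by apply/(hacc n x y (Xn x hx) hy).
by apply: tab_complete ha.
Qed.

Lemma enc_instance_inj (G H : graph) k l : enc_instance (G, k) = enc_instance (H, l) ->
  enc_graph G = enc_graph H /\ k = l.
Proof.
move=> e; have := congr1 unpair e; rewrite !pairsK => -[-> el]; split=> //.
by rewrite -(enc_nat_value k) /= el enc_nat_value.
Qed.

Lemma clique_identification_hard (C : graph -> Prop) :
  (forall G, connected G -> C G) -> NP_hard (clique_identification C).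
Proof.
move=> hC L /NP_composition [[G K pG pK cG hG] _].
exists (fun x => enc_instance (G [:: x], K (size x))); split.
  apply: ptime_polytime; apply (ptime_app2 ptime_pairs).
    by apply: (ptime_comp pG (f := fun x => [:: x])); pt.
  by have h := ptime_comp ptime_enc_nat (ptime_comp pK (ptime_size ptime_id)); exact: h.
move=> x; have hx : clique_identifiable (G [:: x]) (K (size x)) <-> L x.
  rewrite hG //; last by move=> y; rewrite inE => /eqP ->.
  by split=> [[y]|h]; [rewrite inE => /eqP ->|exists x; rewrite ?mem_head].
split=> [/hx h|[H [k [/enc_instance_inj [e <-] _ h]]]].
  by exists (G [:: x]), (K (size x)); split=> //; apply: hC.
by apply/hx; have [i _] := enc_graph_iso (esym e); apply: i.
Qed.


(** * Distillation *)

Section Cover.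
Variables (T Y : finType) (t : nat) (F : {ffun 'I_t -> T} -> Y).
Hypotheses (t_gt0 : 0 < t) (Y_small : #|Y| <= 2 ^ t).

Definition covered (K : {set T}) (y : Y) : {set T} :=
  [set x in K | [exists X : {ffun 'I_t -> T},
    [&& X \in ffun_on (mem K), F X == y & [exists i, X i == x]]]].

(* The tuples over [K] mapped to [y] are tuples over [covered K y], and there are
   only [2 ^ t] values [y]. *)
Lemma cover_half (K : {set T}) : 0 < #|K| -> exists y, #|K| <= 2 * #|covered K y|.
Proof.
move=> K0; case: (boolP [exists y, #|K| <= 2 * #|covered K y|]) => [/existsP //|].
rewrite negb_exists => /forallP hy; exfalso.
(* If [y] covers less than half of [K], then twice the covered part is at most [#|K|.-1]. Raised to
   the power [t], this absorbs the factor [2 ^ t] and stays below [#|K| ^ t]. *)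
have hpre y : 2 ^ t * #|[set X in ffun_on (mem K) | F X == y]| <= #|K|.-1 ^ t.
  have h1 : #|[set X in ffun_on (mem K) | F X == y]| <= #|covered K y| ^ t.
    have -> : #|covered K y| ^ t =
        #|[set X : {ffun 'I_t -> T} | X \in ffun_on (mem (covered K y))]|.
      have h := @card_ffun_on 'I_t T (mem (covered K y)); rewrite card_ord in h.
      exact: (etrans (esym h) (esym (cardsE _))).
    apply/subset_leq_card/subsetP => X; rewrite inE => /andP[hX hF].
    rewrite inE; apply/ffun_onP => i; rewrite !inE; apply/andP; split; first by apply: (ffun_onP hX).
    by apply/existsP; exists X; rewrite hX hF; apply/existsP; exists i.
  apply: leq_trans (leq_mul (leqnn _) h1) _; rewrite -expnMn leq_exp2r //.
  by have := hy y; lia.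
have hsum : #|K| ^ t = \sum_y #|[set X in ffun_on (mem K) | F X == y]|.
  have -> : #|K| ^ t = #|[set X : {ffun 'I_t -> T} | X \in ffun_on (mem K)]|.
    have h := @card_ffun_on 'I_t T (mem K); rewrite card_ord in h.
    exact: (etrans (esym h) (esym (cardsE _))).
  rewrite -sum1_card (partition_big F predT) //=; apply: eq_bigr => y _.
  by rewrite -sum1_card; apply: eq_bigl => X; rewrite !inE.
have : 2 ^ t * #|K| ^ t <= 2 ^ t * #|K|.-1 ^ t.
  rewrite {1}hsum big_distrr /=; apply: (@leq_trans (\sum_(y : Y) #|K|.-1 ^ t)).
    by apply: leq_sum => y _; apply: hpre.
  by rewrite sum_nat_const leq_mul2r Y_small orbT.
rewrite leq_mul2l expn_eq0 /= leq_exp2r //.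
by lia.
Qed.

(** Each value from [cover_half] leaves at most half of [K] uncovered, so [n] values exhaust fewer
    than [2 ^ n] elements. [K] shrinks, while the tuples are only required to lie over the fixed
    [K0]. *)
Lemma cover n (K0 K : {set T}) : K \subset K0 -> #|K| < 2 ^ n ->
  exists S : seq Y, [/\ size S <= n,
    forall y, y \in S -> exists2 X : {ffun 'I_t -> T}, (forall i, X i \in K0) & F X = y
  & forall x, x \in K -> exists X : {ffun 'I_t -> T},
      [/\ forall i, X i \in K0, exists i, X i = x & F X \in S]].
Proof.
elim: n K => [|n IH] K sK hK.
  exists [::]; split=> // x hx.
  by move: hK; rewrite expn0 ltnS leqn0 cards_eq0 => /eqP e; rewrite e inE in hx.
case: (posnP #|K|) => [/eqP|K0']; first rewrite cards_eq0 => /eqP ->.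
  by exists [::]; split=> // x; rewrite inE.
have [y hy] := cover_half K0'.
have cZ : #|K :\: covered K y| < 2 ^ n.
  have sZ : covered K y \subset K by apply/subsetP => x; rewrite inE => /andP[].
  have h1 : #|K :&: covered K y| = #|covered K y| by rewrite (setIidPr sZ).
  by have := cardsID (covered K y) K; rewrite h1; move: hK; rewrite expnS; lia.
have [|S [S1 S2 S3]] := IH (K :\: covered K y) _ cZ.
  by apply: subset_trans sK; apply: subsetDl.
have hcov x : x \in covered K y -> exists X : {ffun 'I_t -> T},
    [/\ forall i, X i \in K0, exists i, X i = x & F X = y].
  rewrite inE => /andP[_ /existsP [X /and3P[/ffun_onP hX /eqP hF /existsP [i /eqP hi]]]].
  exists X; split=> //; last by exists i.
  by move=> j; apply: (subsetP sK); apply: hX.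
exists (y :: S); split=> //.
  move=> z; rewrite in_cons => /orP[/eqP ->|/S2 //].
  have /card_gt0P [x hx] : 0 < #|covered K y| by lia.
  by have [X [h1 _ h2]] := hcov x hx; exists X.
move=> x hx; case: (boolP (x \in covered K y)) => [/hcov [X [h1 h2 h3]]|hn].
  by exists X; split=> //; rewrite h3 mem_head.
have [|X [h1 h2 h3]] := S3 x; first by rewrite in_setD hn.
by exists X; split=> //; rewrite in_cons h3 orbT.
Qed.

End Cover.

(** The last [true] marks the end of [y]. Strings of length at most [s] thus embed into those of
    length exactly [s.+1], of which there are [2 ^ s.+1]: the size that tuples of [s.+1] words
    tolerate. *)
Definition pad (s : nat) (y : seq bool) : seq bool := y ++ true :: nseq (s - size y) false.

Definition unpad (z : seq bool) : seq bool := rev (drop (find id (rev z)).+1 (rev z)).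

Lemma padK s y : unpad (pad s y) = y.
Proof.
rewrite /unpad /pad rev_cat rev_cons -cats1 -catA rev_nseq /=.
have -> : find id (nseq (s - size y) false ++ true :: rev y) = s - size y.
  by elim: (s - size y) => //= k ->.
rewrite -cat_rcons -cats1 drop_size_cat ?revK //.
by rewrite size_cat size_nseq addn1.
Qed.

Lemma size_pad s y : size y <= s -> size (pad s y) = s.+1.
Proof. by move=> h; rewrite size_cat /= size_nseq; lia. Qed.

Lemma ptime_nat_bound (h : nat -> nat) : ptime h -> exists k, forall n, h n <= (n + 2) ^ k.
Proof.
move=> /ptime_sz [k hk]; exists (2 * k) => n; apply: (@leq_trans (sz (h n))).
  by rewrite sz_nat; lia.
apply: (leq_trans (hk n)); rewrite sz_nat expnM; case: (k) => // k'; rewrite leq_exp2r //.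
by rewrite -mulnn; nia.
Qed.

Lemma enc_param_instance_iso (i j : graph * nat) :
  enc_param_instance i = enc_param_instance j ->
  clique_identifiable i.1 i.2 -> clique_identifiable j.1 j.2.
Proof.
case: i j => [G k] [H l] e; have := congr1 unpair e; rewrite !pairsK => -[eg /(congr1 size)].
by rewrite !size_nseq /= => ->; have [h _] := enc_graph_iso eg; apply: h.
Qed.

Section Distillation.
Variables (L : language) (C : composition (fun x => ~ L x)).
Variables (f : graph * nat -> graph * nat) (g : seq bool -> seq bool) (q : {poly nat}).
Let inst (X : seq (seq bool)) : graph * nat :=
  (comp_graph C X, comp_param C (size (head [::] X))).
Hypotheses (g_ptime : ptime g)
  (g_f : forall X, g (enc_param_instance (inst X)) = enc_param_instance (f (inst X)))
  (f_yes : forall X, clique_identifiable (f (inst X)).1 (f (inst X)).2 <->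
                     clique_identifiable (inst X).1 (inst X).2)
  (f_size : forall X, size (enc_param_instance (f (inst X))) <= horner q (inst X).2).

Let A (X : seq (seq bool)) : seq bool := g (enc_param_instance (inst X)).
Let s (n : nat) : nat := horner q (comp_param C n).

Lemma distill_ptime : ptime A.
Proof.
apply: (ptime_comp g_ptime); apply (ptime_app2 ptime_pairs); first exact: comp_graph_ptime.
apply: ptime_nseq; last exact: ptime_const.
by apply: (ptime_comp (comp_param_ptime C)); pt.
Qed.

Lemma head_size n (X : seq (seq bool)) : 0 < size X -> (forall x, x \in X -> size x = n) ->
  size (head [::] X) = n.
Proof. by case: X => // x X _; apply; rewrite mem_head. Qed.

Lemma distill_yes n (X : seq (seq bool)) : 0 < size X -> (forall x, x \in X -> size x = n) ->
  (clique_identifiable (f (inst X)).1 (f (inst X)).2 <-> exists2 x, x \in X & ~ L x).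
Proof.
move=> X0 Xn; rewrite f_yes /inst /= (head_size X0 Xn).
exact: comp_correct X0 Xn.
Qed.

(** The covering lemma for the words of [L] of length [n], tuples of length [s n + 1], and padded
    kernel outputs as values. There are at most [2 ^ n] such words, hence the bound [n.+1]. *)
Lemma advice_list n : exists l : seq (seq bool), [/\ size l <= n.+1,
    all (fun y => size y <= s n) l,
    forall y, y \in l -> exists X, [/\ 0 < size X, forall x, x \in X -> size x = n,
       forall x, x \in X -> L x & A X = y]
  & forall x, size x = n -> L x -> exists X, [/\ x \in X, forall z, z \in X -> size z = n,
       size X = (s n).+1 & A X \in l]].
Proof.
pose T : finType := n.-tuple bool; pose t := (s n).+1; pose Y : finType := t.-tuple bool.
pose ofX (X : {ffun 'I_t -> T}) : seq (seq bool) := [seq tval (X i) | i <- enum 'I_t].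
have ofX_size X : size (ofX X) = t by rewrite size_map size_enum_ord.
have ofX0 X : 0 < size (ofX X) by rewrite ofX_size.
have ofXn X x : x \in ofX X -> size x = n by case/mapP=> i _ ->; apply: size_tuple.
have sA X : size (A (ofX X)) <= s n.
  rewrite /A g_f; apply: leq_trans (f_size _) _.
  by rewrite /inst /= (head_size (ofX0 X) (@ofXn X)).
have szp X : size (pad (s n) (A (ofX X))) == t by rewrite size_pad.
pose F (X : {ffun 'I_t -> T}) : Y := Tuple (szp X).
have unF X : unpad (F X) = A (ofX X) by apply: padK.
(* [L] need not be decidable, so the finite set of its words is formed by excluded middle. *)
pose K := [set x : T | if excluded_middle_informative (L x) then true else false].
have KP x : reflect (L (tval x)) (x \in K).
  by rewrite inE; case: excluded_middle_informative => h; constructor.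
have cK : #|K| < 2 ^ n.+1.
  apply: leq_ltn_trans (max_card _) _.
  by rewrite card_tuple card_bool ltn_exp2l.
have cY : #|Y| <= 2 ^ t by rewrite card_tuple card_bool.
have [S [S1 S2 S3]] := @cover T Y t F isT cY n.+1 K K (subxx K) cK.
exists [seq unpad y | y : Y <- S]; split.
- by rewrite size_map.
- by apply/allP => y /mapP [z /S2 [X _ <-] ->]; rewrite unF.
- move=> y /mapP [z /S2 [X hX <-] ->]; exists (ofX X); rewrite unF; split=> //.
    exact: ofXn.
  by move=> x /mapP [i _ ->]; apply/KP.
move=> x hx Lx; have hx' : size x == n by apply/eqP.
have [|X [h1 [i hi] h2]] := S3 (Tuple hx'); first exact/KP.
exists (ofX X); split=> //.
- by apply/mapP; exists i; rewrite ?mem_enum // hi.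
- exact: ofXn.
by rewrite -unF; apply: map_f.
Qed.

(** Advice need not be computable, so it is obtained by choice. *)
Let adv (n : nat) : seq (seq bool) :=
  proj1_sig (constructive_indefinite_description _ (advice_list n)).

(** [v] consists of the input with its advice, followed by a guessed list of words. Words of the
    wrong length are discarded, since the composition is only correct for words of equal length. *)
Definition accept_check (v : seq bool) : bool :=
  let w := (unpair v).1 in
  let X := [seq r <- decl (unpair v).2 | size r == size (unpair w).1] in
  ((unpair w).1 \in X) && (A X \in decl (unpair w).2).

Lemma accept_pairs x a c : accept_check (pairs (pairs x a) c) =
  (x \in [seq r <- decl c | size r == size x]) &&
  (A [seq r <- decl c | size r == size x] \in decl a).
Proof.
by rewrite /accept_check; cbv zeta; rewrite pairsK; cbn [fst snd]; rewrite pairsK.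
Qed.

Lemma accept_ptime : ptime accept_check.
Proof.
have hX : ptime (fun v => [seq r <- decl (unpair v).2 | size r == size (unpair (unpair v).1).1]).
  by pt.
have hA := ptime_comp distill_ptime hX.
by rewrite /accept_check; cbv zeta; pt.
Qed.

(** The advice lists kernel outputs of tuples over [L], and the certificate is a tuple containing
    [x] whose kernel output is listed. Such an output is a negative instance, so the tuple cannot
    contain a word outside [L]. *)
Lemma distillation : class_NPpoly L.
Proof.
have ps : ptime s by apply: ptime_horner; apply: comp_param_ptime.
have [k hk] := ptime_nat_bound ps; have [p hp] := poly_above (k + 3).
(* The first bound is for the advice, at most [n.+1] strings of length at most [s n]; the second is
   for the certificate, [(s n).+1] words of length [n]. *)
have bnd n : n.+1 * (2 * s n + 2) <= (n + 2) ^ (k + 3) /\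
    (s n).+1 * (2 * n + 2) <= (n + 2) ^ (k + 3).
  have e : (n + 2) ^ (k + 3) = (n + 2) ^ k * ((n + 2) * ((n + 2) * (n + 2))).
    by rewrite expnD !expnS expn0 muln1.
  have h1 := hk n; have h2 : 0 < (n + 2) ^ k by rewrite expn_gt0 addn2.
  have h3 : (s n).+1 <= 2 * (n + 2) ^ k by lia.
  have h4 : (s n).+1 * (2 * (n + 2)) <= 2 * (n + 2) ^ k * (2 * (n + 2)).
    by rewrite leq_mul2r h3 orbT.
  have h5 : 2 * (n + 2) ^ k * (2 * (n + 2)) <= (n + 2) ^ (k + 3).
    rewrite e mulnACA [2 * _ * _]mulnC -!mulnA leq_mul2l; apply/orP; right.
    by nia.
  by split; apply: leq_trans h5; apply: leq_trans h4; nia.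
pose adv_P n := proj2_sig (constructive_indefinite_description _ (advice_list n)).
exists (fun w => exists c, size c <= horner p (size w) /\ accept_check (pairs w c)).
exists (fun n => encl (adv n)), p; split.
- by exists accept_check, p; split=> //; apply: ptime_class_P accept_ptime.
- move=> n; have [h1 h2 _ _] := adv_P n; rewrite hp.
  apply: leq_trans (size_encl h2) _; apply: leq_trans (bnd n).1.
  by rewrite leq_mul2r h1 orbT.
move=> x; have [a1 a2 a3 a4] := adv_P (size x); split=> [Lx|[c [_]]].
  have [X [h1 h2 h3 h4]] := a4 x erefl Lx; exists (encl X); split.
    have hX : all (fun z => size z <= size x) X by apply/allP => z /h2 ->.
    rewrite hp; apply: leq_trans (size_encl hX) _; rewrite h3.
    apply: leq_trans (bnd (size x)).2 _.
    case: (k + 3) => // k'; rewrite leq_exp2r // size_pairs; lia.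
  rewrite accept_pairs !enclK.
  have -> : [seq r <- X | size r == size x] = X.
    by apply/all_filterP/allP => z /h2 ->.
  by rewrite h1.
rewrite accept_pairs enclK; set X := filter _ _ => /andP[xX hX].
have Xn z : z \in X -> size z = size x by rewrite mem_filter => /andP[/eqP].
have X0 : 0 < size X by move: xX; case: (X).
have [X' [h1 h2 h3 h4]] := a3 _ hX.
(* Were [x] outside [L], the kernel of [X] would be positive; the tuple [X'] over [L] has the same
   output, hence contains a word outside [L]. *)
apply: NNPP => nLx.
have yX : clique_identifiable (f (inst X)).1 (f (inst X)).2.
  by apply/(distill_yes X0 Xn); exists x.
have e : enc_param_instance (f (inst X)) = enc_param_instance (f (inst X')).
  by rewrite -!g_f; apply: esym h4.
have := enc_param_instance_iso e yX.
by move/(distill_yes h1 h2) => [z /h3 Lz nLz].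
Qed.

End Distillation.

(** For [L] in coNP the composition is applied to the complement of [L]. Its graphs are connected,
    hence in the domain on which the kernelization is guaranteed. *)
Lemma kernel_collapse (D : graph -> Prop) : (forall G, connected G -> D G) ->
  clique_identification_poly_kernel D -> coNP_sub_NPpoly.
Proof.
move=> hD [f [hf hyes [q hq]]] L /NP_composition [C _].
have [g pg hg] := polytime_on_ptime hf.
have dom X : D (comp_graph C X) by apply/hD/comp_connected.
apply: (@distillation L C f g q pg) => X.
- by apply: hg; apply: dom.
- by apply: hyes; apply: dom.
by apply: hq; apply: dom.
Qed.

Theorem theorem4p1 :
  [/\ NP_complete (clique_identification any_graph),
      clique_identification_poly_kernel any_graph -> coNP_sub_NPpoly,
      NP_complete (clique_identification connected)
    & clique_identification_poly_kernel connected -> coNP_sub_NPpoly].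
Proof.
split.
- split; last by apply: clique_identification_hard.
  by apply: (@clique_identification_NP _ false).
- by apply: kernel_collapse.
- split; last by apply: clique_identification_hard.
  by apply: (@clique_identification_NP _ true) => G; split=> [h _|]; [|apply].
- by apply: kernel_collapse.
Qed.
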